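(* Let $L$ be a numerical semigroup with $G(L)=\{a_1,\dots,a_{n-1}\}$, let $c>1$ and $\ell$ be integers with $\gcd(c,\ell)=1$ and $\ell\in L\setminus G(L)$, and let $H=\langle cL,\ell\rangle$ (the numerical semigroup generated by $ca_1,\dots,ca_{n-1},\ell$, which are its minimal generators). Let $f=x_n^c-\prod_{i=1}^{n-1}x_i^{\lambda_i}$ be a gluing relation, where $\ell=\sum_{i=1}^{n-1}\lambda_i a_i$ with $\lambda_i\geq 0$ and $\sum\lambda_i=\operatorname{ord}_L(\ell)$. If $c\leq\operatorname{ord}_L(\ell)$, then: (a) $I_H^*=(I_L^*S,f^* )$; (b) $H$ is quadratic if and only if $c=2$ and $L$ is quadratic; (c) $H$ is Koszul if and only if $c=2$ and $L$ is Koszul; (d) $I_H^*$ has a Gröbner basis of quadrics (with respect to some term order) if and only if $c=2$ and $I_L^*$ has a Gröbner basis of quadrics (with respect to some term order).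
   Context: A numerical semigroup is a submonoid of $\mathbb{N}$ with finite complement; $G(\cdot)$ denotes the minimal generating set. $K$ is a field; for a numerical semigroup $M$, $K[M]=\bigoplus_{h\in M}Kt^h$ with maximal ideal $\mathfrak m$ generated by $t^h$, $h\in M\setminus\{0\}$. Here $I_L\subseteq K[x_1,\dots,x_{n-1}]$ is the kernel of $x_i\mapsto t^{a_i}$, and $I_H\subseteq S=K[x_1,\dots,x_n]$ is the kernel of $x_i\mapsto t^{ca_i}$ ($i<n$), $x_n\mapsto t^{\ell}$. For a nonzero polynomial $g$, $g^*$ is its homogeneous component of least degree, and $I^*=(g^*:0\ne g\in I)$; $\operatorname{gr}_{\mathfrak m}K[M]\cong$ polynomial ring$/I_M^*$. $\operatorname{ord}_L(\ell)$ is the largest value of $\sum_i\lambda_i$ over all expressions $\ell=\sum_{i=1}^{n-1}\lambda_ia_i$ with nonnegative integers $\lambda_i$. A numerical semigroup $M$ is quadratic if $I_M^*$ is generated by homogeneous polynomials of degree 2, and Koszul if the standard graded $K$-algebra $R=\operatorname{gr}_{\mathfrak m}K[M]$ is Koszul, i.e. $K=R/\mathfrak m_R$ has a linear free resolution over $R$. *)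

(* Defs.v *)
From HB Require Import structures.
From mathcomp Require Import all_boot all_algebra.
From mathcomp Require Import mpoly.

Set Implicit Arguments.
Unset Strict Implicit.
Unset Printing Implicit Defensive.

Import GRing.Theory.
Local Open Scope ring_scope.

Definition numerical_semigroup (M : nat -> Prop) : Prop :=
  [/\ M 0%N,
      (forall x y, M x -> M y -> M (x + y)%N)
    & exists N, forall x, (N <= x)%N -> M x].

Definition min_gen (M : nat -> Prop) (x : nat) : Prop :=
  [/\ M x, (0 < x)%N &
      ~ (exists y z, [/\ M y, M z, (0 < y)%N, (0 < z)%N & x = (y + z)%N])].

Definition expr_of (m : nat) (a : 'I_m -> nat) (l : nat) (lam : 'I_m -> nat) :=
  l = (\sum_(i < m) lam i * a i)%N.

Definition ord_spec (m : nat) (a : 'I_m -> nat) (l k : nat) : Prop :=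
  (exists lam, expr_of a l lam /\ (\sum_(i < m) lam i)%N = k) /\
  (forall lam, expr_of a l lam -> (\sum_(i < m) lam i <= k)%N).

Section Ideals.
Variables (K : fieldType) (n : nat).

Definition ideal_gen (P : {mpoly K[n]} -> Prop) : {mpoly K[n]} -> Prop :=
  fun p => exists s : seq ({mpoly K[n]} * {mpoly K[n]}),
    (forall q, q \in s -> P q.2) /\ p = \sum_(q <- s) q.1 * q.2.

Definition same_ideal (I J : {mpoly K[n]} -> Prop) : Prop :=
  forall p, I p <-> J p.

Definition toric_ker (a : 'I_n -> nat) : {mpoly K[n]} -> Prop :=
  fun p => mmap (fun c : K => c%:P) (fun i => 'X^(a i)) p = 0 :> {poly K}.

Definition lowdeg (p : {mpoly K[n]}) : nat :=
  foldr minn (msize p) [seq mdeg u | u <- msupp p].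

Definition init_form (p : {mpoly K[n]}) : {mpoly K[n]} :=
  \sum_(u <- msupp p | mdeg u == lowdeg p) p@_u *: 'X_[u].

Definition tangent_ideal (I : {mpoly K[n]} -> Prop) : {mpoly K[n]} -> Prop :=
  ideal_gen (fun q => exists g, [/\ I g, g != 0 & q = init_form g]).

Definition homog_of_deg (d : nat) (p : {mpoly K[n]}) : Prop :=
  forall u, u \in msupp p -> mdeg u = d.

Definition quadratic_ideal (J : {mpoly K[n]} -> Prop) : Prop :=
  exists Q : {mpoly K[n]} -> Prop,
    (forall q, Q q -> homog_of_deg 2 q) /\ same_ideal J (ideal_gen Q).

(* Koszulness of R = K[x]/J : the residue field K = R/m_R has a linear
   graded free resolution  ... -> R(-2)^(b 2) -> R(-1)^(b 1) -> R^(b 0) = R -> K -> 0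
   over R.  The differential F_(i+1) -> F_i is given (on column vectors,
   v |-> d i *m v) by a matrix of linear forms, all computations mod J. *)
Definition koszul_quot (J : {mpoly K[n]} -> Prop) : Prop :=
  exists (b : nat -> nat) (d : forall i, 'M[{mpoly K[n]}]_(b i, b i.+1)),
  [/\ b 0%N = 1%N,
      (forall i j k, homog_of_deg 1 (d i j k)),
      (forall i j k, J ((d i *m d i.+1) j k)),
      (* image of F_1 -> F_0 = kernel of R -> K *)
      (forall u : 'cV[{mpoly K[n]}]_(b 0%N),
          (exists v : 'cV[{mpoly K[n]}]_(b 1%N),
              forall j, J ((u - d 0%N *m v) j 0)) <->
          (forall j, exists q, J q /\ (u j 0 - q)@_(0%MM) = 0))
    &
      (forall i (v : 'cV[{mpoly K[n]}]_(b i.+1)),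
          (forall j, J ((d i *m v) j 0)) ->
          exists w : 'cV[{mpoly K[n]}]_(b i.+2),
              forall j, J ((v - d i.+1 *m w) j 0))].

Definition term_order (r : rel 'X_{1..n}) : Prop :=
  [/\ (forall u v, r u v || r v u),
      (forall u v, r u v -> r v u -> u = v),
      (forall u v w, r u v -> r v w -> r u w),
      (forall u v w, r u v -> r (u + w)%MM (v + w)%MM)
    & (forall u, r 0%MM u)].

Definition is_lm (r : rel 'X_{1..n}) (p : {mpoly K[n]}) (u : 'X_{1..n}) : Prop :=
  u \in msupp p /\ forall v, v \in msupp p -> r v u.

Definition mdivides (u v : 'X_{1..n}) : Prop := forall i, (u i <= v i)%N.

Definition groebner_basis (r : rel 'X_{1..n}) (J : {mpoly K[n]} -> Prop)
    (G : seq {mpoly K[n]}) : Prop :=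
  (forall g, g \in G -> J g) /\
  (forall p, J p -> p != 0 ->
     exists g u v, [/\ g \in G, is_lm r g u, is_lm r p v & mdivides u v]).

Definition has_quadratic_GB (J : {mpoly K[n]} -> Prop) : Prop :=
  exists (r : rel 'X_{1..n}) (G : seq {mpoly K[n]}),
    [/\ term_order r, groebner_basis r J G & forall g, g \in G -> homog_of_deg 2 g].

End Ideals.

(* The gluing construction: S = K[x_1..x_m, x_(m+1)] with x_(m+1) = x_n. *)

Definition glue_gens (m c l : nat) (a : 'I_m -> nat) : 'I_m.+1 -> nat :=
  fun i => match unlift ord_max i with Some j => (c * a j)%N | None => l end.

Definition xvar (K : fieldType) (m : nat) (i : 'I_m) : {mpoly K[m.+1]} :=
  'X_(widen_ord (leqnSn m) i).

Definition emb (K : fieldType) (m : nat) (p : {mpoly K[m]}) : {mpoly K[m.+1]} :=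
  mmap (fun c : K => c%:MP) (@xvar K m) p.

Definition glue_rel (K : fieldType) (m c : nat) (lam : 'I_m -> nat) : {mpoly K[m.+1]} :=
  'X_(ord_max) ^+ c - \prod_(i < m) xvar K i ^+ lam i.

(* Main.v *)
Require Import Defs.
From HB Require Import structures.
From mathcomp Require Import all_boot all_algebra.
From mathcomp Require Import ring zify.
From mathcomp Require Import mpoly.
From Stdlib Require Import ClassicalEpsilon Classical.
From Stdlib Require Import FunctionalExtensionality PropExtensionality.

Set Implicit Arguments.
Unset Strict Implicit.
Unset Printing Implicit Defensive.

Import GRing.Theory.
Local Open Scope ring_scope.

(* Write y for the last variable, mu for the degree c part of x^lam, R = K[x]/I_L^* and
   R' = K[x, y]/I_H^*. Dividing an element of I_H by f does not lower orders because c <= ord l,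
   and the coefficients of the remainder lie in I_L since the multiples of l by 0, ..., c - 1 are
   distinct modulo c; the components of least degree give I_H^* = (I_L^*, y^c - mu), so that
   R' = R[y]/(y^c - mu). Sending x to 0 maps I_H^* onto (y^c), and this excludes c > 2 in (b)-(d).

   For c = 2, mu is zero or a monomial, so mu = p q with p, q linear forms. If F is a minimal
   linear complex over R, multiplication by q is null-homotopic on F through scalar matrices h,
   and h h = 0 by uniqueness of scalar liftings. Hence the modules G_(i+1) = F_(i+1) + G_i over R'
   carry an explicit linear differential built from y and p h, without higher homotopies, which is
   exact as far as F is. If R' is Koszul, G is isomorphic to the resolution of K as far as it is
   exact, and splitting its linear syzygies into their components along 1 and y shows that the
   next syzygies of F are linear.

   For Groebner bases, a quadratic basis of I_H^* whose leading monomials do not allow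
   elimination of y consists of quadrics of I_L^* and of elements y^2 - s' whose leading monomial
   u is free of y. Then the polynomials s'^j x^w, with u^j x^w divisible by no leading monomial of
   a quadric of I_L^*, correspond modulo I_H^* to the standard monomials y^(2j) x^w, hence are
   linearly independent modulo I_L^*; as their leading monomials are the u^j x^w, no leading
   monomial of I_L^* can be among these. *)

(** * Linear complexes over a standard graded algebra *)

(** The shape of G comes from the exact sequence 0 -> K(-1) -> K[y]/(y^2) -> K -> 0 over R'. As R'
    is free over R, F tensored with R' resolves K[y]/(y^2) whenever F resolves K, and the cone of a
    lift of multiplication by y, from G to this complex, resolves K again: hence the recursion
    G_(i+1) = F_(i+1) + G_i. Such a lift has to absorb y^2 = mu by a null-homotopy of mu; taking it
    of the form p h with h scalar makes it linear and of square zero, so that the lift has a closed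
    form. The descent from R' to R is an induction on the exactness of F, so F cannot be a
    resolution given beforehand. It is obtained by repeatedly taking a basis of all linear syzygies,
    which is possible over any R, and R is Koszul as soon as it is exact. The chain and exactness
    statements on G therefore carry a bound [s]. Full gradings are avoided: all matrices in play are
    linear or scalar, so constant and linear parts suffice. *)

Lemma col_mulmx (R : pzSemiRingType) p q r (A : 'M[R]_(p, q)) (B : 'M_(q, r)) j :
  col j (A *m B) = A *m col j B.
Proof. by apply/matrixP => i k; rewrite !mxE; apply: eq_bigr => l _; rewrite !mxE. Qed.

(** Applied below to relations that are total because they are implications; that their premises
    hold is proved afterwards, by induction along the chosen sequence. *)
Lemma dep_choice (T : nat -> Type) (P : forall i, T i -> T i.+1 -> Prop) (x0 : T 0%N) :
  (forall i x, exists y, P i x y) ->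
  exists2 f : forall i, T i, f 0%N = x0 & forall i, P i (f i) (f i.+1).
Proof.
move=> H; pose nx i x := constructive_indefinite_description _ (H i x).
exists (nat_rect T x0 (fun i x => proj1_sig (nx i x))) => // i.
exact: (proj2_sig (nx i _)).
Qed.

(* The features of a standard graded K-algebra used by the resolutions below:
   [linpart] is the projection onto the degree one component. *)
Record graded_alg (K : fieldType) (R : comNzRingType) (n : nat) := GradedAlg {
  scal : {rmorphism K -> R};
  aug : {rmorphism R -> K};
  var : 'I_n -> R;
  linpart : {additive R -> R};
  augK : forall k, aug (scal k) = k;
  aug_var : forall i, aug (var i) = 0;
  aug_ker : forall u, aug u = 0 -> exists v, u = \sum_i var i * v i;
  var_free : forall c : 'I_n -> K, \sum_i scal (c i) * var i = 0 -> forall i, c i = 0;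
  linpart_var : forall i w, linpart (var i * w) = var i * scal (aug w) }.

Section GradedAlg.
Variables (K : fieldType) (R : comNzRingType) (n : nat) (G : graded_alg K R n).
Local Notation sc := (scal G).
Local Notation ag := (aug G).

Definition lin (r : R) : Prop := exists c : 'I_n -> K, r = \sum_i sc (c i) * var G i.

Definition linmx p q (D : 'M[R]_(p, q)) : Prop := forall i j, lin (D i j).

Lemma lin_var i : lin (var G i).
Proof.
exists (fun j => (j == i)%:R); rewrite (bigD1 i) //= eqxx rmorph1 mul1r big1 ?addr0 //.
by move=> j /negbTE->; rewrite rmorph0 mul0r.
Qed.

Lemma lin0 : lin 0.
Proof. by exists (fun=> 0); rewrite big1 // => i _; rewrite rmorph0 mul0r. Qed.

Lemma linD r s : lin r -> lin s -> lin (r + s).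
Proof.
move=> [c ->] [d ->]; exists (fun i => c i + d i); rewrite -big_split /=.
by apply: eq_bigr => i _; rewrite rmorphD mulrDl.
Qed.

Lemma lin_scal k r : lin r -> lin (sc k * r).
Proof.
move=> [c ->]; exists (fun i => k * c i); rewrite mulr_sumr.
by apply: eq_bigr => i _; rewrite rmorphM mulrA.
Qed.

Lemma linN r : lin r -> lin (- r).
Proof. by move=> /(lin_scal (-1)); rewrite rmorphN1 mulN1r. Qed.

Lemma linB r s : lin r -> lin s -> lin (r - s).
Proof. by move=> lr /linN; apply: linD. Qed.

Lemma lin_sum I (s : seq I) (P : pred I) F :
  (forall i, P i -> lin (F i)) -> lin (\sum_(i <- s | P i) F i).
Proof. by move=> H; elim/big_ind: _ => //; [exact: lin0 | exact: linD]. Qed.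

Lemma aug_lin r : lin r -> ag r = 0.
Proof.
by move=> [c ->]; rewrite rmorph_sum big1 // => i _; rewrite rmorphM aug_var mulr0.
Qed.

Lemma linpart_mul r w : lin r -> linpart G (r * w) = r * sc (ag w).
Proof.
move=> [c ->]; rewrite !mulr_suml raddf_sum; apply: eq_bigr => i _ /=.
by rewrite mulrAC mulrC linpart_var rmorphM augK rmorphM; ring.
Qed.

Lemma linpart_lin r : lin r -> linpart G r = r.
Proof. by move=> lr; have := linpart_mul 1 lr; rewrite mulr1 !rmorph1 mulr1. Qed.

Local Notation cmx M := (map_mx sc M).

(** The linear part of [D *m W] only sees the constant part of [W]. This is why lifts of linear
    matrices along linear differentials can always be chosen scalar. *)
Lemma linmx_lift p q r (D : 'M_(p, q)) (V : 'M_(p, r)) (W : 'M_(q, r)) :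
  linmx D -> linmx V -> V = D *m W -> V = D *m cmx (map_mx ag W).
Proof.
move=> lD lV E; apply/matrixP => i j.
rewrite -[LHS](linpart_lin (lV i j)) E !mxE raddf_sum.
by apply: eq_bigr => k _ /=; rewrite linpart_mul // !mxE.
Qed.

Lemma linmx_mull p q r (D : 'M_(p, q)) (C : 'M[K]_(q, r)) : linmx D -> linmx (D *m cmx C).
Proof.
move=> lD i j; rewrite mxE; apply: lin_sum => k _.
by rewrite mxE mulrC; apply: lin_scal.
Qed.

Lemma linmx_mulr p q r (D : 'M_(q, r)) (C : 'M[K]_(p, q)) : linmx D -> linmx (cmx C *m D).
Proof.
move=> lD i j; rewrite mxE; apply: lin_sum => k _.
by rewrite mxE; apply: lin_scal.
Qed.

Lemma linmxB p q (D E : 'M_(p, q)) : linmx D -> linmx E -> linmx (D - E).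
Proof. by move=> lD lE i j; rewrite !mxE; apply: linB. Qed.

Lemma linmxD p q (D E : 'M_(p, q)) : linmx D -> linmx E -> linmx (D + E).
Proof. by move=> lD lE i j; rewrite !mxE; apply: linD. Qed.

Lemma linmxN p q (D : 'M_(p, q)) : linmx D -> linmx (- D).
Proof. by move=> lD i j; rewrite !mxE; apply: linN. Qed.

Lemma linmx0 p q : linmx (0 : 'M_(p, q)).
Proof. by move=> i j; rewrite mxE; apply: lin0. Qed.

Lemma linmx_row_mx p q r (A : 'M_(p, q)) (B : 'M_(p, r)) :
  linmx A -> linmx B -> linmx (row_mx A B).
Proof. by move=> lA lB i j; rewrite mxE; case: split. Qed.

Lemma linmx_col_mx p q r (A : 'M_(q, p)) (B : 'M_(r, p)) :
  linmx A -> linmx B -> linmx (col_mx A B).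
Proof. by move=> lA lB i j; rewrite mxE; case: split. Qed.

Lemma linmx_scalar p r : lin r -> linmx (r%:M : 'M_p).
Proof. by move=> lr i j; rewrite mxE; case: eqP => _ //=; rewrite ?mulr0n //; apply: lin0. Qed.

Lemma linmx_scale_const p q r (C : 'M[K]_(p, q)) : lin r -> linmx (r *: cmx C).
Proof. by move=> lr i j; rewrite !mxE mulrC; apply: lin_scal. Qed.

Lemma aug_linmx p q (D : 'M_(p, q)) : linmx D -> map_mx ag D = 0.
Proof. by move=> lD; apply/matrixP => i j; rewrite !mxE aug_lin. Qed.

Lemma aug_cmx p q (C : 'M[K]_(p, q)) : map_mx ag (cmx C) = C.
Proof. by apply/matrixP => i j; rewrite !mxE augK. Qed.

Lemma cmx_inj p q (C C' : 'M[K]_(p, q)) : cmx C = cmx C' -> C = C'.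
Proof. by move=> E; rewrite -[C]aug_cmx E aug_cmx. Qed.

Section Complex.
Variables (b : nat -> nat) (d : forall i, 'M[R]_(b i, b i.+1)).

Definition exact_at0 : Prop := forall u : 'cV[R]_(b 0%N),
  (exists v : 'cV_(b 1%N), u = d 0%N *m v) <-> map_mx ag u = 0.

Definition exact_at i : Prop := forall v : 'cV[R]_(b i.+1),
  d i *m v = 0 -> exists w : 'cV_(b i.+2), v = d i.+1 *m w.

Definition exact_upto s : Prop := exact_at0 /\ forall i, (i < s)%N -> exact_at i.

Definition linear_complex : Prop :=
  (forall i, linmx (d i)) /\ (forall i, d i *m d i.+1 = 0).

(** For linear matrices the usual condition that images lie in the maximal ideal is automatic; what
    the arguments use is the uniqueness of scalar lifts. *)
Definition minimal : Prop := forall i (v : 'cV[K]_(b i.+1)), d i *m cmx v = 0 -> v = 0.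

Lemma exact_at0_mx r (V : 'M[R]_(b 0%N, r)) :
  exact_at0 -> map_mx ag V = 0 -> exists W, V = d 0%N *m W.
Proof.
move=> ex V0; have /fin_all_exists[w wP] (j : 'I_r) : exists w, col j V = d 0%N *m w.
  apply/(ex (col j V)); apply/matrixP => i k.
  by have /matrixP/(_ i j) := V0; rewrite !mxE.
exists (\matrix_(i, j) w j i 0); apply/matrixP => i j.
have /matrixP/(_ i 0) := wP j; rewrite !mxE => ->.
by apply: eq_bigr => k _; rewrite mxE.
Qed.

Lemma exact_at_mx i r (V : 'M[R]_(b i.+1, r)) :
  exact_at i -> d i *m V = 0 -> exists W, V = d i.+1 *m W.
Proof.
move=> ex V0; have /fin_all_exists[w wP] (j : 'I_r) : exists w, col j V = d i.+1 *m w.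
  by apply/(ex (col j V)); rewrite -col_mulmx V0 col0.
exists (\matrix_(i, j) w j i 0); apply/matrixP => k j.
have /matrixP/(_ k 0) := wP j; rewrite !mxE => ->.
by apply: eq_bigr => l _; rewrite mxE.
Qed.

Lemma lift_at0 r (V : 'M[R]_(b 0%N, r)) : (forall i, linmx (d i)) -> exact_at0 -> linmx V ->
  exists C : 'M[K]_(b 1%N, r), d 0%N *m cmx C = V.
Proof.
move=> ld ex lV; have [W E] := exact_at0_mx ex (aug_linmx lV).
by exists (map_mx ag W); rewrite -(linmx_lift (ld 0) lV E).
Qed.

Lemma lift_at i r (V : 'M[R]_(b i.+1, r)) : (forall i, linmx (d i)) -> exact_at i ->
  linmx V -> d i *m V = 0 -> exists C : 'M[K]_(b i.+2, r), d i.+1 *m cmx C = V.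
Proof.
move=> ld ex lV V0; have [W E] := exact_at_mx ex V0.
by exists (map_mx ag W); rewrite -(linmx_lift (ld i.+1) lV E).
Qed.

Lemma minimal_mx i r (C : 'M[K]_(b i.+1, r)) : minimal -> d i *m cmx C = 0 -> C = 0.
Proof.
move=> mn C0; apply/matrixP => k j.
have /mn/matrixP/(_ k 0) : d i *m cmx (col j C) = 0.
  by rewrite map_col -col_mulmx C0 col0.
by rewrite !mxE.
Qed.

Lemma exact_minimal : linear_complex -> (forall i, exact_at i) -> minimal.
Proof.
move=> [ld _] ex i v /ex[w /(congr1 (map_mx ag))].
by rewrite aug_cmx map_mxM aug_linmx // mul0mx.
Qed.

End Complex.

Definition koszul_alg : Prop :=
  exists (b : nat -> nat) (d : forall i, 'M[R]_(b i, b i.+1)),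
  [/\ b 0%N = 1%N, linear_complex d, exact_at0 d & forall i, exact_at d i].

(** The comparison theorem with scalar components, truncated: the source is only a complex below
    [s], the target only exact up to [s]. *)
Lemma lift_chain_map bP (dP : forall i, 'M[R]_(bP i, bP i.+1))
    b (d : forall i, 'M[R]_(b i, b i.+1)) s (x0 : 'M[K]_(b 0%N, bP 0%N)) :
  (forall i, linmx (dP i)) -> (forall i, (i < s)%N -> dP i *m dP i.+1 = 0) ->
  (forall i, linmx (d i)) -> exact_upto d s ->
  exists f : forall i, 'M[K]_(b i, bP i),
    f 0%N = x0 /\ forall i, (i <= s)%N -> d i *m cmx (f i.+1) = cmx (f i) *m dP i.
Proof.
move=> lP cP lF [ex0 ex].
pose P i (x : 'M[K]_(b i, bP i)) (y : 'M[K]_(b i.+1, bP i.+1)) :=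
  (i <= s)%N -> (exists z, cmx x *m dP i = d i *m cmx z) -> d i *m cmx y = cmx x *m dP i.
have [i x|f f0 fP] := @dep_choice _ P x0.
  have [[z E]|H] := excluded_middle_informative (exists z, cmx x *m dP i = d i *m cmx z).
    by exists z => _ _; rewrite E.
  by exists 0.
exists f; split=> // i; elim: i => [|i IH] is_.
  apply: fP => //.
  by have [C <-] := lift_at0 lF ex0 (linmx_mulr (f 0%N) (lP 0%N)); exists C.
apply: fP => //.
have [] := @lift_at _ d i _ (cmx (f i.+1) *m dP i.+1) lF (ex _ is_).
- exact: linmx_mulr.
- by rewrite mulmxA IH ?(ltnW is_) // -mulmxA cP // mulmx0.
by move=> C <-; exists C.
Qed.

(* A linear resolution [P] and a minimal linear complex [F], exact up to degree
   [s], are isomorphic up to degree [s.+1] via scalar matrices. *)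
Lemma linear_syzygies b (d : forall i, 'M[R]_(b i, b i.+1)) s :
  koszul_alg -> b 0%N = 1%N -> (forall i, linmx (d i)) ->
  (forall i, (i < s)%N -> d i *m d i.+1 = 0) -> minimal d -> exact_upto d s ->
  exists r (L : 'M[R]_(b s.+1, r)), [/\ linmx L, d s *m L = 0 &
    forall v : 'cV_(b s.+1), d s *m v = 0 -> exists w, v = L *m w].
Proof.
move=> [bP [dP [bP0 lP exP0 exP]]] b0 lF cF mF exF.
(* [const_mx 1] plays the identity in degree 0: [b 0] and [bP 0] are equal to 1 only by proved
   equations, so [1%:M] would not have the right type. *)
have [al [al0 alP]] := lift_chain_map (const_mx 1) lP.1 (fun i _ => lP.2 i) lF exF.
have [|be [be0 beP]] := @lift_chain_map _ d _ dP s (const_mx 1) lF cF lP.1.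
  by split=> // i _; apply: exP.
(* Both sides lift the identity, and scalar lifts into the minimal [d] are unique. Thus [d] is a
   summand of [dP] in this range, and generators of the cycles of [dP] push forward along [al]. *)
have albe i : (i <= s.+1)%N -> al i *m be i = 1%:M.
  elim: i => [|i IH] is_.
    rewrite al0 be0; apply/matrixP => i j; rewrite !mxE.
    rewrite (eq_bigr (fun=> 1)); last by move=> k _; rewrite !mxE mulr1.
    rewrite sumr_const card_ord bP0; move: i j; rewrite b0 => i j.
    by rewrite !ord1.
  apply/eqP; rewrite -subr_eq0; apply/eqP; apply: (minimal_mx mF (i := i)).
  rewrite map_mxB map_mxM mulmxBr mulmxA alP // -mulmxA beP // mulmxA -map_mxM.
  by rewrite IH 1?ltnW // !map_mx1 mul1mx mulmx1 subrr.
exists (bP s.+2), (cmx (al s.+1) *m dP s.+1); split.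
- by apply: linmx_mulr; apply: lP.1.
- by rewrite mulmxA alP // -mulmxA lP.2 mulmx0.
move=> v v0; have [] := exP s (cmx (be s.+1) *m v).
  by rewrite mulmxA beP // -mulmxA v0 mulmx0.
move=> w E; exists w; rewrite -mulmxA -E mulmxA -map_mxM albe // map_mx1 mul1mx.
by [].
Qed.
End GradedAlg.

(** * The minimal linear complex *)

(** [U] is an arbitrary predicate, so no elimination applies: a matrix of maximal rank with row
    space inside [U] is chosen, the rank being bounded by [N]. A vector of [U] outside the row space
    would raise the rank. *)
Lemma subspace_row_base (K : fieldType) N (U : 'rV[K]_N -> Prop) :
  U 0 -> (forall k u v, U u -> U v -> U (k *: u + v)) ->
  exists r (B : 'M[K]_(r, N)), row_free B /\ forall u, U u <-> (u <= B)%MS.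
Proof.
move=> U0 UD.
pose good r := exists B : 'M[K]_N, (forall u : 'rV_N, (u <= B)%MS -> U u) /\ \rank B = r.
have bnd r : good r -> (r <= N)%N by move=> [B [_ <-]]; apply: rank_leq_col.
have [r [[B [BU rB]] mx]] : exists r, good r /\ forall s, good s -> (s <= r)%N.
  have g0 : good 0%N by exists 0; split; [move=> u /submx0null -> | rewrite mxrank0].
  apply: NNPP => H; have gd r : exists2 s, good s & (r <= s)%N.
    elim: r => [|r [s gs rs]]; first by exists 0%N.
    apply: NNPP => nr; apply: H; exists s; split=> // t gt.
    by rewrite leqNgt; apply/negP => st; apply: nr; exists t => //; apply: leq_ltn_trans st.
  by have [s /bnd sN Ns] := gd N.+1; have := leq_trans Ns sN; rewrite ltnn.
exists (\rank B), (row_base B); split; first exact: row_base_free.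
move=> u; rewrite eq_row_base; split; last exact: BU.
move=> Uu; have /mx : good (\rank (B + u)%MS).
  exists (B + u)%MS; split=> // w /sub_addsmxP[[w1 w2] /= ->].
  rewrite addrC; have [k ->] : exists k, w2 *m u = k *: u.
    by exists (w2 0 0); rewrite [w2 in LHS]mx11_scalar mul_scalar_mx.
  by apply: UD => //; apply: BU; apply: submxMl.
rewrite -rB => rk; have /eqmxP/andP[_ ] : (B :=: B + u)%MS.
  by apply/eqmxP; rewrite -(geq_leqif (mxrank_leqif_eq (addsmxSl B u))).
by apply: submx_trans; apply: addsmxSr.
Qed.

Section Canonical.
Variables (K : fieldType) (R : comNzRingType) (n : nat) (G : graded_alg K R n).
Local Notation cmx M := (map_mx (scal G) M).

(** [M] holds the coordinates of a column of linear forms. They are unique by [var_free], which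
    makes the linear syzygies a subspace of a space of dimension q * n. *)
Definition lincol q (M : 'M[K]_(q, n)) : 'cV[R]_q :=
  \col_i \sum_j scal G (M i j) * var G j.

Lemma lincol_linear q k (M N : 'M[K]_(q, n)) :
  lincol (k *: M + N) = scal G k *: lincol M + lincol N.
Proof.
apply/colP => i; rewrite !mxE mulr_sumr -big_split /=; apply: eq_bigr => j _.
by rewrite !mxE rmorphD rmorphM mulrDl mulrA.
Qed.

Lemma lincol0 q : lincol (0 : 'M_(q, n)) = 0.
Proof. by have := lincol_linear (-1) 0 (0 : 'M_(q, n)); rewrite scaler0 addr0 rmorphN1 scaleN1r addNr. Qed.

Lemma lincolP q (V : 'cV[R]_q) : linmx G V -> exists M, V = lincol M.
Proof.
move=> lV; have /fin_all_exists[c cP] (i : 'I_q) := lV i 0.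
exists (\matrix_(i, j) c i j); apply/colP => i; rewrite cP mxE.
by apply: eq_bigr => j _; rewrite mxE.
Qed.

Lemma lincol_lin q (M : 'M[K]_(q, n)) : linmx G (lincol M).
Proof. by move=> i j; rewrite mxE; exists (M i). Qed.

Lemma lincol_inj0 q (M : 'M[K]_(q, n)) : lincol M = 0 -> M = 0.
Proof.
move=> M0; apply/matrixP => i j; rewrite mxE.
by have /matrixP/(_ i 0) := M0; rewrite !mxE => /(@var_free _ _ _ G)/(_ j).
Qed.

(** The columns of [N] form a K-basis of the linear cycles of [D]: spanning gives the third clause,
    independence the fourth. Cycles of higher degree may be missed. *)
Lemma next_syzygies p q (D : 'M[R]_(p, q)) : exists r (N : 'M[R]_(q, r)),
  [/\ linmx G N, D *m N = 0,
      forall V : 'cV_q, linmx G V -> D *m V = 0 -> exists C : 'cV[K]_r, V = N *m cmx C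
    & forall C : 'cV[K]_r, N *m cmx C = 0 -> C = 0].
Proof.
have [|k u v|r [B [Bf BU]]] := @subspace_row_base K (q * n)
  (fun u => D *m lincol (vec_mx u) = 0).
- by rewrite linear0 lincol0 mulmx0.
- by move=> u0 v0; rewrite linearP /= lincol_linear mulmxDr -scalemxAr u0 v0 scaler0 addr0.
pose N := \matrix_(i < q, k < r) lincol (vec_mx (row k B)) i 0.
have NE (C : 'cV[K]_r) : N *m cmx C = lincol (vec_mx (C^T *m B)).
  apply/colP => i; rewrite !mxE mulmx_sum_row linear_sum /=.
  rewrite (eq_bigr (fun k => \sum_j scal G (C k 0) * scal G (vec_mx (row k B) i j) * var G j)).
    rewrite exchange_big; apply: eq_bigr => j _ /=; rewrite summxE rmorph_sum mulr_suml.
    by apply: eq_bigr => k _; rewrite linearZ /= !mxE rmorphM.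
  move=> k _; rewrite !mxE mulrC mulr_sumr; apply: eq_bigr => j _.
  by rewrite mulrA.
have NK (C : 'cV[K]_r) : D *m (N *m cmx C) = 0.
  by rewrite NE; apply/BU; apply: submxMl.
exists r, N; split.
- by move=> i k; rewrite mxE; apply: lincol_lin.
- apply/matrixP => i k; have /matrixP/(_ i 0) := NK (delta_mx k 0).
  by rewrite map_delta_mx mulmxA -colE !mxE.
- move=> V /lincolP[M ->] M0; have /submxP[C E] : (mxvec M <= B)%MS by apply/BU; rewrite mxvecK.
  by exists C^T; rewrite NE trmxK -E mxvecK.
move=> C; rewrite NE => /lincol_inj0 /(congr1 mxvec); rewrite vec_mxK linear0 => E.
have := row_free_inj Bf; move=> /(_ _ C^T 0); rewrite E mul0mx => /(_ erefl).
by move=> /(congr1 trmx); rewrite trmxK trmx0.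
Qed.

(** A differential packed with its ranks. The next stage reuses the column rank as row rank by
    computation, so that consecutive matrices compose without casts. *)
Let stage := {p : nat & {q : nat & 'M[R]_(p, q)}}.

Lemma minimal_linear_chain : exists (b : nat -> nat) (d : forall i, 'M[R]_(b i, b i.+1)),
  [/\ b 0%N = 1%N, linear_complex G d, minimal G d, exact_at0 G d
    & forall i r (V : 'M[R]_(b i.+1, r)), linmx G V -> d i *m V = 0 ->
        exists C : 'M[K]_(b i.+2, r), V = d i.+1 *m cmx C].
Proof.
pose nx p q (D : 'M[R]_(p, q)) := constructive_indefinite_description _ (next_syzygies D).
pose nN p q (D : 'M[R]_(p, q)) := constructive_indefinite_description _ (proj2_sig (nx p q D)).
pose step (s : stage) : stage :=
  existT _ (projT1 (projT2 s)) (existT _ _ (proj1_sig (nN _ _ (projT2 (projT2 s))))).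
pose st := nat_rect (fun=> stage) (existT _ 1%N (existT _ n (\row_i var G i))) (fun _ => step).
pose b i := projT1 (st i).
pose d i : 'M[R]_(b i, b i.+1) := projT2 (projT2 (st i)).
have dP i : [/\ linmx G (d i.+1), d i *m d i.+1 = 0,
  forall V : 'cV_(b i.+1), linmx G V -> d i *m V = 0 ->
    exists C : 'cV[K]_(b i.+2), V = d i.+1 *m cmx C
  & forall C : 'cV[K]_(b i.+2), d i.+1 *m cmx C = 0 -> C = 0].
  exact: (proj2_sig (nN _ _ (projT2 (projT2 (st i))))).
have rowE (v : 'cV[R]_n) : d 0%N *m v = (\sum_i var G i * v i 0)%:M.
  apply/matrixP => i j; rewrite !ord1 !mxE eqxx; apply: eq_bigr => k _.
  by rewrite mxE.
have lin0 : linmx G (d 0%N) by move=> i j; rewrite mxE; apply: lin_var.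
exists b, d; split=> //.
- by split=> [[|i]|i]; [| case: (dP i) | case: (dP i)].
- case=> [|i] v; last by case: (dP i) => _ _ _; apply.
  rewrite (rowE (cmx v)) => /matrixP/(_ 0 0); rewrite !mxE eqxx mulr1n => E.
  apply/colP => i; rewrite mxE; apply: (var_free (g := G) (c := fun i => v i 0)).
  by rewrite -[RHS]E; apply: eq_bigr => j _; rewrite mxE mulrC.
- move=> u; split=> [[v ->]|u0].
    by rewrite map_mxM aug_linmx // mul0mx.
  have /(aug_ker (g := G))[v vE] : aug G (u 0 0) = 0.
    by have /matrixP/(_ 0 0) := u0; rewrite !mxE.
  exists (\col_i v i); rewrite (rowE (\col_i v i)); apply/matrixP => i j.
  rewrite !ord1 vE !mxE eqxx; apply: eq_bigr => k _; by rewrite mxE.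
move=> i r V lV V0.
have /fin_all_exists[C CP] (j : 'I_r) : exists C : 'cV[K]_(b i.+2), col j V = d i.+1 *m cmx C.
  case: (dP i) => _ _ H _; apply: H; first by move=> k l; rewrite mxE.
  by rewrite -col_mulmx V0 col0.
exists (\matrix_(k, j) C j k 0); apply/matrixP => k j.
have /matrixP/(_ k 0) := CP j; rewrite !mxE => ->.
by apply: eq_bigr => l _; rewrite !mxE.
Qed.
End Canonical.

(** * Adjoining a square root *)

Lemma lift_max_widen n (i : 'I_n) : lift ord_max i = widen_ord (leqnSn n) i.
Proof. by apply: val_inj; rewrite /= /bump leqNgt ltn_ord. Qed.

(* [quadext mu] is R[y]/(y^2 - mu); the pair (a, b) stands for a + b y. *)
Definition quadext (R : comNzRingType) (mu : R) : Type := (R * R)%type.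

Section QuadExt.
Variables (R : comNzRingType) (mu : R).
Local Notation Q := (quadext mu).

HB.instance Definition _ := GRing.Zmodule.copy Q (R * R)%type.

Definition qmul (u v : Q) : Q := (u.1 * v.1 + mu * (u.2 * v.2), u.1 * v.2 + u.2 * v.1).
Definition qone : Q := (1, 0).

Lemma pair_ext (u v : Q) : u.1 = v.1 -> u.2 = v.2 -> u = v.
Proof. by case: u v => [a b] [c d] /= -> ->. Qed.

Lemma qmulA : associative qmul.
Proof. by move=> u v w; apply: pair_ext => /=; ring. Qed.
Lemma qmulC : commutative qmul.
Proof. by move=> u v; apply: pair_ext => /=; ring. Qed.
Lemma qmul1 : left_id qone qmul.
Proof. by move=> u; apply: pair_ext => /=; ring. Qed.
Lemma qmulDl : left_distributive qmul +%R.
Proof. by move=> u v w; apply: pair_ext => /=; ring. Qed.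
Lemma qone_neq0 : qone != 0.
Proof. by apply/eqP => -[/eqP]; rewrite oner_eq0. Qed.

HB.instance Definition _ := GRing.Zmodule_isComNzRing.Build Q qmulA qmulC qmul1 qmulDl qone_neq0.

Definition qemb (a : R) : Q := (a, 0).
Definition qy : Q := (0, 1).
Definition co0 (u : Q) : R := u.1.
Definition co1 (u : Q) : R := u.2.
Arguments co0 : simpl never.
Arguments co1 : simpl never.

Lemma qemb_is_zmod : zmod_morphism qemb.
Proof. by move=> a b; apply: pair_ext => //=; rewrite subr0. Qed.
HB.instance Definition _ := GRing.isZmodMorphism.Build R Q qemb qemb_is_zmod.
Lemma qemb_is_monoid : monoid_morphism qemb.
Proof. by split=> // a b; apply: pair_ext => /=; ring. Qed.
HB.instance Definition _ := GRing.isMonoidMorphism.Build R Q qemb qemb_is_monoid.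

Lemma co0_is_zmod : zmod_morphism co0. Proof. by []. Qed.
HB.instance Definition _ := GRing.isZmodMorphism.Build Q R co0 co0_is_zmod.
Lemma co1_is_zmod : zmod_morphism co1. Proof. by []. Qed.
HB.instance Definition _ := GRing.isZmodMorphism.Build Q R co1 co1_is_zmod.

Lemma quadextE (u : Q) : u = qemb (co0 u) + qy * qemb (co1 u).
Proof. by apply: pair_ext => /=; rewrite /co0 /co1; ring. Qed.
Lemma qyy : qy * qy = qemb mu.
Proof. by apply: pair_ext => /=; ring. Qed.
Lemma co0M a u : co0 (qemb a * u) = a * co0 u.
Proof. by rewrite /co0 /=; ring. Qed.
Lemma co1M a u : co1 (qemb a * u) = a * co1 u.
Proof. by rewrite /co1 /=; ring. Qed.
Lemma co0y u : co0 (qy * u) = mu * co1 u.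
Proof. by rewrite /co0 /co1 /=; ring. Qed.
Lemma co1y u : co1 (qy * u) = co0 u.
Proof. by rewrite /co0 /co1 /=; ring. Qed.
Lemma co1e a : co1 (qemb a) = 0. Proof. by []. Qed.

Local Notation em M := (map_mx qemb M).
Local Notation c0 M := (map_mx co0 M).
Local Notation c1 M := (map_mx co1 M).

Lemma quadext_mxE p q (M : 'M[Q]_(p, q)) : M = em (c0 M) + qy *: em (c1 M).
Proof. by apply/matrixP => i j; rewrite !mxE -quadextE. Qed.
Lemma map_co0M p q r (A : 'M_(p, q)) (M : 'M[Q]_(q, r)) : c0 (em A *m M) = A *m c0 M.
Proof.
apply/matrixP => i j; rewrite !mxE raddf_sum; apply: eq_bigr => k _ /=.
by rewrite !mxE co0M.
Qed.
Lemma map_co1M p q r (A : 'M_(p, q)) (M : 'M[Q]_(q, r)) : c1 (em A *m M) = A *m c1 M.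
Proof.
apply/matrixP => i j; rewrite !mxE raddf_sum; apply: eq_bigr => k _ /=.
by rewrite !mxE co1M.
Qed.
Lemma map_co1Z p q a (M : 'M[Q]_(p, q)) : c1 (qemb a *: M) = a *: c1 M.
Proof. by apply/matrixP => i j; rewrite !mxE co1M. Qed.
Lemma map_co0y p q (M : 'M[Q]_(p, q)) : c0 (qy *: M) = mu *: c1 M.
Proof. by apply/matrixP => i j; rewrite !mxE co0y. Qed.
Lemma map_co1y p q (M : 'M[Q]_(p, q)) : c1 (qy *: M) = c0 M.
Proof. by apply/matrixP => i j; rewrite !mxE co1y. Qed.
Lemma map_co0_emb p q (M : 'M[R]_(p, q)) : c0 (em M) = M.
Proof. by apply/matrixP => i j; rewrite !mxE. Qed.
Lemma map_co1_emb p q (M : 'M[R]_(p, q)) : c1 (em M) = 0.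
Proof. by apply/matrixP => i j; rewrite !mxE. Qed.

Section Exact.
Variables (p q r : nat) (A : 'M[R]_(p, q)) (B : 'M[R]_(q, r)).
Hypothesis ex : forall v : 'cV_q, A *m v = 0 -> exists w, v = B *m w.

(** The extension is free over [R] with basis 1, y, so kernels and images of matrices over [R] are
    computed on each coefficient. *)
Lemma quadext_exact (v : 'cV[Q]_q) : em A *m v = 0 -> exists w, v = em B *m w.
Proof.
move=> v0; have [w0 E0] : exists w, c0 v = B *m w by apply: ex; rewrite -map_co0M v0 raddf0.
have [w1 E1] : exists w, c1 v = B *m w by apply: ex; rewrite -map_co1M v0 raddf0.
exists (em w0 + qy *: em w1); rewrite [LHS]quadext_mxE E0 E1 !map_mxM mulmxDr scalemxAr.
by [].
Qed.
End Exact.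

Section QuadAlg.
Variables (K : fieldType) (n : nat) (G : graded_alg K R n).
Hypothesis mu_aug : forall r, linpart G (mu * r) = 0.
Hypothesis aug_mu : aug G mu = 0.

Definition qscal (k : K) : Q := qemb (scal G k).
Definition qaug (u : Q) : K := aug G (co0 u).
Definition qvar (i : 'I_n.+1) : Q :=
  if unlift ord_max i is Some j then qemb (var G j) else qy.
(** With y in degree one, a + b y contributes the linear part of a and the constant part of b.
    Compatibility with products by y rests on [mu_aug]: multiples of [mu] have no linear part. *)
Definition qlinpart (u : Q) : Q := (linpart G (co0 u), scal G (aug G (co1 u))).

HB.instance Definition _ := GRing.RMorphism.copy qscal (qemb \o scal G).

Lemma qaug_is_zmod : zmod_morphism qaug.
Proof. by move=> u v; rewrite /qaug !raddfB. Qed.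
HB.instance Definition _ := GRing.isZmodMorphism.Build Q K qaug qaug_is_zmod.
Lemma qaug_is_monoid : monoid_morphism qaug.
Proof.
split=> [|u v]; first by rewrite /qaug rmorph1.
by rewrite /qaug /co0 rmorphD !rmorphM aug_mu mul0r addr0.
Qed.
HB.instance Definition _ := GRing.isMonoidMorphism.Build Q K qaug qaug_is_monoid.

Lemma qlinpart_is_zmod : zmod_morphism qlinpart.
Proof. by move=> u v; apply: pair_ext; rewrite /= !raddfB. Qed.
HB.instance Definition _ := GRing.isZmodMorphism.Build Q Q qlinpart qlinpart_is_zmod.

Lemma widen_neq_max (i : 'I_n) : widen_ord (leqnSn n) i != ord_max.
Proof. by rewrite -val_eqE /= ltn_eqF. Qed.

Lemma qvar_widen i : qvar (widen_ord (leqnSn n) i) = qemb (var G i).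
Proof.
by rewrite /qvar -lift_max_widen liftK.
Qed.

Lemma qvar_max : qvar ord_max = qy.
Proof. by rewrite /qvar unlift_none. Qed.

Fact qaugK k : qaug (qscal k) = k.
Proof. exact: augK. Qed.

Fact qaug_var i : qaug (qvar i) = 0.
Proof.
by rewrite /qvar; case: unlift => [j|]; rewrite /qaug /co0 /= ?aug_var ?rmorph0.
Qed.

Fact qaug_ker u : qaug u = 0 -> exists v, u = \sum_i qvar i * v i.
Proof.
move=> /aug_ker[v vE].
exists (fun i => if unlift ord_max i is Some j then qemb (v j) else qemb (co1 u)).
rewrite big_ord_recr /= qvar_max unlift_none [LHS]quadextE vE rmorph_sum; congr (_ + _).
by apply: eq_bigr => i _; rewrite qvar_widen rmorphM -lift_max_widen liftK.
Qed.

Fact qvar_free (c : 'I_n.+1 -> K) : \sum_i qscal (c i) * qvar i = 0 -> forall i, c i = 0.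
Proof.
rewrite big_ord_recr /= qvar_max => E i.
have E1 : co0 (\sum_(i < n) qscal (c (widen_ord (leqnSn n) i)) * qvar (widen_ord (leqnSn n) i))
   = \sum_(i < n) scal G (c (widen_ord (leqnSn n) i)) * var G i.
  rewrite raddf_sum; apply: eq_bigr => j _ /=.
  by rewrite co0M qvar_widen.
have E2 : co1 (\sum_(i < n) qscal (c (widen_ord (leqnSn n) i)) * qvar (widen_ord (leqnSn n) i)) = 0.
  by rewrite raddf_sum big1 // => j _ /=; rewrite co1M qvar_widen co1e mulr0.
have := congr1 co0 E; rewrite raddfD /= E1 co0M mulr0 addr0 raddf0 => /(@var_free _ _ _ G) H.
have := congr1 co1 E; rewrite raddfD /= E2 co1M mulr1 add0r raddf0 => /(congr1 (aug G)).
rewrite augK rmorph0 => H'.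
case: (unliftP ord_max i) => [j ->|-> //].
by rewrite -[RHS](H j) lift_max_widen.
Qed.

Fact qlinpart_var i w : qlinpart (qvar i * w) = qvar i * qscal (qaug w).
Proof.
rewrite /qvar; case: unlift => [j|].
  apply: pair_ext; rewrite /= /qlinpart.
    by rewrite co0M linpart_var /qaug; ring.
  by rewrite co1M rmorphM aug_var mul0r rmorph0; ring.
apply: pair_ext; rewrite /= /qlinpart ?co0y ?co1y ?mu_aug /qaug; ring.
Qed.

Definition quad_alg : graded_alg K Q n.+1 :=
  GradedAlg qaugK qaug_var qaug_ker qvar_free qlinpart_var.

Lemma qlin_emb a : lin G a -> lin quad_alg (qemb a).
Proof.
move=> [c ->]; exists (fun i => if unlift ord_max i is Some j then c j else 0).
rewrite big_ord_recr /= unlift_none rmorph0 mul0r addr0 rmorph_sum.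
by apply: eq_bigr => i _ /=; rewrite qvar_widen rmorphM -lift_max_widen liftK.
Qed.

Lemma qlin_y : lin quad_alg qy.
Proof. by rewrite -qvar_max; apply: (lin_var quad_alg). Qed.

Lemma qlin_co u : lin quad_alg u -> lin G (co0 u) /\ exists k, co1 u = scal G k.
Proof.
move=> [c ->]; rewrite big_ord_recr /= qvar_max; split; last first.
  exists (c ord_max); rewrite raddfD /= co1M mulr1 raddf_sum big1 ?add0r // => i _ /=.
  by rewrite co1M qvar_widen co1e mulr0.
exists (fun i => c (widen_ord (leqnSn n) i)); rewrite raddfD /= co0M mulr0 addr0 raddf_sum.
by apply: eq_bigr => i _ /=; rewrite co0M qvar_widen.
Qed.

(** In a linear element a + b y the coefficient b is a constant. This keeps the syzygies over [R],
    extracted below from a linear matrix over the extension, linear. *)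
Lemma qlinmx_co p q (M : 'M_(p, q)) : linmx quad_alg M ->
  linmx G (c0 M) /\ exists C : 'M[K]_(p, q), c1 M = map_mx (scal G) C.
Proof.
move=> lM; split=> [i j|]; first by rewrite mxE; case: (qlin_co (lM i j)).
exists (map_mx (aug G) (c1 M)); apply/matrixP => i j; rewrite !mxE.
by have [_ [k ->]] := qlin_co (lM i j); rewrite augK.
Qed.

Lemma qlinmx_emb p q (M : 'M_(p, q)) : linmx G M -> linmx quad_alg (em M).
Proof. by move=> lM i j; rewrite mxE; apply: qlin_emb. Qed.
End QuadAlg.
End QuadExt.

(** * The cone construction *)

Section Homotopy.
Variables (K : fieldType) (R : comNzRingType) (n : nat) (G : graded_alg K R n).
Variables (b : nat -> nat) (d : forall i, 'M[R]_(b i, b i.+1)) (q : R).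
Local Notation cmx M := (map_mx (scal G) M).

Definition null_homotopy (h : forall i, 'M[K]_(b i.+1, b i)) s : Prop :=
  [/\ d 0%N *m cmx (h 0%N) = q%:M,
      forall i, (i < s)%N -> d i.+1 *m cmx (h i.+1) + cmx (h i) *m d i = q%:M
    & forall i, (i < s)%N -> cmx (h i.+1) *m cmx (h i) = 0].

(** The family [h] is chosen once for all [s], since the cone over a full resolution needs a single
    homotopy. *)
Lemma null_homotopy_ex :
  lin G q -> linear_complex G d -> minimal G d -> exact_at0 G d ->
  exists h, forall s, exact_upto G d s -> null_homotopy h s.
Proof.
move=> lq [ld cd] mn ex0.
have lqm p : linmx G (q%:M : 'M_p) by apply: linmx_scalar.
have [h0 h0E] := lift_at0 ld ex0 (lqm (b 0%N)).
pose P i (x : 'M[K]_(b i.+1, b i)) (y : 'M[K]_(b i.+2, b i.+1)) :=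
  exact_at d i -> d i *m (q%:M - cmx x *m d i) = 0 ->
  d i.+1 *m cmx y = q%:M - cmx x *m d i.
have [i x|h hE hP] := @dep_choice _ P h0.
  have [ex|] := excluded_middle_informative (exact_at d i); last by exists 0.
  have [E|] := excluded_middle_informative (d i *m (q%:M - cmx x *m d i) = 0); last by exists 0.
  have [|C CE] := lift_at ld ex _ E; last by exists C.
  by apply: linmxB => //; apply: linmx_mulr.
exists h => s [_ ex].
have h0E' : d 0%N *m cmx (h 0%N) = q%:M by rewrite hE.
have Q i : (i <= s)%N -> d i *m (q%:M - cmx (h i) *m d i) = 0 /\
   ((i < s)%N -> d i.+1 *m cmx (h i.+1) = q%:M - cmx (h i) *m d i).
  elim: i => [|i IH] is_.
    have E : d 0%N *m (q%:M - cmx (h 0%N) *m d 0%N) = 0.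
      by rewrite mulmxBr mulmxA h0E' mul_mx_scalar mul_scalar_mx subrr.
    by split=> // s0; apply: hP => //; apply: ex.
  have [_ /(_ is_) E1] := IH (ltnW is_).
  have E : d i.+1 *m (q%:M - cmx (h i.+1) *m d i.+1) = 0.
    rewrite mulmxBr mulmxA E1 mulmxBl -mulmxA cd mulmx0 subr0.
    by rewrite mul_mx_scalar mul_scalar_mx subrr.
  by split=> // s0; apply: hP => //; apply: ex.
have R1 i : (i < s)%N -> d i.+1 *m cmx (h i.+1) = q%:M - cmx (h i) *m d i.
  by move=> is_; have [_ ] := Q i (ltnW is_); apply.
split=> [//|i is_|]; first by rewrite R1 // subrK.
(* The product is scalar, so by minimality it is enough that the differential kills it. Substituting
   the homotopy equation twice cancels the multiples of [q] and leaves the preceding product [h h],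
   zero by induction. *)
suff H i : (i < s)%N -> h i.+1 *m h i = 0.
  by move=> i is_; rewrite -map_mxM H // map_mx0.
elim: i => [|i IH] is_; apply: (minimal_mx mn); rewrite map_mxM mulmxA R1 // mulmxBl -mulmxA.
  by rewrite h0E' mul_mx_scalar mul_scalar_mx subrr.
rewrite R1 ?(ltnW is_) // mulmxBr mulmxA -map_mxM IH ?(ltnW is_) // map_mx0 mul0mx subr0.
by rewrite mul_mx_scalar mul_scalar_mx subrr.
Qed.
End Homotopy.

Section Cone.
Variables (K : fieldType) (R : comNzRingType) (n : nat) (G : graded_alg K R n).
Variables (p q : R) (lp : lin G p) (lq : lin G q).
Local Notation mu := (p * q).
Local Notation Q := (quadext mu).
Local Notation cmx M := (map_mx (scal G) M).
Local Notation em M := (map_mx (@qemb R mu) M).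
Local Notation c0 M := (map_mx (@co0 R mu) M).
Local Notation c1 M := (map_mx (@co1 R mu) M).
Local Notation y := (@qy R mu).

Fact linpart_mu r : linpart G (mu * r) = 0.
Proof. by rewrite -mulrA linpart_mul // rmorphM (aug_lin lq) mul0r rmorph0 mulr0. Qed.

Fact aug_mu0 : aug G mu = 0.
Proof. by rewrite rmorphM (aug_lin lp) mul0r. Qed.

Local Notation GH := (quad_alg linpart_mu aug_mu0).

Variables (b : nat -> nat) (d : forall i, 'M[R]_(b i, b i.+1)).
Variable h : forall i, 'M[K]_(b i.+1, b i).

Fixpoint cone_rank i : nat := if i is j.+1 then (b j.+1 + cone_rank j)%N else b 0%N.

Definition cone_proj i : 'M[Q]_(b i, cone_rank i) :=
  match i with 0%N => 1%:M | j.+1 => row_mx 1%:M 0 end.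

(** The lift of multiplication by y from the cone to the extended complex. The second block is the
    correction forced by y^2 = p q: [p] times the homotopy for [q]. *)
Definition cone_map i : 'M[Q]_(b i, cone_rank i) :=
  match i with
  | 0%N => y%:M
  | j.+1 => row_mx y%:M (qemb mu p *: (em (cmx (h j)) *m cone_proj j))
  end.

Fixpoint cone_diff i : 'M[Q]_(cone_rank i, cone_rank i.+1) :=
  match i with
  | 0%N => row_mx (em (d 0%N)) (cone_map 0)
  | j.+1 => block_mx (em (d j.+1)) (cone_map j.+1) 0 (- cone_diff j)
  end.

Local Notation prj := cone_proj.
Local Notation phi := cone_map.
Local Notation D := cone_diff.
Local Notation dH i := (em (d i)).
Local Notation hH i := (em (cmx (h i))).

Lemma cone_proj_diff i : prj i *m D i = row_mx (dH i) (phi i).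
Proof.
case: i => [|i] /=; first by rewrite mul1mx.
by rewrite mul_row_block !mul1mx mul0mx addr0 mul0mx addr0.
Qed.

Hypothesis ld : linear_complex G d.

Lemma cone_map_lin i : linmx GH (phi i).
Proof.
case: i => [|i] /=; first by apply: linmx_scalar; apply: qlin_y.
apply: linmx_row_mx; first by apply: linmx_scalar; apply: qlin_y.
rewrite scalemxAl.
have lP : linmx GH (qemb mu p *: hH i).
  move=> u v; rewrite !mxE [X in lin _ X]mulrC; apply: (lin_scal (G := GH) (h i u v)).
  exact: qlin_emb.
case: i lP => [|i] lP /=; first by rewrite mulmx1.
by rewrite mul_mx_row mulmx1 mulmx0; apply: linmx_row_mx; last exact: linmx0.
Qed.

Lemma cone_diff_lin i : linmx GH (D i).
Proof.
elim: i => [|i IH] /=.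
  apply: linmx_row_mx; first by apply: qlinmx_emb; apply: ld.1.
  by apply: linmx_scalar; apply: qlin_y.
apply: linmx_col_mx; apply: linmx_row_mx; last exact: linmxN.
- by apply: qlinmx_emb; apply: ld.1.
- exact: (cone_map_lin (i := i.+1)).
- exact: linmx0.
Qed.

Lemma cone_diff_min : minimal G d -> minimal GH D.
Proof.
move=> mn; elim=> [|i IH] v.
  rewrite -[v]vsubmxK map_col_mx /= mul_row_col mul_scalar_mx => E.
  have eqs k l (C : 'M[K]_(k, l)) : map_mx (scal GH) C = em (cmx C) by apply/matrixP => ? ?; rewrite !mxE.
  have Eu : dsubmx v = 0.
    have := congr1 (fun M => c1 M) E; rewrite map_mxD /= !eqs map_co1M map_co1_emb mulmx0 add0r map_co1y map_co0_emb map_mx0.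
    by move=> H; apply: (cmx_inj (G := G)); rewrite map_mx0.
  have := congr1 (fun M => c0 M) E; rewrite Eu map_mx0 scaler0 addr0 eqs map_co0M map_co0_emb map_mx0.
  by move=> /mn ->; rewrite col_mx0.
rewrite -[v]vsubmxK map_col_mx /= mul_block_col mul0mx add0r => /eqP.
rewrite col_mx_eq0 => /andP[/eqP E1 /eqP E2].
have eqs k l (C : 'M[K]_(k, l)) : map_mx (scal GH) C = em (cmx C) by apply/matrixP => ? ?; rewrite !mxE.
have Eu : dsubmx v = 0 by apply: IH; apply/eqP; rewrite -oppr_eq0 -mulNmx; apply/eqP.
move: E1; rewrite Eu map_mx0 mulmx0 addr0 eqs -map_mxM => /(congr1 (fun M => c0 M)).
by rewrite map_co0_emb map_mx0 => /mn ->; rewrite col_mx0.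
Qed.

Section Upto.
Variable s : nat.
Hypothesis hP : null_homotopy G d q h s.

(** This is where [h h = 0] enters: [h] annihilates the correction term of [phi], and only the
    multiplication by y remains. *)
Lemma homotopy_cone_map j : (j <= s)%N -> hH j *m phi j = y *: (hH j *m prj j).
Proof.
case: j => [|j] js /=; first by rewrite mul_mx_scalar mulmx1.
have [_ _ hh] := hP.
rewrite !mul_mx_row mul_mx_scalar mulmx1 mulmx0 -scalemxAr mulmxA -map_mxM hh //.
by rewrite map_mx0 mul0mx scaler0 scale_row_mx scaler0.
Qed.

(** On the summand F_(i+1) both sides are y times [d i]. On G_i, the equation [d h + h d = q]
    matches [p d h] with y^2 - [p h d], using y^2 = p q. *)
Lemma cone_chain i : (i <= s)%N -> dH i *m phi i.+1 = phi i *m D i.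
Proof.
have [h0 hS _] := hP.
case: i => [|i] is_.
  rewrite /= mulmx1 mul_mx_row mul_mx_scalar -scalemxAr -map_mxM h0 mul_mx_row.
  rewrite !mul_scalar_mx; congr row_mx.
  apply/matrixP => j k; rewrite !mxE; case: eqP => _; rewrite ?mulr1n ?mulr0n ?rmorph0 ?mulr0 //.
  by rewrite qyy rmorphM.
rewrite [phi i.+1]/= [D i.+1]/= [phi i.+2]/= mul_mx_row mul_mx_scalar mul_row_block mulmx0 addr0.
rewrite mul_scalar_mx; congr row_mx; rewrite mul_scalar_mx mulmxN -scalemxAl -mulmxA cone_proj_diff.
rewrite [hH i *m row_mx _ _]mul_mx_row homotopy_cone_map ?(ltnW is_) // -[LHS]scalemxAr mulmxA -[em (d _) *m _]map_mxM.
have -> : d i.+1 *m cmx (h i.+1) = q%:M - cmx (h i) *m d i by rewrite -(hS _ is_) addrK.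
rewrite mul_mx_row mulmx1 mulmx0 !scale_row_mx opp_row_mx add_row_mx scaler0.
congr row_mx; last by rewrite !scalerA [y * _]mulrC subrr.
rewrite map_mxB scalerBr map_mxM; congr (_ - _).
apply/matrixP => j k; rewrite !mxE; case: eqP => _; rewrite ?mulr1n ?mulr0n ?rmorph0 ?mulr0 //.
by rewrite qyy rmorphM.
Qed.

Lemma cone_complex i : (i <= s)%N -> D i *m D i.+1 = 0.
Proof.
elim: i => [|i IH] is_.
  rewrite [D 1]/= [D 0]/= mul_row_block mulmx0 addr0 -map_mxM ld.2 map_mx0.
  by rewrite cone_chain // mulmxN subrr row_mx0.
have E : D i.+1 = block_mx (dH i.+1) (phi i.+1) 0 (- D i) by [].
rewrite [D i.+2]/= -/(D i.+1) [X in X *m _]E mulmx_block !mulmx0 !mul0mx !addr0 -map_mxM ld.2 map_mx0.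
rewrite cone_chain // mulmxN subrr add0r mulNmx mulmxN IH ?(ltnW is_) // !oppr0.
exact: block_mx0.
Qed.

Lemma cone_exact_at0 : exact_at0 G d -> exact_at0 GH D.
Proof.
move=> ex0 u; split=> [[v ->]|u0].
  by rewrite map_mxM aug_linmx ?mul0mx //; apply: cone_diff_lin.
have [|v E] := (ex0 (c0 u)).2; first by rewrite -[RHS]u0; apply/matrixP => i j; rewrite !mxE.
exists (col_mx (em v) (em (c1 u))); rewrite mul_row_col mul_scalar_mx -map_mxM -E.
exact: quadext_mxE.
Qed.

(* Once the lower component [w] of a cycle is a boundary, the upper one becomes
   a cycle for [d] after subtracting the image of that boundary. *)
Lemma cone_fill i v w : (i <= s)%N -> exact_at d i ->
  dH i *m v + phi i *m w = 0 -> (exists w', w = D i *m w') ->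
  exists u, col_mx v w = D i.+1 *m u :> 'cV_(b i.+1 + cone_rank i).
Proof.
move=> is_ ex E [w' wE].
have : dH i *m (v + phi i.+1 *m w') = 0.
  by rewrite mulmxDr mulmxA cone_chain // -mulmxA -wE.
move=> /(quadext_exact ex)[u uE].
exists (col_mx u (- w')); rewrite [D i.+1]/= mul_block_col mul0mx add0r mulNmx !mulmxN opprK -wE.
by rewrite -uE addrK.
Qed.

Lemma cone_exact_upto : exact_upto G d s -> exact_upto GH D s.
Proof.
move=> [ex0 ex]; split; first exact: cone_exact_at0.
elim=> [|i IH] is_ v.
  rewrite -[v]vsubmxK mul_row_col => E; apply: (cone_fill _ (ex _ is_) E) => //.
  (* The lower component has to have augmentation 0. The y-coefficient of [E] expresses its
     coefficient of 1 through [d 0], whose entries are linear. *)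
  apply/(cone_exact_at0 ex0); rewrite [cone_map 0]/= mul_scalar_mx in E.
  have := congr1 (fun M => c1 M) E.
  rewrite map_mxD /= map_co1M map_co1y map_mx0 => /eqP; rewrite addr_eq0 => /eqP E1.
  have -> : map_mx (aug GH) (dsubmx v) = map_mx (aug G) (c0 (dsubmx v)).
    by apply/matrixP => j k; rewrite !mxE.
  apply/eqP; rewrite -oppr_eq0 -map_mxN -E1 map_mxM aug_linmx ?mul0mx //.
  exact: ld.1.
rewrite -[v]vsubmxK [D i.+1]/= mul_block_col mul0mx add0r => /eqP.
rewrite col_mx_eq0 => /andP[/eqP E1 /eqP E2]; apply: (cone_fill _ (ex _ is_) E1); first exact: ltnW.
by apply: IH; [apply: ltnW | apply/eqP; rewrite -oppr_eq0 -mulNmx; apply/eqP].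
Qed.

End Upto.

Lemma cone_koszul : b 0%N = 1%N -> exact_at0 G d -> (forall i, exact_at d i) ->
  (forall s, null_homotopy G d q h s) -> koszul_alg GH.
Proof.
move=> b0 ex0 ex hP; exists cone_rank, D; split=> //.
- split; [exact: cone_diff_lin | by move=> i; apply: (cone_complex (hP i))].
- exact: cone_exact_at0.
move=> i; have [|_ ] := cone_exact_upto (hP i.+1); last by apply.
by split=> // j _; apply: ex.
Qed.

Lemma cone_cycle s r (M1 : 'M_(b s.+1, r)) (M2 : 'M_(cone_rank s, r)) :
  D s *m col_mx M1 M2 = 0 -> dH s *m M1 + phi s *m M2 = 0.
Proof.
case: s M1 M2 => [|t] M1 M2 /=; first by rewrite mul_row_col.
by rewrite mul_block_col => /eqP; rewrite col_mx_eq0 => /andP[/eqP].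
Qed.

Lemma cone_cycleS s r (M1 : 'M_(b s.+2, r)) (M2 : 'M_(cone_rank s.+1, r)) :
  D s.+1 *m col_mx M1 M2 = 0 -> D s *m M2 = 0.
Proof.
rewrite /= mul_block_col => /eqP; rewrite col_mx_eq0 => /andP[_ /eqP].
by rewrite mul0mx add0r mulNmx => /eqP; rewrite oppr_eq0 => /eqP.
Qed.

Lemma cone_top_cycle s r (M : 'M_(b s.+1, r)) : dH s *m M = 0 -> D s *m col_mx M 0 = 0.
Proof.
case: s M => [|t] M E /=; first by rewrite mul_row_col E mulmx0 addr0.
by rewrite mul_block_col E !mulmx0 mul0mx !addr0 col_mx0.
Qed.

(** The lower component of a cycle is a cycle one degree below, where the cone is already exact; a
    lift of a linear matrix is then scalar. In degree 0 augmentation replaces the cycle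
    condition. *)
Lemma cone_lift s r (M1 : 'M_(b s.+1, r)) (M2 : 'M_(cone_rank s, r)) :
  linmx GH M2 -> exact_upto GH D s -> D s *m col_mx M1 M2 = 0 ->
  exists C : 'M[K]_(_, r), D s *m map_mx (scal GH) C = M2.
Proof.
case: s M1 M2 => [|t] M1 M2 lM2 [ex0 ex] E; first exact: (lift_at0 (fun i => @cone_diff_lin i) ex0 lM2).
exact: (lift_at (fun i => @cone_diff_lin i) (ex _ (ltnSn t)) lM2 (cone_cycleS E)).
Qed.

Section Syzygies.
Variables (s r : nat) (L1 : 'M[Q]_(b s.+1, r)) (L2 : 'M[Q]_(cone_rank s, r)).
Hypotheses (hP : null_homotopy G d q h s) (DL : D s *m col_mx L1 L2 = 0).

Let nu := prj s *m L2.
(** Expanding [phi] applied to [(L1, L2)] by y^2 = p q, this is the coefficient of y, and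
    [cone_syz2] is the coefficient of 1 with a factor [p] taken out. *)
Definition cone_syz1 := c0 L1 + p *: (cmx (h s) *m c1 nu).
Definition cone_syz2 := q *: c1 L1 + cmx (h s) *m c0 nu.

Lemma cone_mapE : phi s.+1 *m col_mx L1 L2 = y *: em cone_syz1 + qemb mu p *: em cone_syz2.
Proof.
rewrite /= mul_row_col mul_scalar_mx -scalemxAl -mulmxA -/nu.
rewrite [L1 in LHS]quadext_mxE [nu in LHS]quadext_mxE /cone_syz1 /cone_syz2 !map_mxD !map_mxZ /= !map_mxM.
rewrite mulmxDr !scalerDr -scalemxAr !scalerA qyy rmorphM [y * _]mulrC.
by rewrite [X in _ + X = _]addrC addrACA.
Qed.

Lemma cone_syz1_cycle : d s *m cone_syz1 = 0.
Proof.
have := congr1 (fun M => c1 M) (congr1 (mulmx (dH s)) cone_mapE).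
rewrite mulmxA (cone_chain hP) // -mulmxA DL mulmx0 map_mx0 map_co1M map_mxD /= map_co1y map_co0_emb.
by rewrite map_co1Z map_co1_emb scaler0 addr0.
Qed.

(** Comparing coefficients of 1 in [cone_mapE] would only give [p] times the claim, and [p] may be a
    zero divisor or 0. Instead the cycle condition is read block by block: the y-coefficient of the
    first block, and the coefficient of 1 in [h] times the second one. With [d h = q - h d] the two
    contributions of [c1 xi] cancel. *)
Lemma cone_syz2_cycle : d s *m cone_syz2 = 0.
Proof.
rewrite /cone_syz2 /nu; case: (s) L1 L2 hP DL => [|j] M1 M2 [h0 hS hh] E.
  have := congr1 (fun M => c1 M) (cone_cycle E); rewrite mul_scalar_mx map_mxD /= map_co1M map_co1y map_mx0.
  move=> E1; rewrite mul1mx mulmxDr -scalemxAr mulmxA h0 mul_scalar_mx -scalerDr E1.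
  by rewrite scaler0.
pose xi := prj j *m dsubmx M2.
have nuE : prj j.+1 *m M2 = usubmx M2.
  by rewrite -{1}[M2]vsubmxK /= mul_row_col mul1mx mul0mx addr0.
rewrite nuE.
have E1 : d j.+1 *m c1 M1 + c0 (usubmx M2) + p *: (cmx (h j) *m c1 xi) = 0.
  have := congr1 (fun M => c1 M) (cone_cycle E); rewrite -{1}[M2]vsubmxK /= mul_row_col.
  by rewrite mul_scalar_mx -scalemxAl -mulmxA !map_mxD /= map_co1M map_co1y map_co1Z map_co1M map_mx0 addrA.
have E2 : cmx (h j) *m (d j *m c0 (usubmx M2)) + mu *: (cmx (h j) *m c1 xi) = 0.
  have := cone_cycleS E; rewrite -{1}[M2]vsubmxK => /cone_cycle/(congr1 (mulmx (hH j))).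
  have hP' : null_homotopy G d q h j.+1 by [].
  rewrite mulmxDr mulmx0 [hH j *m (phi j *m _)]mulmxA (homotopy_cone_map hP') ?leqnSn //.
  move/(congr1 (fun M => c0 M)).
  by rewrite map_mxD /= !map_co0M -scalemxAl map_co0y -mulmxA map_co1M map_mx0.
rewrite mulmxDr -scalemxAr mulmxA.
have -> : d j.+1 *m cmx (h j.+1) = q%:M - cmx (h j) *m d j by rewrite -(hS _ (ltnSn j)) addrK.
rewrite mulmxBl mul_scalar_mx addrA -scalerDr -mulmxA.
move/eqP: E1; rewrite addr_eq0 => /eqP ->; move/eqP: E2; rewrite addr_eq0 => /eqP ->.
by rewrite opprK scalerN scalerA [q * p]mulrC addNr.
Qed.
End Syzygies.

(** A cycle [v] of [d], placed above 0, is a combination of linear cycles [L] of the cone. Adding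
    [phi] of a scalar lift of the lower parts turns [L1] into cycles [Ga] over [R]. In the
    combination giving [v], the added term is [phi] of a cone cycle, hence a combination of
    [cone_syz1] and [cone_syz2]. All three families consist of linear cycles of [d s], which are
    boundaries by [lg]. *)
Lemma cone_syzygies s : minimal G d ->
  (forall i r (V : 'M[R]_(b i.+1, r)), linmx G V -> d i *m V = 0 ->
     exists C : 'M[K]_(b i.+2, r), V = d i.+1 *m cmx C) ->
  b 0%N = 1%N -> exact_upto G d s -> null_homotopy G d q h s ->
  koszul_alg GH -> exact_at d s.
Proof.
move=> mn lg b0 ex hP kH v v0.
have exH := cone_exact_upto hP ex.
have [r [L [lL DL Lgen]]] := linear_syzygies kH b0 (fun i => @cone_diff_lin i)
  (fun i is_ => cone_complex hP (ltnW is_)) (cone_diff_min mn) exH.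
pose L1 : 'M_(b s.+1, r) := usubmx L; pose L2 : 'M_(cone_rank s, r) := dsubmx L.
have LE : L = col_mx L1 L2 by rewrite vsubmxK.
have lL1 : linmx GH L1 by move=> i j; rewrite mxE.
have lL2 : linmx GH L2 by move=> i j; rewrite mxE.
rewrite LE in DL Lgen.
have [C CE] := cone_lift lL2 exH DL.
set cC := map_mx _ C in CE.
pose Ga := L1 + phi s.+1 *m cC.
have lGa : linmx GH Ga by apply: linmxD => //; apply: linmx_mull; apply: cone_map_lin.
have dGa : dH s *m Ga = 0.
  by rewrite mulmxDr mulmxA (cone_chain hP) // -mulmxA CE; apply: cone_cycle.
have [lGa0 [C1 C1E]] := qlinmx_co lGa.
(* The y-coefficients of a linear matrix are scalars, and minimality forbids a nonzero scalar
   cycle. *)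
have Ga1 : c1 Ga = 0.
  by rewrite C1E (minimal_mx mn (C := C1)) ?map_mx0 // -C1E -map_co1M dGa map_mx0.
have [|w] := Lgen (col_mx (em v) 0).
  by apply: cone_top_cycle; rewrite -map_mxM v0 map_mx0.
rewrite mul_col_mx => /eq_col_mx[E1 E2].
have [|w2 w2E] := Lgen (cC *m w); first by rewrite mulmxA CE -E2.
have lnu : linmx GH (prj s *m L2).
  move: (L2) lL2; case: (s) => [|t] M lM /=; first by rewrite mul1mx.
  by rewrite -[M]vsubmxK mul_row_col mul1mx mul0mx addr0 => i j; rewrite mxE.
have [lnu0 [C2 C2E]] := qlinmx_co lnu.
have [lL10 [C3 C3E]] := qlinmx_co lL1.
have [A0 A0E] : exists A : 'M[K]_(_, r), c0 Ga = d s.+1 *m cmx A.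
  by apply: lg => //; rewrite -map_co0M dGa map_mx0.
have [A1 A1E] : exists A : 'M[K]_(_, r), cone_syz1 L1 L2 = d s.+1 *m cmx A.
  apply: lg; last exact: cone_syz1_cycle.
  rewrite /cone_syz1 C2E -map_mxM; apply: linmxD => //.
  exact: linmx_scale_const.
have [A2 A2E] : exists A : 'M[K]_(_, r), cone_syz2 L1 L2 = d s.+1 *m cmx A.
  apply: lg; last exact: cone_syz2_cycle.
  rewrite /cone_syz2 C3E; apply: linmxD; first exact: linmx_scale_const.
  exact: linmx_mulr.
pose X := em (cmx A0) *m w - (y *: em (cmx A1) + qemb mu p *: em (cmx A2)) *m w2.
(* Over the extension [v] is the boundary of [X]; coefficients of 1 bring this equation back to
   [R]. *)
exists (c0 X); rewrite -map_co0M -[LHS](map_co0_emb mu); congr (map_mx _ _).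
have -> : em v = Ga *m w - phi s.+1 *m col_mx L1 L2 *m w2.
  by rewrite mulmxDl -E1 -!mulmxA w2E addrK.
rewrite cone_mapE A1E A2E [Ga]quadext_mxE Ga1 A0E map_mx0 scaler0 addr0 !map_mxM.
by rewrite /X mulmxBr !mulmxA mulmxDr -!scalemxAr.
Qed.

End Cone.

Theorem quadext_koszul (K : fieldType) (R : comNzRingType) n (G : graded_alg K R n)
    (p q : R) (lp : lin G p) (lq : lin G q) :
  koszul_alg (quad_alg (linpart_mu lp lq) (aug_mu0 q lp)) <-> koszul_alg G.
Proof.
split=> [kH|[b [d [b0 ld ex0 ex]]]].
  have [b [d [b0 ld mn ex0 lg]]] := minimal_linear_chain G.
  have [h hP] := null_homotopy_ex lq ld mn ex0.
  exists b, d; split=> // s; elim/ltn_ind: s => s IH.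
  by apply: (cone_syzygies ld mn lg b0 (conj ex0 IH) (hP s (conj ex0 IH)) kH).
have [h hP] := null_homotopy_ex lq ld (exact_minimal ld ex) ex0.
apply: (cone_koszul lp lq (h := h) ld b0 ex0 ex) => s; apply: hP.
by split=> // i _; apply: ex.
Qed.

(** * Orders and homogeneous components of polynomials *)

Lemma mnm_neq0_ex n (u : 'X_{1..n}) : u != 0%MM -> exists i, u i != 0%N.
Proof.
move=> u0; apply/existsP; apply: contraNT u0; rewrite negb_exists => /forallP h.
by apply/eqP/mnmP => i; rewrite mnm0E; have := h i; rewrite negbK => /eqP.
Qed.

Section Ideals.
Variables (K : fieldType) (n : nat).
Local Notation A := {mpoly K[n]}.
Local Notation hc := (pihomog mdeg).
Implicit Types (p q : A) (J : A -> Prop).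

Definition is_ideal J : Prop :=
  [/\ J 0, (forall p q, J p -> J q -> J (p + q)) & forall a p, J p -> J (a * p)].

Lemma idealN J p : is_ideal J -> J p -> J (- p).
Proof. by move=> [_ _ JM] Jp; rewrite -mulN1r; apply: JM. Qed.

Lemma idealB J p q : is_ideal J -> J p -> J q -> J (p - q).
Proof. by move=> iJ Jp Jq; case: (iJ) => _ JD _; apply: JD => //; apply: idealN. Qed.

Lemma ideal_sum J I (r : seq I) (P : pred I) F : is_ideal J ->
  (forall i, P i -> J (F i)) -> J (\sum_(i <- r | P i) F i).
Proof. by move=> [J0 JD _] H; elim/big_ind: _. Qed.

Lemma ideal_sum_seq J (I : eqType) (r : seq I) (F : I -> A) : is_ideal J ->
  (forall i, i \in r -> J (F i)) -> J (\sum_(i <- r) F i).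
Proof.
by move=> iJ H; rewrite big_seq; apply: ideal_sum.
Qed.

Lemma idealZ J c p : is_ideal J -> J p -> J (c *: p).
Proof. by move=> [_ _ JM] Jp; rewrite -mul_mpolyC; apply: JM. Qed.

Lemma ideal_gen_ideal (P : A -> Prop) : is_ideal (ideal_gen P).
Proof.
split.
- by exists [::]; split; rewrite ?big_nil.
- move=> p q [s [sP ->]] [t [tP ->]]; exists (s ++ t); split; last by rewrite big_cat.
  by move=> z; rewrite mem_cat => /orP[/sP|/tP].
move=> a p [s [sP ->]]; exists [seq (a * z.1, z.2) | z <- s]; split.
  by move=> z /mapP[z' /sP Pz ->].
by rewrite big_map mulr_sumr; apply: eq_bigr => z _; rewrite mulrA.
Qed.

Lemma mem_ideal_gen (P : A -> Prop) p : P p -> ideal_gen P p.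
Proof.
move=> Pp; exists [:: (1, p)]; split; last by rewrite big_seq1 mul1r.
by move=> z; rewrite inE => /eqP ->.
Qed.

Lemma ideal_gen_sub (P : A -> Prop) J : is_ideal J ->
  (forall p, P p -> J p) -> forall p, ideal_gen P p -> J p.
Proof.
move=> iJ PJ p [s [sP ->]]; apply: ideal_sum_seq => // z /sP /PJ Jz.
by case: iJ => _ _; apply.
Qed.

(** A lower bound on the order, stated on coefficients so that it holds for 0 and is stable under
    sums. *)
Definition ordge d p : Prop := forall u, (mdeg u < d)%N -> p@_u = 0.

Lemma mcoeff_hc d p u : (hc d p)@_u = if mdeg u == d then p@_u else 0.
Proof.
rewrite pihomogE raddf_sum /= (eq_bigr (fun m => p@_m * (m == u)%:R)); last first.
  by move=> m _; rewrite mcoeffZ mcoeffX.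
have [up|up] := boolP (u \in msupp p); last first.
  rewrite (memN_msupp_eq0 up) if_same big_seq_cond big1 // => m /andP[mp _].
  by case: eqP => [e|_]; [rewrite -e mp in up | rewrite mulr0].
rewrite big_mkcond (bigD1_seq u) ?msupp_uniq //= eqxx mulr1 big1 ?addr0 // => m /negbTE->.
by rewrite mulr0 if_same.
Qed.

Lemma homog_hc d p : homog_of_deg d p <-> hc d p = p.
Proof.
split=> [h|<- u]; last first.
  by rewrite mcoeff_msupp mcoeff_hc; case: (mdeg u =P d) => // _; rewrite eqxx.
apply/mpolyP => u; rewrite mcoeff_hc; case: eqP => // ne.
by apply/esym/eqP; rewrite mcoeff_eq0; apply/negP => /h.
Qed.

Lemma hc_homog d p : homog_of_deg d (hc d p).
Proof. by apply/homog_hc; rewrite pihomog_id. Qed.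

Lemma homog0 d : homog_of_deg d (0 : A).
Proof. by apply/homog_hc; rewrite raddf0. Qed.

Lemma homogD d p q : homog_of_deg d p -> homog_of_deg d q -> homog_of_deg d (p + q).
Proof. by move=> /homog_hc hp /homog_hc hq; apply/homog_hc; rewrite raddfD /= hp hq. Qed.

Lemma homogZ d c p : homog_of_deg d p -> homog_of_deg d (c *: p).
Proof. by move=> /homog_hc hp; apply/homog_hc; rewrite linearZ /= hp. Qed.

Lemma homogN d p : homog_of_deg d p -> homog_of_deg d (- p).
Proof. by move=> /homog_hc hp; apply/homog_hc; rewrite raddfN /= hp. Qed.

Lemma homogB d p q : homog_of_deg d p -> homog_of_deg d q -> homog_of_deg d (p - q).
Proof. by move=> hp /homogN; apply: homogD. Qed.

Lemma homog_sum d I (r : seq I) (P : pred I) F :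
  (forall i, P i -> homog_of_deg d (F i)) -> homog_of_deg d (\sum_(i <- r | P i) F i : A).
Proof. by move=> H; elim/big_ind: _ => //; [apply: homog0 | apply: homogD]. Qed.

Lemma homogX u : homog_of_deg (mdeg u) ('X_[u] : A).
Proof. by move=> v; rewrite msuppX inE => /eqP ->. Qed.

Lemma homog_dhomog d p : homog_of_deg d p <-> p \is d.-homog.
Proof. by split=> [h|/dhomogP h]; [apply/dhomogP|]. Qed.

Lemma homogM d e p q : homog_of_deg d p -> homog_of_deg e q -> homog_of_deg (d + e) (p * q).
Proof. by move=> /homog_dhomog hp /homog_dhomog hq; apply/homog_dhomog/dhomogM. Qed.

Lemma homog_exp d p j : homog_of_deg d p -> homog_of_deg (d * j) (p ^+ j).
Proof. by move=> /homog_dhomog h; apply/homog_dhomog/dhomogMn. Qed.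

Lemma ordge0 d : ordge d 0. Proof. by move=> u _; rewrite mcoeff0. Qed.

Lemma ordgeD d p q : ordge d p -> ordge d q -> ordge d (p + q).
Proof. by move=> hp hq u ud; rewrite mcoeffD hp // hq // addr0. Qed.

Lemma ordgeN d p : ordge d p -> ordge d (- p).
Proof. by move=> hp u ud; rewrite mcoeffN hp // oppr0. Qed.

Lemma ordgeB d p q : ordge d p -> ordge d q -> ordge d (p - q).
Proof. by move=> hp /ordgeN; apply: ordgeD. Qed.

Lemma ordgeZ d c p : ordge d p -> ordge d (c *: p).
Proof. by move=> hp u ud; rewrite mcoeffZ hp // mulr0. Qed.

Lemma ordge_sum d I (r : seq I) (P : pred I) F :
  (forall i, P i -> ordge d (F i)) -> ordge d (\sum_(i <- r | P i) F i).
Proof. by move=> H; elim/big_ind: _ => //; [apply: ordge0 | apply: ordgeD]. Qed.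

Lemma ordgeW d e p : (e <= d)%N -> ordge d p -> ordge e p.
Proof. by move=> ed hp u ue; apply: hp; apply: leq_trans ue ed. Qed.

Lemma homog_ordge d p : homog_of_deg d p -> ordge d p.
Proof.
move=> h u ud; apply/eqP; rewrite mcoeff_eq0; apply/negP => /h e.
by rewrite e ltnn in ud.
Qed.

Lemma ordgeX u : ordge (mdeg u) 'X_[u].
Proof. exact/homog_ordge/homogX. Qed.

Lemma ordgeM d e p q : ordge d p -> ordge e q -> ordge (d + e) (p * q).
Proof.
move=> hp hq u ud; apply/eqP; rewrite mcoeff_eq0; apply/negP.
move=> /msuppM_le/allpairsP[[v w] /= [vp wq uE]].
have vd : (d <= mdeg v)%N by rewrite leqNgt; apply/negP => /hp/eqP; rewrite mcoeff_eq0 vp.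
have we : (e <= mdeg w)%N by rewrite leqNgt; apply/negP => /hq/eqP; rewrite mcoeff_eq0 wq.
by move: ud; rewrite uE mdegD ltnNge leq_add.
Qed.

Lemma ordge_hc0 d e p : ordge d p -> (e < d)%N -> hc e p = 0.
Proof.
move=> hp ed; apply/mpolyP => u; rewrite mcoeff_hc mcoeff0; case: eqP => // ue.
by apply: hp; rewrite ue.
Qed.

Lemma ordge_sub d p : ordge d p -> ordge d.+1 (p - hc d p).
Proof.
move=> hp u; rewrite ltnS leq_eqVlt => /orP[/eqP e|lt].
  by rewrite mcoeffB mcoeff_hc e eqxx subrr.
by rewrite mcoeffB mcoeff_hc (hp u) // if_same subrr.
Qed.

Lemma hcM d e p q : ordge d p -> ordge e q -> hc (d + e) (p * q) = hc d p * hc e q.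
Proof.
move=> hp hq; rewrite -[p in LHS](subrK (hc d p)) -[q in LHS](subrK (hc e q)).
set p' := p - _; set q' := q - _; have hp' : ordge d.+1 p' := ordge_sub hp.
have hq' : ordge e.+1 q' := ordge_sub hq.
have oh k r : ordge k (hc k r) by apply/homog_ordge/hc_homog.
have -> : (p' + hc d p) * (q' + hc e q) =
  hc d p * hc e q + (p' * q' + hc d p * q' + p' * hc e q) by ring.
rewrite raddfD /= [X in _ + X](@ordge_hc0 (d + e).+1) // ?addr0.
  by apply/homog_hc/homogM; apply: hc_homog.
apply: ordgeD; first apply: ordgeD.
- by apply: ordgeW (ordgeM hp' hq'); lia.
- by rewrite -addnS; apply: ordgeM.
- by rewrite -addSn; apply: ordgeM.
Qed.

Lemma hc_homogM d e p q : homog_of_deg e q -> hc (d + e) (p * q) = hc d p * q.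
Proof.
move=> hq; rewrite {1}(pihomog_partitionE (leqnn (msize p))) mulr_suml raddf_sum /=.
have E k r : hc (d + e) (hc k r * q) = if k == d then hc d r * q else 0.
  have [->|ne] := eqVneq k d; first by apply/homog_hc/homogM => //; apply: hc_homog.
  apply: (@pihomog_ne0 _ _ _ (k + e) (d + e)); first by rewrite eqn_add2r.
  by apply/homog_dhomog/homogM => //; apply: hc_homog.
rewrite (eq_bigr _ (fun (i : 'I_(msize p)) _ => E i p)).
have [lt|ge] := ltnP d (msize p).
  rewrite (bigD1 (Ordinal lt)) //= eqxx big1 ?addr0 // => i ne.
  by rewrite ifN //; apply: contraNneq ne => e'; apply/eqP/val_inj.
have -> : hc d p = 0.
  apply/mpolyP => u; rewrite mcoeff_hc mcoeff0; case: eqP => // e'.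
  by apply/eqP; rewrite mcoeff_eq0; apply: msize_mdeg_ge; rewrite e'.
rewrite mul0r big1 // => i _; rewrite ifN // neq_ltn.
by rewrite (leq_trans (ltn_ord i) ge).
Qed.

Lemma hc_homogM0 d e p q : homog_of_deg e q -> (d < e)%N -> hc d (p * q) = 0.
Proof.
move=> hq de; apply: (@ordge_hc0 (0 + e)); last by [].
by apply: ordgeM; [move=> u | apply: homog_ordge].
Qed.

Definition homog_ideal J : Prop := is_ideal J /\ forall d p, J p -> J (hc d p).

Lemma homog_ideal_gen (P : A -> Prop) :
  (forall q, P q -> exists d, homog_of_deg d q) -> homog_ideal (ideal_gen P).
Proof.
move=> hP; split=> [|d p [s [sP ->]]]; first exact: ideal_gen_ideal.
rewrite raddf_sum /=; apply: ideal_sum_seq => [|z /sP Pz]; first exact: ideal_gen_ideal.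
have [e he] := hP _ Pz; have [J0 _ JM] := ideal_gen_ideal P.
have [ed|/(hc_homogM0 z.1 he) -> //] := leqP e d.
rewrite -(subnK ed) hc_homogM //; apply: JM; exact: mem_ideal_gen.
Qed.

Lemma lowdeg_ordge p : ordge (lowdeg p) p.
Proof.
move=> u; rewrite /lowdeg => ud; apply/eqP; rewrite mcoeff_eq0; apply: contraTN ud => up.
rewrite -leqNgt; elim: (msupp p) up => //= v s IH; rewrite inE => /orP[/eqP ->|/IH h].
  exact: geq_minl.
exact: leq_trans (geq_minr _ _) h.
Qed.

Lemma init_formE p : init_form p = hc (lowdeg p) p.
Proof. by []. Qed.

Lemma lowdeg_eq d p : ordge d p -> hc d p != 0 -> lowdeg p = d.
Proof.
move=> hp nz; apply/eqP; rewrite eqn_leq; apply/andP; split.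
  rewrite leqNgt; apply/negP => lt.
  by rewrite (ordge_hc0 (lowdeg_ordge (p := p)) lt) eqxx in nz.
have p0 : msize p != 0%N by rewrite msize_poly_eq0; apply: contraNneq nz => ->; rewrite raddf0.
rewrite /lowdeg; have sz : (d <= msize p)%N.
  rewrite leqNgt; apply/negP => lt; move/eqP: nz; apply; apply/mpolyP => u.
  rewrite mcoeff_hc mcoeff0; case: eqP => // e; apply/eqP; rewrite mcoeff_eq0.
  by apply: msize_mdeg_ge; rewrite e ltnW.
have : forall u, u \in msupp p -> (d <= mdeg u)%N.
  by move=> u; rewrite mcoeff_msupp leqNgt; apply: contraNN => /hp ->.
elim: (msupp p) => //= v s IH H; rewrite leq_min H ?mem_head //= IH // => u us.
by apply: H; rewrite inE us orbT.
Qed.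

Lemma init_form_eq d p : ordge d p -> hc d p != 0 -> init_form p = hc d p.
Proof. by move=> hp nz; rewrite init_formE (lowdeg_eq hp nz). Qed.

Lemma tangent_homog_ideal I : homog_ideal (tangent_ideal I).
Proof.
apply: homog_ideal_gen => q [g [_ _ ->]]; exists (lowdeg g).
by rewrite init_formE; apply: hc_homog.
Qed.

(** If the order of [g] exceeds [d] the component is just 0. Admitting this case lets one bound [d]
    serve for all remainders of a division. *)
Lemma mem_tangent (I : A -> Prop) d g : I g -> ordge d g -> tangent_ideal I (hc d g).
Proof.
move=> Ig hg; have [->|nz] := eqVneq (hc d g) 0; first by case: (ideal_gen_ideal (fun q => exists g, [/\ I g, g != 0 & q = init_form g])).
apply: mem_ideal_gen; exists g; split=> //; last by rewrite (init_form_eq hg nz).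
by apply: contraNneq nz => ->; rewrite raddf0.
Qed.

Lemma ideal_gen_coeff0 d (P : A -> Prop) p :
  (forall q, P q -> ordge d q) -> ideal_gen P p -> ordge d p.
Proof.
move=> hP [s [sP ->]]; rewrite big_seq; apply: ordge_sum => z /sP /hP hz.
by rewrite -[d]add0n; apply: ordgeM => // u.
Qed.

End Ideals.

(** * The polynomial ring with one more variable, and toric ideals *)

Lemma mpoly_rmorph_ext (K : fieldType) n (S : comNzRingType) (f g : {rmorphism {mpoly K[n]} -> S}) :
  (forall k, f k%:MP = g k%:MP) -> (forall i, f 'X_i = g 'X_i) -> forall p, f p = g p.
Proof.
move=> fgC fgX p; rewrite [p]mpolyE !raddf_sum; apply: eq_bigr => u _ /=.
rewrite -mul_mpolyC !rmorphM /= fgC; congr (_ * _).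
by rewrite mpolyXE_id !rmorph_prod; apply: eq_bigr => i _; rewrite !rmorphXn /= fgX.
Qed.

Section Widen.
Variables (K : fieldType) (m : nat).
Local Notation A := {mpoly K[m]}.
Local Notation S := {mpoly K[m.+1]}.
Local Notation em := (@emb K m).
Local Notation wid := (@mnmwiden m).
Local Notation hc := (pihomog mdeg).
Local Notation y := ('X_ord_max : S).

HB.instance Definition _ := GRing.RMorphism.copy em (@mwiden m K).

Definition low (w : 'X_{1..m.+1}) : 'X_{1..m} :=
  [multinom w (widen_ord (leqnSn m) i) | i < m].

Lemma low_wid u : low (wid u) = u.
Proof. by apply/mnmP => i; rewrite mnmE mnmwiden_widen. Qed.

Lemma mnm_split w : w = (wid (low w) + U_(ord_max) *+ w ord_max)%MM.
Proof.
apply/mnmP => i; rewrite mnmDE mulmnE mnm1E.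
case: (unliftP ord_max i) => [j ->|->].
  rewrite lift_max_widen mnmwiden_widen mnmE -val_eqE /= gtn_eqF //= mul0n addn0.
  by [].
by rewrite mnmwiden_ordmax eqxx mul1n.
Qed.

Lemma low_split u e : low (wid u + U_(ord_max) *+ e)%MM = u.
Proof.
apply/mnmP => i; rewrite mnmE mnmDE mnmwiden_widen mulmnE mnm1E -val_eqE /=.
by rewrite gtn_eqF //= mul0n addn0.
Qed.

Lemma max_split u e : (wid u + U_(ord_max) *+ e)%MM ord_max = e.
Proof. by rewrite mnmDE mnmwiden_ordmax mulmnE mnm1E eqxx mul1n. Qed.

Lemma low_max_inj w w' : low w = low w' -> w ord_max = w' ord_max -> w = w'.
Proof. by move=> e1 e2; rewrite (mnm_split w) (mnm_split w') e1 e2. Qed.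

Lemma mdeg_wid u : mdeg (wid u) = mdeg u.
Proof.
rewrite !mdegE big_ord_recr /= mnmwiden_ordmax addn0.
by apply: eq_bigr => i _; rewrite mnmwiden_widen.
Qed.

Lemma mdeg_low w : (mdeg (low w) + w ord_max)%N = mdeg w.
Proof. by rewrite [in RHS](mnm_split w) mdegD mdeg_wid mdegMn mdeg1 mul1n. Qed.

Lemma emb_X u : em 'X_[u] = 'X_[wid u].
Proof. exact: mwidenX. Qed.

Lemma emb_var i : em 'X_i = xvar K i.
Proof. by rewrite emb_X mnmwiden1. Qed.

Lemma emb_C k : em k%:MP = k%:MP.
Proof. exact: mwidenC. Qed.

Lemma emb_Z k p : em (k *: p) = k *: em p.
Proof. exact: mwidenZ. Qed.

Lemma X_split w : 'X_[w] = y ^+ w ord_max * em 'X_[low w] :> S.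
Proof. by rewrite emb_X {1}(mnm_split w) mpolyXD mpolyXn mulrC. Qed.

Lemma emb_sumX p : em p = \sum_(u <- msupp p) p@_u *: 'X_[wid u].
Proof.
rewrite {1}[p]mpolyE (raddf_sum em); apply: eq_bigr => u _ /=.
by rewrite [LHS]emb_Z emb_X.
Qed.

Lemma mcoeff_emb p w : (em p)@_w = if w ord_max == 0%N then p@_(low w) else 0.
Proof.
rewrite emb_sumX (raddf_sum (mcoeff w)) /=; case: eqP => w0; last first.
  rewrite big1 // => u _; rewrite mcoeffZ mcoeffX.
  case: eqP => [e|]; last by rewrite mulr0.
  by move: w0; rewrite -e mnmwiden_ordmax.
rewrite [in RHS](mpolyE p) (raddf_sum (mcoeff (low w))) /=.
apply: eq_bigr => u _; rewrite !mcoeffZ !mcoeffX; congr (_ * _%:R).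
congr (nat_of_bool _); apply/eqP/eqP => [<-|->]; first by rewrite low_wid.
by apply: low_max_inj; rewrite ?low_wid // mnmwiden_ordmax w0.
Qed.

Lemma mcoeff_yX e (p : S) w : (y ^+ e * p)@_w =
  if (e <= w ord_max)%N then p@_(w - U_(ord_max) *+ e) else 0.
Proof.
rewrite mpolyXn mulrC; case: leqP => [le|gt].
  rewrite -{1}[w](@submK _ (U_(ord_max) *+ e)%MM); first by rewrite addmC mcoeffMX.
  apply/mnm_lepP => i; rewrite mulmnE mnm1E; case: eqP => [<-|_]; rewrite ?mul1n ?mul0n //.
apply/eqP; rewrite mcoeff_eq0; apply/negP.
move=> /msuppM_le/allpairsP[[v1 v2] /= [_ ]]; rewrite msuppX inE => /eqP -> e'.
by move: gt; rewrite e' mnmDE mulmnE mnm1E eqxx mul1n ltnNge leq_addl.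
Qed.

Lemma mcoeff_yemb e p w : (y ^+ e * em p)@_w = if w ord_max == e then p@_(low w) else 0.
Proof.
rewrite mcoeff_yX mcoeff_emb mnmBE mulmnE mnm1E eqxx mul1n.
have lowB : low (w - U_(ord_max) *+ e)%MM = low w.
  apply/mnmP => i; rewrite !mnmE mulmnE mnm1E -val_eqE /= gtn_eqF //= mul0n subn0 //.
rewrite lowB subn_eq0 eqn_leq andbC.
by case: leqP.
Qed.

Lemma ordge_yemb d e p : ordge d p -> ordge (d + e) (y ^+ e * em p).
Proof.
move=> hp w; rewrite mcoeff_yemb; case: eqP => // <-; rewrite -mdeg_low ltn_add2r.
exact: hp.
Qed.

Lemma hc_yemb d e p : hc (d + e) (y ^+ e * em p) = y ^+ e * em (hc d p).
Proof.
apply/mpolyP => w; rewrite mcoeff_hc !mcoeff_yemb mcoeff_hc -mdeg_low.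
by case: (w ord_max =P e) => [->|_]; rewrite ?eqn_add2r // if_same.
Qed.

Lemma hc_emb d p : hc d (em p) = em (hc d p).
Proof. by have := hc_yemb d 0 p; rewrite addn0 expr0 !mul1r. Qed.

Lemma homog_emb d p : homog_of_deg d p -> homog_of_deg d (em p).
Proof. by move=> /homog_hc hp; apply/homog_hc; rewrite hc_emb hp. Qed.

Lemma ordge_emb d p : ordge d p -> ordge d (em p).
Proof. by move=> /(ordge_yemb (e := 0)); rewrite addn0 expr0 mul1r. Qed.

Lemma mpoly_yemb (p : S) : p = \sum_(w <- msupp p) y ^+ w ord_max * em (p@_w *: 'X_[low w]).
Proof.
by rewrite {1}[p]mpolyE; apply: eq_bigr => w _; rewrite X_split emb_Z scalerAr.
Qed.

(** Powers y^e with e >= c are rewritten by y^c = M; as [M] has order at least c, this never lowers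
    the order. The subtractions are truncated: the bounds are void for remainders with i >= d, and
    for [h] when c >= d. *)
Lemma emb_division c (M : A) d (g : S) : (0 < c)%N -> ordge c M -> ordge d g ->
  exists (r : 'I_c -> A) h, [/\ g = \sum_(i < c) y ^+ i * em (r i) + h * (y ^+ c - em M),
    forall i : 'I_c, ordge (d - i) (r i) & ordge (d - c) h].
Proof.
move=> c0 oM; pose P (g : S) := exists (r : 'I_c -> A) h,
  [/\ g = \sum_(i < c) y ^+ i * em (r i) + h * (y ^+ c - em M),
    forall i : 'I_c, ordge (d - i) (r i) & ordge (d - c) h].
have PD g1 g2 : P g1 -> P g2 -> P (g1 + g2).
  move=> [r [h [-> hr hh]]] [r' [h' [-> hr' hh']]]; exists (fun i => r i + r' i), (h + h').
  split=> [|i|]; [|exact: ordgeD|exact: ordgeD].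
  rewrite mulrDl addrACA -big_split; congr (_ + _); apply: eq_bigr => i _ /=.
  by rewrite raddfD mulrDr.
have P0 : P 0.
  exists (fun=> 0), 0; split=> [|i|]; try exact: ordge0.
  by rewrite mul0r addr0 big1 // => i _; rewrite raddf0 mulr0.
have Pm e : forall a, ordge (d - e) a -> P (y ^+ e * em a).
  elim/ltn_ind: e => e IH a oa; have [lt|ge] := ltnP e c.
    exists (fun i => if i == Ordinal lt then a else 0), 0; split=> [|i|]; last exact: ordge0.
      rewrite (bigD1 (Ordinal lt)) //= eqxx mul0r addr0 big1 ?addr0 // => i /negbTE->.
      by rewrite raddf0 mulr0.
    by case: eqP => [->|_] //; exact: ordge0.
  have -> : y ^+ e * em a = y ^+ (e - c) * em (a * M) + y ^+ (e - c) * em a * (y ^+ c - em M).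
    by rewrite rmorphM -{1}(subnK ge) exprD /=; ring.
  apply: PD; first by apply: IH; [lia | apply: ordgeW (ordgeM oa oM); lia].
  exists (fun=> 0), (y ^+ (e - c) * em a); split=> [|i|]; last by apply: ordgeW (ordge_yemb oa); lia.
    by rewrite big1 ?add0r // => i _; rewrite raddf0 mulr0.
  exact: ordge0.
move=> og; rewrite -/(P g) (mpoly_yemb g) big_seq; elim/big_ind: _ => // w wg.
apply: Pm; apply: ordgeZ; apply: (@ordgeW _ _ (mdeg (low w))); last exact: ordgeX.
have : (d <= mdeg w)%N by rewrite leqNgt; apply: contraTN wg => /og/eqP; rewrite mcoeff_eq0.
by have := mdeg_low w; lia.
Qed.
End Widen.

(** * Toric ideals and residues modulo c *)

Definition tmap (K : fieldType) n (b : 'I_n -> nat) : {mpoly K[n]} -> {poly K} :=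
  mmap (@polyC K) (fun i => 'X^(b i)).
HB.instance Definition _ (K : fieldType) n (b : 'I_n -> nat) :=
  GRing.RMorphism.copy (tmap b) (mmap (@polyC K) (fun i => 'X^(b i))).

Section Toric.
Variables (K : fieldType) (m : nat) (a : 'I_m -> nat).

Lemma tmapP n (b : 'I_n -> nat) (p : {mpoly K[n]}) : toric_ker b p <-> tmap (K := K) b p = 0.
Proof. by []. Qed.

Lemma tmapC n (b : 'I_n -> nat) k : tmap (K := K) b k%:MP = k%:P.
Proof. exact: mmapC. Qed.

Lemma tmapX n (b : 'I_n -> nat) i : tmap (K := K) b 'X_i = 'X^(b i).
Proof. by rewrite /tmap mmapX mmap1U. Qed.

Lemma tmapXm n (b : 'I_n -> nat) (u : 'X_{1..n}) :
  tmap (K := K) b 'X_[u] = 'X^(\sum_i u i * b i).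
Proof.
rewrite mpolyXE_id rmorph_prod (big_morph (fun e => 'X^e : {poly K}) (exprD 'X) (expr0 'X)).
by apply: eq_bigr => i _; rewrite rmorphXn /= tmapX -exprM mulnC.
Qed.

Lemma toric_ideal n (b : 'I_n -> nat) : is_ideal (@toric_ker K n b).
Proof.
split=> [|p q /tmapP hp /tmapP hq|r p /tmapP hp]; apply/tmapP; first by rewrite raddf0.
  by rewrite raddfD /= hp hq addr0.
by rewrite rmorphM /= hp mulr0.
Qed.

Variables (c l : nat).
Local Notation b := (glue_gens c l a).
Local Notation S := {mpoly K[m.+1]}.
Local Notation y := ('X_ord_max : S).

Lemma glue_gens_max : b ord_max = l.
Proof. by rewrite /glue_gens unlift_none. Qed.

Lemma glue_gens_widen i : b (widen_ord (leqnSn m) i) = (c * a i)%N.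
Proof.
by rewrite /glue_gens -lift_max_widen liftK.
Qed.

Lemma tmap_emb (p : {mpoly K[m]}) : tmap b (emb p) = tmap a p \Po 'X^c.
Proof.
apply: (mpoly_rmorph_ext (f := tmap b \o @emb K m) (g := comp_poly 'X^c \o tmap a)) => /= [k|i].
  by rewrite emb_C !tmapC comp_polyC.
by rewrite emb_var !tmapX glue_gens_widen comp_Xn_poly exprM.
Qed.

Lemma toric_ker_emb (p : {mpoly K[m]}) : toric_ker a p -> toric_ker b (emb p).
Proof. by move=> /tmapP hp; apply/tmapP; rewrite tmap_emb hp comp_poly0. Qed.

(** The image of the term in y^i only has exponents congruent to l i modulo c. These residues differ
    for different i < c by coprimality, so nothing cancels between terms; the coefficient of t^j in
    the image of [r i] is found at l i + c j. *)
Lemma toric_ker_residues (r : 'I_c -> {mpoly K[m]}) : (0 < c)%N -> coprime c l ->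
  toric_ker b (\sum_(i < c) y ^+ i * emb (r i)) -> forall i, toric_ker a (r i).
Proof.
move=> c0 cl /tmapP; rewrite (raddf_sum (tmap b)) /= => E i; apply/tmapP/polyP => j; rewrite coef0.
have := congr1 (fun p : {poly K} => p`_(l * i + c * j)) E; rewrite coef_sum coef0.
have T (k : 'I_c) : (tmap b (y ^+ k * emb (r k)))`_(l * i + c * j) = if k == i then (tmap a (r i))`_j else 0.
  rewrite rmorphM rmorphXn /= tmapX glue_gens_max -exprM tmap_emb coefXnM coef_comp_poly_Xn //.
  have [->|ne] := eqVneq k i; first by rewrite ltnNge leq_addr /= addKn dvdn_mulr // mulKn.
  case: ltnP => // le; case: ifP => // /dvdnP[q qE]; case/eqP: ne; apply/val_inj.
  have : l * k = l * i %[mod c].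
    have -> : (l * k = l * i + c * j - q * c)%N by lia.
    have qc : (q * c <= l * i + c * j)%N by lia.
    by rewrite -[in RHS](modnMDl j) -[in LHS](modnMDl q) [(q * c + _)%N]subnKC // addnC mulnC.
  move=> /eqP; rewrite -[(l * k)%N]addn0.
  wlog le' : i k {le qE} / (k <= i)%N.
    move=> H e; case: (leqP k i) => [ki|/ltnW ik]; first exact: H ki e.
    by apply/esym/H => //; rewrite addn0 eq_sym -[(l * k)%N]addn0.
  rewrite addn0 eq_sym eqn_mod_dvd ?leq_mul2l ?le' ?orbT // -mulnBr Gauss_dvdr //.
  have lt : (i - k < c)%N by apply: leq_ltn_trans (leq_subr _ _) (ltn_ord i).
  case: (posnP (i - k)) => [e _|pos /(dvdn_leq pos)]; last by rewrite leqNgt lt.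
  by apply/eqP; rewrite eqn_leq le' -subn_eq0 e.
by rewrite (eq_bigr _ (fun k _ => T k)) (bigD1 i) //= eqxx big1 ?addr0 // => k /negbTE->.
Qed.

End Toric.

(** * The tangent ideal of a gluing *)

Section LowDegree.
Variables (K : fieldType) (m : nat) (L : nat -> Prop) (a : 'I_m -> nat).
Hypotheses (nL : numerical_semigroup L) (ia : injective a).
Hypothesis minL : forall x, min_gen L x <-> exists i, a i = x.

Lemma toric_ker_coeff (g : {mpoly K[m]}) (u : 'X_{1..m}) : toric_ker a g ->
  (forall v : 'X_{1..m}, (\sum_i v i * a i = \sum_i u i * a i)%N -> v = u) -> g@_u = 0.
Proof.
move=> /tmapP E H; have := congr1 (fun p : {poly K} => p`_(\sum_i u i * a i)%N) E.
rewrite [g in tmap _ g]mpolyE (raddf_sum (tmap a)) coef_sum coef0 /=.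
have T (v : 'X_{1..m}) : (tmap a (g@_v *: 'X_[v]))`_(\sum_i u i * a i)%N = if v == u then g@_u else 0.
  rewrite -mul_mpolyC rmorphM /= tmapC tmapXm coefCM coefXn.
  have [->|ne] := eqVneq v u; first by rewrite eqxx mulr1.
  by case: eqP => [/esym/H e|]; [rewrite e eqxx in ne | rewrite mulr0].
rewrite (eq_bigr _ (fun v _ => T v)) -big_mkcond /=.
have [ug|/memN_msupp_eq0 //] := boolP (u \in msupp g).
by rewrite big_mkcond (bigD1_seq u) ?msupp_uniq //= eqxx big1 ?addr0 // => v /negbTE->.
Qed.

Lemma gen_min i : min_gen L (a i).
Proof. by apply/minL; exists i. Qed.

Lemma gen_gt0 i : (0 < a i)%N.
Proof. by case: (gen_min i). Qed.

Lemma sum_gens_mem (u : 'X_{1..m}) : L (\sum_i u i * a i)%N.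
Proof.
case: nL => L0 LD _; elim/big_ind: _ => // i _.
elim: (u i) => [|e IH]; first by rewrite mul0n.
by rewrite mulSn; apply: LD => //; case: (gen_min i).
Qed.

Lemma sum_gens_eq0 (u : 'X_{1..m}) : (\sum_i u i * a i = 0)%N -> u = 0%MM.
Proof.
move=> /eqP; rewrite sum_nat_eq0 => /forallP H; apply/mnmP => i.
by have := H i; rewrite /= muln_eq0 mnm0E => /orP[/eqP //|]; rewrite gtn_eqF ?gen_gt0.
Qed.

(** The weights 0 and [a i] have only one expression each, since the generators are irreducible in
    [L] and pairwise distinct. Order two is what makes constant and linear parts well defined modulo
    the tangent ideal. *)
Lemma toric_ker_ordge2 (g : {mpoly K[m]}) : toric_ker a g -> ordge 2 g.
Proof.
move=> Ig u u2; apply: toric_ker_coeff (Ig) _ => v.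
have [u0|u0] := eqVneq u 0%MM.
  rewrite u0 [RHS]big1 => [|i _]; last by rewrite mnm0E mul0n.
  exact: sum_gens_eq0.
have /mdeg1P[i /eqP ui] : mdeg u == 1%N.
  by rewrite eqn_leq -ltnS u2 lt0n mdeg_eq0.
have -> : (\sum_j u j * a j = a i)%N.
  rewrite ui (bigD1 i) //= mnm1E eqxx mul1n big1 ?addn0 // => j ne.
  by rewrite mnm1E eq_sym (negbTE ne).
move=> E; have [j vj] : exists j, v j != 0%N.
  apply: mnm_neq0_ex; apply: contraTneq (gen_gt0 i) => v0.
  by rewrite -E v0 big1 // => j _; rewrite mnm0E.
pose w := (v - U_(j))%MM.
have vE : v = (w + U_(j))%MM by rewrite submK // lep1mP.
have E2 : (a i = \sum_t w t * a t + a j)%N.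
  rewrite -E vE; under eq_bigr do rewrite mnmDE mulnDl.
  rewrite big_split /=; congr (_ + _)%N.
  rewrite (bigD1 j) //= mnm1E eqxx mul1n big1 ?addn0 // => t ne.
  by rewrite mnm1E eq_sym (negbTE ne).
have [/sum_gens_eq0 w0|pos] := posnP (\sum_t w t * a t)%N; last first.
  case: (gen_min i) => _ _ []; exists (\sum_t w t * a t)%N, (a j); split=> //.
  - exact: sum_gens_mem.
  - by case: (gen_min j).
  - exact: gen_gt0.
move: E2; rewrite w0 big1 ?add0n => [/ia ij|t _]; last by rewrite mnm0E.
by rewrite ui vE w0 add0m ij.
Qed.

Lemma tangent_toric_ordge2 (g : {mpoly K[m]}) : tangent_ideal (toric_ker a) g -> ordge 2 g.
Proof.
apply: ideal_gen_coeff0 => q [h [Ih _ ->]] u u2; rewrite init_formE mcoeff_hc.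
by case: ifP => // _; apply: toric_ker_ordge2 u2.
Qed.
End LowDegree.

Section Glue.
Variables (K : fieldType) (m : nat) (a : 'I_m -> nat) (c l : nat) (lam : 'I_m -> nat).
Hypotheses (c0 : (0 < c)%N) (cl : coprime c l) (lE : expr_of a l lam).
Hypothesis ck : (c <= \sum_(i < m) lam i)%N.
Local Notation A := {mpoly K[m]}.
Local Notation S := {mpoly K[m.+1]}.
Local Notation y := ('X_ord_max : S).
Local Notation hc := (pihomog mdeg).
Local Notation IL := (@toric_ker K m a).
Local Notation IH := (@toric_ker K m.+1 (glue_gens c l a)).
Local Notation f := (@glue_rel K m c lam).

Let lamm : 'X_{1..m} := [multinom lam i | i < m].
(** This is the full monomial when the sum of [lam] equals c, and 0 when the sum is larger. *)
Definition glue_mu : A := hc c 'X_[lamm].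
Local Notation mu := glue_mu.

Lemma glue_relE : f = y ^+ c - emb 'X_[lamm].
Proof.
rewrite /glue_rel [X in emb X]mpolyXE_id (rmorph_prod (@emb K m)); congr (_ - _); apply: eq_bigr => i _ /=.
by rewrite rmorphXn /= emb_var mnmE.
Qed.

Lemma mdeg_lamm : mdeg lamm = (\sum_(i < m) lam i)%N.
Proof. by rewrite mdegE; apply: eq_bigr => i _; rewrite mnmE. Qed.

Lemma ordge_lamm : ordge c ('X_[lamm] : A).
Proof. by apply: (@ordgeW _ _ (mdeg lamm)); [rewrite mdeg_lamm | apply: ordgeX]. Qed.

Lemma glue_muP : mu = 0 \/ exists2 w, mdeg w = c & mu = 'X_[w].
Proof.
by rewrite /mu pihomogX; case: eqP => e; [right; exists lamm | left].
Qed.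

Lemma homog_yc : homog_of_deg c (y ^+ c).
Proof. by rewrite mpolyXn -{1}[c]mul1n -(mdeg1 (@ord_max m)) -mdegMn; apply: homogX. Qed.

Lemma hc_glue_rel : hc c f = y ^+ c - emb mu.
Proof. by rewrite glue_relE raddfB /= hc_emb; congr (_ - _); apply/homog_hc/homog_yc. Qed.

Lemma ordge_glue_rel : ordge c f.
Proof.
rewrite glue_relE; apply: ordgeB; first exact/homog_ordge/homog_yc.
exact/ordge_emb/ordge_lamm.
Qed.

Lemma mcoeff_yc_emb n (p : A) : (0 < n)%N -> (y ^+ n - emb p)@_(U_(ord_max) *+ n) = 1.
Proof.
move=> n0; rewrite mcoeffB mcoeff_emb mulmnE mnm1E eqxx mul1n gtn_eqF // subr0.
by rewrite mcoeffXn eqxx.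
Qed.

Lemma init_glue_rel : init_form f = y ^+ c - emb mu.
Proof.
rewrite (init_form_eq ordge_glue_rel) hc_glue_rel //.
apply/eqP => E; have := mcoeff_yc_emb mu c0; rewrite E mcoeff0 => /esym/eqP.
by rewrite oner_eq0.
Qed.

Lemma toric_glue_rel : IH f.
Proof.
apply/tmapP; rewrite glue_relE rmorphB rmorphXn /= tmapX glue_gens_max tmap_emb tmapXm.
rewrite comp_Xn_poly -!exprM; apply/eqP; rewrite subr_eq0; apply/eqP; congr ('X^_).
by rewrite mulnC lE; congr (_ * _)%N; apply: eq_bigr => i _; rewrite mnmE.
Qed.

Definition glue_ideal (J : A -> Prop) (M : A) : S -> Prop :=
  ideal_gen (fun q => (exists p, J p /\ q = emb p) \/ q = y ^+ c - emb M).

Theorem tangent_glue : same_ideal (tangent_ideal IH) (glue_ideal (tangent_ideal IL) mu).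
Proof.
have iG := ideal_gen_ideal (fun q => (exists p, tangent_ideal IL p /\ q = emb p) \/ q = y ^+ c - emb mu).
have [G0 GD GM] := iG.
have iT := ideal_gen_ideal (fun q => exists g, [/\ IH g, g != 0 & q = init_form g]).
move=> p; split; apply: ideal_gen_sub => // {}p.
  move=> [g [Ig _ ->]]; rewrite init_formE; move: (lowdeg g) (@lowdeg_ordge _ _ g) => d og.
  have [r [h [gE or oh]]] := emb_division c0 ordge_lamm og.
  rewrite -glue_relE in gE.
  have Ir i : IL (r i).
    apply: (toric_ker_residues (l := l)) => //.
    have -> : \sum_(i < c) y ^+ i * emb (r i) = g - h * f by rewrite gE addrK.
    apply: idealB Ig _; first exact: toric_ideal.
    by case: (toric_ideal K (glue_gens c l a)) => _ _; apply; apply: toric_glue_rel.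
  rewrite gE raddfD (raddf_sum (hc d)) /=; apply: GD.
    apply: ideal_sum => // i _; have [id|di] := leqP i d.
      rewrite -{1}(subnK id) hc_yemb; apply: GM; apply: mem_ideal_gen; left.
      by exists (hc (d - i) (r i)); split=> //; apply: mem_tangent.
    by rewrite (ordge_hc0 (ordge_yemb (e := i) (or i))) //; lia.
  have [cd|dc] := leqP c d.
    rewrite -{1}(subnK cd) (hcM oh ordge_glue_rel) hc_glue_rel; apply: GM.
    by apply: mem_ideal_gen; right.
  by rewrite (ordge_hc0 (ordgeM oh ordge_glue_rel)) //; lia.
move=> [[q [Tq ->]]|->]; last first.
  rewrite -hc_glue_rel; apply: mem_tangent ordge_glue_rel; exact: toric_glue_rel.
case: Tq => s [sP ->]; rewrite (raddf_sum (@emb K m)) /=; apply: ideal_sum_seq => // z /sP[g [Ig _ ->]].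
rewrite rmorphM /=; case: (iT) => _ _; apply; rewrite init_formE -hc_emb.
apply: mem_tangent; first exact: toric_ker_emb.
exact/ordge_emb/lowdeg_ordge.
Qed.
End Glue.

(** * Koszul quotients of polynomial rings *)

Section Quotient.
Variables (K : fieldType) (n : nat) (J : {mpoly K[n]} -> Prop).
Local Notation A := {mpoly K[n]}.
Hypotheses (iJ : is_ideal J) (J1 : ~ J 1).

(** A boolean version of [J], obtained by excluded middle, as the quotient construction demands. *)
Definition ideal_pred : {pred A} := fun p => if excluded_middle_informative (J p) then true else false.

Lemma ideal_predP p : reflect (J p) (p \in ideal_pred).
Proof. by rewrite unfold_in /ideal_pred; case: excluded_middle_informative => h; constructor. Qed.

Lemma ideal_pred_closed : idealr_closed ideal_pred.
Proof.
have [J0 JD JM] := iJ; split; [exact/ideal_predP | exact/ideal_predP |].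
by move=> a p q /ideal_predP Jp /ideal_predP Jq; apply/ideal_predP; apply: JD => //; apply: JM.
Qed.

HB.instance Definition _ := isIdealr.Build A ideal_pred ideal_pred_closed.

Lemma quotient_exists : exists (R : comNzRingType) (pi : {rmorphism A -> R}),
  (forall r, exists p, pi p = r) /\ forall p, pi p = 0 <-> J p.
Proof.
exists {ideal_quot ideal_pred}, \pi_({ideal_quot ideal_pred})%qT; split.
  by move=> r; exists (repr r); apply: reprK.
move=> p; have E : (\pi_({ideal_quot ideal_pred})%qT p == 0) = (p \in ideal_pred).
  by rewrite -[0](rmorph0 \pi_({ideal_quot ideal_pred})%qT) -Quotient.idealrBE subr0.
by split=> [/eqP|/ideal_predP]; [rewrite E => /ideal_predP | rewrite -E => /eqP].
Qed.
End Quotient.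

Section QuotientAlg.
Variables (K : fieldType) (n : nat) (J : {mpoly K[n]} -> Prop).
Local Notation A := {mpoly K[n]}.
Local Notation hc := (pihomog mdeg).
Hypothesis J2 : forall p, J p -> ordge 2 p.
Variables (R : comNzRingType) (pi : {rmorphism A -> R}).
Hypotheses (pi_surj : forall r, exists p, pi p = r) (pi_ker : forall p, pi p = 0 <-> J p).

Definition lift_quot r : A := proj1_sig (constructive_indefinite_description _ (pi_surj r)).

Lemma lift_quotK r : pi (lift_quot r) = r.
Proof. exact: (proj2_sig (constructive_indefinite_description _ (pi_surj r))). Qed.

(** Constant and linear parts do not see a difference of order two, so they descend to the quotient
    through any choice of representatives. *)
Lemma lift_quot_ker p : ordge 2 (lift_quot (pi p) - p).
Proof. by apply/J2/pi_ker; rewrite rmorphB lift_quotK subrr. Qed.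

Definition quot_scal (k : K) : R := pi k%:MP.
HB.instance Definition _ := GRing.RMorphism.copy quot_scal (pi \o @mpolyC n K).

Definition quot_aug (r : R) : K := (lift_quot r)@_0%MM.

Lemma quot_augE p : quot_aug (pi p) = p@_0%MM.
Proof.
by apply/eqP; rewrite -subr_eq0 /quot_aug -mcoeffB lift_quot_ker ?mdeg0.
Qed.

Lemma quot_aug_zmod : zmod_morphism quot_aug.
Proof.
move=> r s; rewrite -[r]lift_quotK -[s]lift_quotK -rmorphB !quot_augE.
by rewrite mcoeffB.
Qed.
HB.instance Definition _ := GRing.isZmodMorphism.Build R K quot_aug quot_aug_zmod.

Lemma quot_aug_monoid : monoid_morphism quot_aug.
Proof.
split=> [|r s]; first by rewrite -(rmorph1 pi) quot_augE mcoeff1 eqxx.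
by rewrite -[r]lift_quotK -[s]lift_quotK -rmorphM !quot_augE rmorphM.
Qed.
HB.instance Definition _ := GRing.isMonoidMorphism.Build R K quot_aug quot_aug_monoid.

Definition quot_linpart (r : R) : R := pi (hc 1 (lift_quot r)).

Lemma quot_linpartE p : quot_linpart (pi p) = pi (hc 1 p).
Proof.
apply/eqP; rewrite -subr_eq0 -rmorphB -raddfB /=.
by rewrite (ordge_hc0 (@lift_quot_ker p)) // rmorph0.
Qed.

Lemma quot_linpart_zmod : zmod_morphism quot_linpart.
Proof.
move=> r s; rewrite -[r]lift_quotK -[s]lift_quotK -rmorphB !quot_linpartE.
by rewrite raddfB rmorphB.
Qed.
HB.instance Definition _ := GRing.isZmodMorphism.Build R R quot_linpart quot_linpart_zmod.

Fact quot_augK k : quot_aug (quot_scal k) = k.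
Proof. by rewrite quot_augE mcoeffC eqxx mulr1. Qed.

Fact quot_aug_var i : quot_aug (pi 'X_i) = 0.
Proof. by rewrite quot_augE mcoeffX mnm1_eq0. Qed.

Lemma mcoeff0_var_sum (p : A) : p@_0%MM = 0 -> exists v : 'I_n -> A, p = \sum_i 'X_i * v i.
Proof.
move=> p0; have : forall u, u \in msupp p -> u != 0%MM.
  by move=> u; apply: contraTneq => ->; rewrite mcoeff_msupp p0 eqxx.
move=> H; rewrite [p]mpolyE big_seq; elim/big_ind: _ => [|q r [v ->] [w ->]|u /H u0].
- by exists (fun=> 0); rewrite big1 // => i _; rewrite mulr0.
- exists (fun i => v i + w i); rewrite -big_split; apply: eq_bigr => i _.
  by rewrite mulrDr.
have [i ui] := mnm_neq0_ex u0.
exists (fun j => if j == i then p@_u *: 'X_[u - U_(i)] else 0).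
rewrite (bigD1 i) //= eqxx big1 ?addr0 => [|j /negbTE->]; last by rewrite mulr0.
by rewrite -scalerAr -mpolyXD addmC submK // lep1mP.
Qed.

Fact quot_aug_ker u : quot_aug u = 0 -> exists v, u = \sum_i pi 'X_i * v i.
Proof.
rewrite -[u]lift_quotK quot_augE => /mcoeff0_var_sum[v ->].
by exists (fun i => pi (v i)); rewrite rmorph_sum; apply: eq_bigr => i _; rewrite rmorphM.
Qed.

Lemma linear_form_coeff (c : 'I_n -> K) i : (\sum_j (c j)%:MP * 'X_j : A)@_U_(i) = c i.
Proof.
rewrite (raddf_sum (mcoeff _)) (bigD1 i) //= mcoeffCM mcoeffX eqxx mulr1 big1 ?addr0 // => j ne.
by rewrite mcoeffCM mcoeffX eq_mnm1 (negbTE ne) mulr0.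
Qed.

Fact quot_var_free (c : 'I_n -> K) : \sum_i quot_scal (c i) * pi 'X_i = 0 -> forall i, c i = 0.
Proof.
move=> E i; rewrite -(linear_form_coeff c i).
have /pi_ker/J2 : pi (\sum_j (c j)%:MP * 'X_j) = 0.
  by rewrite -[RHS]E rmorph_sum; apply: eq_bigr => j _; rewrite rmorphM.
by apply; rewrite mdeg1.
Qed.

Fact quot_linpart_var i w : quot_linpart (pi 'X_i * w) = pi 'X_i * quot_scal (quot_aug w).
Proof.
rewrite -[w]lift_quotK -rmorphM quot_linpartE quot_augE -rmorphM; congr (pi _).
have hX : homog_of_deg 1 ('X_i : A) by rewrite -(mdeg1 i); apply: homogX.
rewrite mulrC (hc_homogM 0 _ hX) mulrC; congr (_ * _).
apply/mpolyP => u; rewrite mcoeff_hc mcoeffC mdeg_eq0.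
by case: eqP => [->|_]; rewrite ?mulr1 ?mulr0.
Qed.

Definition quot_alg : graded_alg K R n :=
  GradedAlg quot_augK quot_aug_var quot_aug_ker quot_var_free quot_linpart_var.
End QuotientAlg.

Section Bridge.
Variables (K : fieldType) (n : nat) (J : {mpoly K[n]} -> Prop).
Local Notation A := {mpoly K[n]}.
Variables (R : comNzRingType) (G : graded_alg K R n) (pi : {rmorphism A -> R}).
Hypotheses (pi_surj : forall r, exists p, pi p = r) (pi_ker : forall p, pi p = 0 <-> J p).
Hypotheses (piC : forall k, pi k%:MP = scal G k) (piX : forall i, pi 'X_i = var G i).

Lemma aug_pi p : aug G (pi p) = p@_0%MM.
Proof.
apply: (mpoly_rmorph_ext (f := aug G \o pi) (g := mcoeff 0%MM)) => [k|i] /=.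
  by rewrite piC augK mcoeffC eqxx mulr1.
by rewrite piX aug_var mcoeffX mnm1_eq0.
Qed.

Lemma linear_formE (p : A) : homog_of_deg 1 p -> p = \sum_i (p@_U_(i))%:MP * 'X_i.
Proof.
move=> hp; apply/mpolyP => u; have [/mdeg1P[i /eqP ->]|ne] := boolP (mdeg u == 1%N).
  by rewrite (linear_form_coeff (fun i => p@_U_(i))).
transitivity (0 : K).
  by apply/eqP; rewrite mcoeff_eq0; apply: contra ne => /hp ->.
apply/esym/eqP; rewrite mcoeff_eq0; apply: contra ne.
have h : homog_of_deg 1 (\sum_i (p@_U_(i))%:MP * 'X_i).
  by apply: homog_sum => i _; rewrite mul_mpolyC; apply: homogZ; rewrite -(mdeg1 i); apply: homogX.
by move=> /h ->.
Qed.

Lemma lin_pi p : homog_of_deg 1 p -> lin G (pi p).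
Proof.
move=> /linear_formE ->; exists (fun i => p@_U_(i)); rewrite rmorph_sum.
by apply: eq_bigr => i _; rewrite rmorphM /= piC piX.
Qed.

Lemma lin_lift r : lin G r -> exists p, homog_of_deg 1 p /\ pi p = r.
Proof.
move=> [c ->]; exists (\sum_i (c i)%:MP * 'X_i); split.
  by apply: homog_sum => i _; rewrite mul_mpolyC; apply: homogZ; rewrite -(mdeg1 i); apply: homogX.
by rewrite rmorph_sum; apply: eq_bigr => i _; rewrite rmorphM /= piC piX.
Qed.

Lemma map_pi0 p q (M : 'M[A]_(p, q)) : map_mx pi M = 0 <-> forall i j, J (M i j).
Proof.
split=> [/matrixP E i j|H]; first by apply/pi_ker; have := E i j; rewrite !mxE.
by apply/matrixP => i j; rewrite !mxE; apply/pi_ker.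
Qed.

Lemma map_pi_eq p (u v : 'cV[A]_p) : map_mx pi u = map_mx pi v <-> forall j, J ((u - v) j 0).
Proof.
split=> [E j|H].
  by have /map_pi0 : map_mx pi (u - v) = 0 by rewrite map_mxB E subrr.
apply/eqP; rewrite -subr_eq0 -map_mxB; apply/eqP/map_pi0 => i j.
by rewrite ord1; apply: H.
Qed.

Lemma map_pi_surj p q (P : A -> Prop) (M : 'M[R]_(p, q)) :
  (forall i j, exists a, P a /\ pi a = M i j) ->
  exists N : 'M[A]_(p, q), (forall i j, P (N i j)) /\ map_mx pi N = M.
Proof.
move=> H; pose N : 'M[A]_(p, q) := \matrix_(i < p, j < q) proj1_sig (constructive_indefinite_description _ (H i j)).
have NP i j := proj2_sig (constructive_indefinite_description _ (H i j)).
exists N; split=> [i j|]; first by rewrite mxE; case: (NP i j).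
by apply/matrixP => i j; rewrite !mxE; case: (NP i j).
Qed.

Lemma map_pi_lift p q (M : 'M[R]_(p, q)) : exists N, map_mx pi N = M.
Proof.
have [|N [_ E]] := @map_pi_surj _ _ (fun=> True) M; last by exists N.
by move=> i j; have [a aE] := pi_surj (M i j); exists a.
Qed.

Lemma aug_pi0 p (u : 'cV[A]_p) : map_mx (aug G) (map_mx pi u) = 0 <->
  forall j, exists q, J q /\ (u j 0 - q)@_0%MM = 0.
Proof.
split=> [/matrixP E j|H].
  exists 0; rewrite subr0; split; first by apply/pi_ker; rewrite rmorph0.
  by have := E j 0; rewrite !mxE aug_pi.
apply/matrixP => j k; rewrite !mxE !ord1; have [q [Jq E]] := H j.
by rewrite -(subrK q (u j 0)) rmorphD /= (pi_ker q).2 // addr0 aug_pi.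
Qed.

(** Congruences modulo [J] are equalities in the quotient. Conversely, linear entries are lifted by
    [lin_lift] to true linear forms, so the degree condition holds on the polynomials themselves. *)
Lemma koszul_quotP : koszul_quot J <-> koszul_alg G.
Proof.
split=> [[b [d [b0 ld cd ex0 ex]]]|[b [d [b0 [ld cd] ex0 ex]]]].
  exists b, (fun i => map_mx pi (d i)); split=> //.
  - split=> [i j k|i]; first by rewrite mxE; apply: lin_pi.
    by rewrite -map_mxM; apply/map_pi0.
  - move=> u; have [u' <-] := map_pi_lift u; rewrite (aug_pi0 u') -ex0.
    split=> [[v E]|[v E]].
      by have [v' vE] := map_pi_lift v; exists v'; apply/map_pi_eq; rewrite E map_mxM vE.
    by exists (map_mx pi v); rewrite -map_mxM; apply/map_pi_eq.
  move=> i v; have [v' <-] := map_pi_lift v; rewrite -map_mxM => /map_pi0 E.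
  have [w wE] := ex i v' (fun j => E j 0).
  by exists (map_mx pi w); rewrite -map_mxM; apply/map_pi_eq.
have H i := map_pi_surj (fun j k => lin_lift (ld i j k)).
pose d' i := proj1_sig (constructive_indefinite_description _ (H i)).
have d'P i : (forall j k, homog_of_deg 1 (d' i j k)) /\ map_mx pi (d' i) = d i.
  exact: (proj2_sig (constructive_indefinite_description _ (H i))).
exists b, d'; split=> //.
- by move=> i; case: (d'P i).
- by move=> i; apply/map_pi0; rewrite map_mxM !(d'P _).2.
- move=> u; rewrite -aug_pi0 -ex0; split=> [[v /map_pi_eq E]|[v E]].
    by exists (map_mx pi v); rewrite E map_mxM (d'P _).2.
  have [v' vE] := map_pi_lift v; exists v'; apply/map_pi_eq.
  by rewrite E map_mxM (d'P _).2 vE.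
move=> i v E; have [|w wE] := ex i (map_mx pi v).
  by rewrite -(d'P _).2 -map_mxM; apply/map_pi0 => j k; rewrite ord1; apply: E.
have [w' w'E] := map_pi_lift w; exists w'; apply/map_pi_eq.
by rewrite wE map_mxM (d'P _).2 w'E.
Qed.
End Bridge.

(** * Gluing with a homogeneous relation *)

Definition quad_map (K : fieldType) m (R : comNzRingType) (pi : {rmorphism {mpoly K[m]} -> R})
    (mu : R) : {rmorphism {mpoly K[m.+1]} -> quadext mu} :=
  @mmap m.+1 K (quadext mu) (@qemb R mu \o (pi \o @mpolyC m K))
    (fun i => if unlift ord_max i is Some j then qemb mu (pi 'X_j) else qy mu).
Section QuadMap.
Variables (K : fieldType) (m : nat) (R : comNzRingType) (pi : {rmorphism {mpoly K[m]} -> R}).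
Variables (M : {mpoly K[m]}) (mu : R).
Hypothesis muE : pi M = mu.
Local Notation A := {mpoly K[m]}.
Local Notation S := {mpoly K[m.+1]}.
Local Notation y := ('X_ord_max : S).
Local Notation piH := (quad_map pi mu).

Lemma quad_mapC k : piH k%:MP = qemb mu (pi k%:MP).
Proof. exact: mmapC. Qed.

Lemma quad_mapX i : piH 'X_i = if unlift ord_max i is Some j then qemb mu (pi 'X_j) else qy mu.
Proof. by rewrite [LHS]mmapX mmap1U. Qed.

Lemma quad_mapy : piH y = qy mu.
Proof. by rewrite quad_mapX unlift_none. Qed.

Lemma quad_map_emb p : piH (emb p) = qemb mu (pi p).
Proof.
apply: (mpoly_rmorph_ext (f := piH \o @emb K m) (g := @qemb R mu \o pi)) => /= [k|i].
  by rewrite emb_C quad_mapC.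
by rewrite emb_var quad_mapX -lift_max_widen liftK.
Qed.

Lemma quad_map_rel : piH (y ^+ 2 - emb M) = 0.
Proof. by rewrite rmorphB rmorphXn /= quad_mapy quad_map_emb expr2 qyy muE subrr. Qed.

Lemma quad_map_split p0 p1 : piH (emb p0 + y * emb p1) = 0 -> pi p0 = 0 /\ pi p1 = 0.
Proof.
rewrite rmorphD rmorphM /= quad_mapy !quad_map_emb => E.
have := congr1 (@co0 R mu) E; have := congr1 (@co1 R mu) E.
by rewrite /co0 /co1 /= !(mul0r, mulr0, mul1r, addr0, add0r) => -> ->.
Qed.

Variable J : A -> Prop.
Hypotheses (iJ : is_ideal J) (pi_ker : forall p, pi p = 0 <-> J p) (oM : ordge 2 M).

Lemma emb_division2 d g : ordge d g -> exists r0 r1 h,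
  [/\ g = emb r0 + y * emb r1 + h * (y ^+ 2 - emb M), ordge d r0, ordge (d - 1) r1 & ordge (d - 2) h].
Proof.
move=> /(emb_division (c := 2) (isT : (0 < 2)%N) oM)[r [h [-> or oh]]].
exists (r ord0), (r ord_max), h; split=> //; last exact: (or ord_max).
  by rewrite big_ord_recl big_ord1 expr0 mul1r expr1; congr (_ + y * emb (r _) + _); apply: val_inj.
by have := or ord0; rewrite subn0.
Qed.

Lemma quad_map_ker p : piH p = 0 <-> glue_ideal 2 J M p.
Proof.
split=> [E|]; last first.
  move=> [s [sP ->]]; rewrite rmorph_sum big1_seq // => z /= /sP[[q [Jq ->]]|->]; rewrite rmorphM /=.
    by rewrite quad_map_emb (pi_ker q).2 // raddf0 mulr0.
  by rewrite quad_map_rel mulr0.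
have [r0 [r1 [h [pE _ _ _]]]] := @emb_division2 0 p (fun u ud => ltac:(by [])).
have [|E0 E1] := @quad_map_split r0 r1.
  by move: E; rewrite pE rmorphD [piH (h * _)]rmorphM /= quad_map_rel mulr0 addr0.
have [G0 GD GM] := ideal_gen_ideal (fun q : S => (exists p, J p /\ q = emb p) \/ q = y ^+ 2 - emb M).
rewrite pE; apply: (GD); last by apply: (GM); apply: mem_ideal_gen; right.
apply: GD; last apply: GM; apply: mem_ideal_gen; left.
  by exists r0; split=> //; apply/pi_ker.
by exists r1; split=> //; apply/pi_ker.
Qed.

Lemma glue_ideal_split p0 p1 : glue_ideal 2 J M (emb p0 + y * emb p1) -> J p0 /\ J p1.
Proof. by move=> /quad_map_ker/quad_map_split[/pi_ker h0 /pi_ker h1]. Qed.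

Lemma quad_map_surj : (forall r, exists p, pi p = r) -> forall u, exists p, piH p = u.
Proof.
move=> ps u; have [p0 E0] := ps (co0 u); have [p1 E1] := ps (co1 u).
exists (emb p0 + y * emb p1); rewrite rmorphD rmorphM /= quad_mapy !quad_map_emb E0 E1.
by rewrite -quadextE.
Qed.

(** Divide by y^2 - M and keep degree two: the y-coefficient of the remainder lies in [J], so it has
    no linear part to contribute, and the quotient contributes its constant term only. *)
Lemma quadric_glue_ideal q : (forall p, J p -> ordge 2 p) -> (forall d p, J p -> J (pihomog mdeg d p)) ->
  homog_of_deg 2 q -> glue_ideal 2 J M q -> homog_of_deg 2 M ->
  exists s t, [/\ J s, homog_of_deg 2 s & q = emb s + t *: (y ^+ 2 - emb M)].
Proof.
move=> oJ hJ hq Jq hM; have [r0 [r1 [h [qE o0 o1 oh]]]] := emb_division2 (homog_ordge hq).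
have [J0 J1] : J r0 /\ J r1.
  apply: glue_ideal_split; have -> : emb r0 + y * emb r1 = q - h * (y ^+ 2 - emb M) by rewrite qE addrK.
  apply: idealB Jq _; first exact: ideal_gen_ideal.
  have [_ _ GM] := ideal_gen_ideal (fun q : S => (exists p, J p /\ q = emb p) \/ q = y ^+ 2 - emb M).
  by apply: GM; apply: mem_ideal_gen; right.
have hf : homog_of_deg 2 (y ^+ 2 - emb M).
  by apply: homogB; [apply: homog_yc | apply: homog_emb].
exists (pihomog mdeg 2 r0), (h@_0%MM); split; [exact: hJ | exact: hc_homog |].
clear J0 Jq; move: (y ^+ 2 - emb M) hf qE => F hf qE.
rewrite -{1}(homog_hc 2 q).1 // qE !raddfD /= hc_emb (hc_homogM 0 h hf).
have -> : pihomog mdeg 2 (y * emb r1) = 0.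
  have := hc_yemb 1 1 r1; rewrite expr1 => ->.
  by rewrite (ordge_hc0 (oJ _ J1)) // raddf0 mulr0.
rewrite addr0 -mul_mpolyC; congr (_ + _ * _); apply/mpolyP => u.
rewrite mcoeff_hc mcoeffC mdeg_eq0.
by case: eqP => [->|_]; rewrite ?mulr1 ?mulr0.
Qed.
End QuadMap.

(** * Setting all variables but y to zero: the exclusion of c > 2 *)

Definition ymap (K : fieldType) m : {mpoly K[m.+1]} -> {poly K} :=
  mmap (@polyC K) (fun i => if i == ord_max then 'X else 0).
HB.instance Definition _ (K : fieldType) m :=
  GRing.RMorphism.copy (@ymap K m) (mmap (@polyC K) (fun i => if i == ord_max then 'X else 0)).

Section YMap.
Variables (K : fieldType) (m : nat).
Local Notation A := {mpoly K[m]}.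
Local Notation S := {mpoly K[m.+1]}.
Local Notation y := ('X_ord_max : S).
Local Notation chi := (@ymap K m).

Lemma ymap_y : chi y = 'X.
Proof. by rewrite [LHS]mmapX mmap1U eqxx. Qed.

Lemma ymap_emb p : chi (emb p) = (p@_0%MM)%:P.
Proof.
apply: (mpoly_rmorph_ext (f := chi \o @emb K m) (g := @polyC K \o mcoeff 0%MM)) => /= [k|i].
  by rewrite emb_C [LHS]mmapC mcoeffC eqxx mulr1.
by rewrite emb_var [LHS]mmapX mmap1U (negbTE (widen_neq_max i)) mcoeffX mnm1_eq0.
Qed.

Lemma ymap_homog d p : homog_of_deg d p -> exists k, chi p = k%:P * 'X^d.
Proof.
move=> hp; rewrite (mpoly_yemb p) big_seq; elim/big_ind: _ => [|q r [k kE] [k' kE']|w wp].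
- by exists 0; rewrite raddf0 mul0r.
- by exists (k + k'); rewrite raddfD /= kE kE' polyCD mulrDl.
rewrite rmorphM rmorphXn /= ymap_y ymap_emb mcoeffZ mcoeffX.
have [e|_] := eqVneq (low w) 0%MM; last by exists 0; rewrite mulr0 mulr0 mul0r.
have -> : w ord_max = d by rewrite -(hp _ wp) -mdeg_low e mdeg0.
by exists (p@_w * 1); rewrite mulrC.
Qed.

Variables (J : A -> Prop) (M : A) (c : nat).
Hypotheses (oJ : forall p, J p -> ordge 1 p) (oM : ordge 1 M).

Lemma ymap_rel : chi (y ^+ c - emb M) = 'X^c.
Proof. by rewrite rmorphB rmorphXn /= ymap_y ymap_emb oM ?mdeg0 // subr0. Qed.

Lemma ymap_glue_ideal p : glue_ideal c J M p -> exists z, chi p = z * 'X^c.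
Proof.
move=> [s [sP ->]]; rewrite rmorph_sum big_seq.
elim/big_ind: _ => [|q r [k ->] [k' ->]|z /sP[[q [Jq ->]]|->]]; rewrite ?rmorphM /=.
- by exists 0; rewrite mul0r.
- by exists (k + k'); rewrite mulrDl.
- by exists 0; rewrite ymap_emb (oJ Jq) ?mdeg0 // mulr0 mul0r.
by exists (chi z.1); rewrite ymap_rel.
Qed.

Lemma ymap_low d p : (d < c)%N -> homog_of_deg d p -> glue_ideal c J M p -> chi p = 0.
Proof.
move=> dc /ymap_homog[k kE] /ymap_glue_ideal[z zE].
have := congr1 (fun q : {poly K} => q`_d) (etrans (esym kE) zE).
by rewrite [RHS]coefMXn dc coefCM coefXn eqxx mulr1 kE => ->; rewrite mul0r.
Qed.
End YMap.

Section MainBC.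
Variables (K : fieldType) (m c : nat) (J : {mpoly K[m]} -> Prop) (M : {mpoly K[m]}).
Local Notation A := {mpoly K[m]}.
Local Notation S := {mpoly K[m.+1]}.
Local Notation y := ('X_ord_max : S).
Hypotheses (c1 : (1 < c)%N) (hJ : homog_ideal J) (oJ : forall p, J p -> ordge 2 p).
Hypothesis MP : M = 0 \/ exists2 w, mdeg w = c & M = 'X_[w].
Local Notation JH := (glue_ideal c J M).

Let iJ : is_ideal J. Proof. by case: hJ. Qed.

Lemma ideal_proper (I : A -> Prop) : (forall p, I p -> ordge 2 p) -> ~ I 1.
Proof.
move=> oI /oI/(_ 0%MM); rewrite mdeg0 mcoeff1 eqxx => /(_ isT)/eqP.
by rewrite oner_eq0.
Qed.

Lemma glue_mono_homog : homog_of_deg c M.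
Proof. by case: MP => [->|[w <- ->]]; [apply: homog0 | apply: homogX]. Qed.

Lemma glue_ordge2 : ordge 2 M.
Proof. by apply: ordgeW (homog_ordge glue_mono_homog). Qed.

Let oJ1 p : J p -> ordge 1 p. Proof. by move=> /oJ; apply: ordgeW. Qed.
Let oM1 : ordge 1 M. Proof. by apply: ordgeW glue_ordge2. Qed.

Lemma glue_rel_mem : JH (y ^+ c - emb M).
Proof. by apply: mem_ideal_gen; right. Qed.

(** For c > 2 the quadrics of the ideal have image 0 under [ymap], whereas y^c - M has image X^c. *)
Lemma quadratic_glue_c : quadratic_ideal JH -> c = 2%N.
Proof.
move=> [Q [hQ QE]]; apply/eqP; rewrite eqn_leq c1 andbT leqNgt; apply/negP => c3.
have [s [sP E]] := (QE _).1 glue_rel_mem.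
have : ymap (y ^+ c - emb M) = 0.
  rewrite E rmorph_sum big1_seq // => z /= /sP Qz; rewrite rmorphM /=.
  rewrite [ymap z.2](ymap_low oJ1 oM1 c3 (hQ _ Qz)) ?mulr0 //.
  by apply/QE; apply: mem_ideal_gen.
by rewrite ymap_rel // => /eqP; rewrite expf_eq0 polyX_eq0 andbF.
Qed.

(** The relation y^c - M produces a cycle [g] of degree c - 1 in the variables. For c > 2 the
    products of [d 0] and [d 1] are quadrics of the ideal, so they vanish under [ymap] exactly and
    not just modulo X^c. If [g] were a boundary modulo the ideal, the image of [d 0 g] would have no
    term X^c; but that term has coefficient 1. *)
Lemma koszul_glue_c : koszul_quot JH -> c = 2%N.
Proof.
move=> [b [d [b0 ld cd ex0 ex]]]; apply/eqP; rewrite eqn_leq c1 andbT leqNgt; apply/negP => c3.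
have [G0 GD GM] := ideal_gen_ideal (fun q : S => (exists p, J p /\ q = emb p) \/ q = y ^+ c - emb M).
have chiJ p q (V : 'M[S]_(p, q)) : (forall i j, JH (V i j)) ->
    exists Z : 'M[{poly K}]_(p, q), map_mx (@ymap K m) V = 'X^c *: Z.
  move=> H; have /fin_all_exists2[z _ zE] (i : 'I_p) : exists2 z : 'I_q -> {poly K}, True & forall j, ymap (V i j) = z j * 'X^c.
    by have /fin_all_exists[z zE] := fun j => ymap_glue_ideal oJ1 oM1 (H i j); exists z.
  by exists (\matrix_(i, j) z i j); apply/matrixP => i j; rewrite !mxE zE mulrC.
have gen i : exists v : 'cV_(b 1%N), forall j, JH ((const_mx 'X_i - d 0%N *m v) j 0).
  apply/ex0 => j; exists 0; split; first exact: G0.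
  by rewrite subr0 mxE mcoeffX mnm1_eq0.
have [v vE] := gen ord_max.
(* y^c - M lifts through [d 0] to y^(c-1) v - v', where v lifts y and v' lifts M. *)
have [v' v'E v'0] : exists2 v' : 'cV_(b 1%N), forall j, JH ((const_mx (emb M) - d 0%N *m v') j 0)
    & map_mx (@ymap K m) v' = 0.
  case: MP => [M0|[w wc Mw]].
    have eM : emb M = 0 by rewrite M0 raddf0.
    by exists 0 => [j|]; [rewrite mulmx0 !mxE eM subr0; exact: G0 | rewrite map_mx0].
  have [i wi] : exists i, w i != 0%N by apply: mnm_neq0_ex; rewrite -mdeg_eq0 wc -lt0n ltnW.
  have [v' v'E] := gen (widen_ord (leqnSn m) i).
  have wE : w = (w - U_(i) + U_(i))%MM by rewrite submK // lep1mP.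
  exists (emb 'X_[w - U_(i)] *: v') => [j|].
    have eM : emb M = emb 'X_[w - U_(i)] * xvar K i by rewrite Mw {1}wE mpolyXD rmorphM /= emb_var.
    have -> : (const_mx (emb M) - d 0%N *m (emb 'X_[w - U_(i)] *: v')) j 0 =
        emb 'X_[w - U_(i)] * (const_mx (xvar K i) - d 0%N *m v') j 0.
      by rewrite -scalemxAr !mxE eM mulrBr.
    by apply: GM; apply: v'E.
  apply/matrixP => j k; rewrite !mxE rmorphM /= ymap_emb mcoeffX.
  have -> : ((w - U_(i))%MM == 0%MM) = false; last by rewrite mul0r.
  apply: contraTF c3 => /eqP e; move: wc; rewrite {1}wE e add0m mdeg1 => <-.
  by [].
pose g := y ^+ c.-1 *: v - v'.
have [w wE] : exists w : 'cV_(b 2%N), forall j, JH ((g - d 1%N *m w) j 0).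
  apply: ex => j.
  have -> : (d 0%N *m g) j 0 = (y ^+ c - emb M) - y ^+ c.-1 * (const_mx y - d 0%N *m v) j 0
      + (const_mx (emb M) - d 0%N *m v') j 0.
    rewrite mulmxBr -scalemxAr !mxE mulrBr -exprSr prednK ?(ltnW c1) //; ring.
  apply: GD; last exact: v'E.
  by apply: (@idealB _ _ JH); [exact: ideal_gen_ideal | exact: glue_rel_mem | apply: GM; apply: vE].
have [Z1 Z1E] := @chiJ _ 1%N (const_mx y - d 0%N *m v) (fun i j => eq_ind_r (fun j => JH (_ i j)) (vE i) (ord1 j)).
have [Z2 Z2E] := @chiJ _ 1%N (g - d 1%N *m w) (fun i j => eq_ind_r (fun j => JH (_ i j)) (wE i) (ord1 j)).
have dd : map_mx (@ymap K m) (d 0%N) *m map_mx (@ymap K m) (d 1%N) = 0.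
  rewrite -map_mxM; apply/matrixP => i j; rewrite mxE [RHS]mxE.
  apply: (ymap_low oJ1 oM1 c3) (cd _ _ _); rewrite mxE; apply: homog_sum => k _.
  by apply: (homogM (d := 1) (e := 1)); apply: ld.
(* The factor X coming from linearity pushes the error term of [g], already divisible by X^c, beyond
   degree c. *)
have [D0 D0E] : exists D0 : 'M[{poly K}]_(b 0%N, b 1%N), map_mx (@ymap K m) (d 0%N) = 'X *: D0.
  have H i : exists z : 'I_(b 1%N) -> {poly K}, forall j, ymap (d 0%N i j) = z j * 'X.
    have /fin_all_exists[z zE] := fun j => ymap_homog (ld 0%N i j).
    by exists (fun j => (z j)%:P) => j; rewrite zE expr1.
  have /fin_all_exists[z zE] := H.
  by exists (\matrix_(i, j) z i j); apply/matrixP => i j; rewrite !mxE zE mulrC.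
have i0 : 'I_(b 0%N) by rewrite b0; exact: ord0.
have Ev : ('X *: D0) *m map_mx (@ymap K m) v = const_mx ('X : {poly K}) - 'X^c *: Z1.
  by rewrite -Z1E map_mxB map_mxM D0E map_const_mx /= ymap_y opprB addrC subrK.
have Eg : 'X^(c.-1) *: map_mx (@ymap K m) v = map_mx (@ymap K m) g.
  rewrite map_mxB v'0 subr0; apply/matrixP => i j; rewrite !mxE /= rmorphM rmorphXn /= ymap_y.
  by [].
clearbody g.
have : 'X^(c.-1) *: ('X *: D0 *m map_mx (@ymap K m) v) = 'X^c *: ('X *: D0 *m Z2).
  rewrite scalemxAr Eg scalemxAr -Z2E map_mxB map_mxM mulmxBr -D0E mulmxA dd mul0mx subr0.
  by [].
rewrite Ev => /matrixP/(_ i0 0); rewrite -scalemxAl !mxE mulrBr -exprSr prednK ?(ltnW c1) //.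
move=> /(congr1 (fun p : {poly K} => p`_c)); rewrite coefB coefXn eqxx.
rewrite !coefXnM (_ : (c < c.-1)%N = false); last by lia.
rewrite (_ : (c - c.-1 < c)%N); last by lia.
rewrite ltnn subnn coefXM eqxx subr0 => /eqP.
by rewrite oner_eq0.
Qed.
End MainBC.

(** * The case c = 2: quadratic and Koszul ideals *)

Section QuadricGlue.
Variables (K : fieldType) (m : nat) (J : {mpoly K[m]} -> Prop) (M : {mpoly K[m]}).
Local Notation A := {mpoly K[m]}.
Local Notation S := {mpoly K[m.+1]}.
Local Notation y := ('X_ord_max : S).
Hypotheses (hJ : homog_ideal J) (oJ : forall p, J p -> ordge 2 p).
Hypothesis MP : M = 0 \/ exists2 w, mdeg w = 2%N & M = 'X_[w].
Local Notation JH := (glue_ideal 2 J M).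

Let iJ : is_ideal J. Proof. by case: hJ. Qed.
Let oM : ordge 2 M. Proof. exact: (glue_ordge2 (c := 2)). Qed.
Let hM : homog_of_deg 2 M. Proof. exact: glue_mono_homog. Qed.

Lemma quadratic_glue_ideal : quadratic_ideal J -> quadratic_ideal JH.
Proof.
move=> [Q [hQ QE]].
pose Q' (q : S) := (exists p, Q p /\ q = emb p) \/ q = y ^+ 2 - emb M.
have iQ' := ideal_gen_ideal Q'; have [_ _ QM] := iQ'.
exists Q'; split=> [q [[p [/hQ hp ->]]|->]|p]; first exact: homog_emb.
  by apply: homogB; [apply: homog_yc | apply: homog_emb].
split; (apply: ideal_gen_sub; first exact: ideal_gen_ideal) => {}p.
  move=> [[r [/QE [s [sP ->]] ->]]|->]; last by apply: mem_ideal_gen; right.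
  rewrite (raddf_sum (@emb K m)) /=; apply: ideal_sum_seq => // z /sP Qz.
  by rewrite rmorphM /=; apply: QM; apply: mem_ideal_gen; left; exists z.2.
move=> [[r [Qr ->]]|->]; apply: mem_ideal_gen; last by right.
by left; exists r; split=> //; apply/QE; apply: mem_ideal_gen.
Qed.

(** Take the quotient by the ideal [Q2] of the quadrics of [J] alone and adjoin a square root of
    [M]. The resulting ring kills the quadrics of [JH], hence all of [JH] and every [emb p] with p
    in [J]; as the quotient embeds in it, p lies in the ideal of [Q2]. *)
Lemma quadratic_of_glue_ideal : quadratic_ideal JH -> quadratic_ideal J.
Proof.
move=> [Q [hQ QE]].
pose Q2 q := homog_of_deg 2 q /\ J q.
have iQ2 := ideal_gen_ideal Q2.
have oQ2 p : ideal_gen Q2 p -> ordge 2 p.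
  by apply: ideal_gen_coeff0 => q [_ /oJ].
have Q2J p : ideal_gen Q2 p -> J p by apply: ideal_gen_sub => // q [].
have [R [pi [_ pi_ker]]] := quotient_exists iQ2 (ideal_proper oQ2).
exists Q2; split=> [q []//|p]; split=> [Jp|]; last exact: Q2J.
have [R0 [pi0 [_ pi0_ker]]] := quotient_exists iJ (ideal_proper oJ).
have : JH (emb p) by apply: mem_ideal_gen; left; exists p.
move=> /QE[s [sP E]]; apply/pi_ker.
have : quad_map pi (pi M) (emb p) = 0.
  rewrite E rmorph_sum big1_seq // => z /= /sP Qz; rewrite rmorphM /=.
  have Jz : JH z.2 by apply/QE; apply: mem_ideal_gen.
  have [r [t [Jr hr ->]]] := quadric_glue_ideal (erefl _) pi0_ker oM oJ hJ.2 (hQ _ Qz) Jz hM.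
  rewrite -mul_mpolyC rmorphD [quad_map _ _ (_ * (_ - _))]rmorphM /= quad_map_rel // mulr0 addr0.
  rewrite quad_map_emb (pi_ker r).2 ?raddf0 ?mulr0 //.
  by apply: mem_ideal_gen.
by rewrite quad_map_emb => /(congr1 (@co0 R (pi M))).
Qed.

Lemma koszul_glue_ideal : koszul_quot JH <-> koszul_quot J.
Proof.
have [R [pi [pi_surj pi_ker]]] := quotient_exists iJ (ideal_proper oJ).
pose G := quot_alg oJ pi_surj pi_ker.
(* The zero case factors as 0 times 0, a monomial of degree two as a product of two variables. *)
have [p [q [lp lq ME]]] : exists p q, [/\ lin G p, lin G q & pi M = p * q].
  case: MP => [->|[w w2 ->]].
    by exists 0, 0; split; [exact: lin0 | exact: lin0 | rewrite rmorph0 mul0r].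
  have [i wi] : exists i, w i != 0%N by apply: mnm_neq0_ex; rewrite -mdeg_eq0 w2.
  have wE : w = (w - U_(i) + U_(i))%MM by rewrite submK // lep1mP.
  have /mdeg1P[j /eqP jE] : mdeg (w - U_(i))%MM == 1%N.
    by move: w2; rewrite {1}wE mdegD mdeg1 addn1 => -[->].
  exists (pi 'X_j), (pi 'X_i); split; first exact: (lin_var G).
    exact: (lin_var G).
  by rewrite wE jE mpolyXD rmorphM.
have GE := @koszul_quotP _ _ J _ G pi pi_surj pi_ker (fun=> erefl) (fun=> erefl).
rewrite GE -(quadext_koszul lp lq).
apply: (@koszul_quotP _ _ JH _ _ (quad_map pi (p * q))).
- exact: quad_map_surj.
- by move=> r; apply: quad_map_ker.
- exact: quad_mapC.
by move=> i; rewrite quad_mapX.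
Qed.
End QuadricGlue.

(** * Quadratic Groebner bases *)

Section TermOrder.
Variables (K : fieldType) (n : nat) (r : rel 'X_{1..n}).
Hypothesis tor : term_order r.
Local Notation A := {mpoly K[n]}.
Implicit Types (p q : A) (u v w : 'X_{1..n}).

Lemma term_refl u : r u u.
Proof. by case: tor => tot _ _ _ _; have := tot u u; rewrite orbb. Qed.

Lemma term_trans v u w : r u v -> r v w -> r u w.
Proof. by case: tor => _ _ tr _ _; apply: tr. Qed.

Lemma term_anti u v : r u v -> r v u -> u = v.
Proof. by case: tor => _ an _ _ _; apply: an. Qed.

Lemma term_add w u v : r u v -> r (u + w)%MM (v + w)%MM.
Proof. by case: tor => _ _ _ ad _; apply: ad. Qed.

Lemma term_addl w u v : r u v -> r (w + u)%MM (w + v)%MM.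
Proof. by rewrite ![(w + _)%MM]addmC; apply: term_add. Qed.

Lemma term_total u v : r u v \/ r v u.
Proof. by case: tor => tot _ _ _ _; apply/orP. Qed.

Lemma lm_exists p : p != 0 -> exists u, is_lm r p u.
Proof.
rewrite -msupp_eq0 /is_lm; elim: (msupp p) => // a s IH _.
case: s IH => [|b s] IH.
  by exists a; split=> [|v]; rewrite inE // => /eqP ->; apply: term_refl.
have [//|u [us uP]] := IH; have [ua|au] := term_total u a.
  exists a; split=> [|v]; first by rewrite inE eqxx.
  rewrite inE => /orP[/eqP->|/uP vu]; [exact: term_refl | exact: term_trans ua].
exists u; split=> [|v]; first by rewrite inE us orbT.
by rewrite inE => /orP[/eqP->|/uP].
Qed.

Lemma lm_uniq p u v : is_lm r p u -> is_lm r p v -> u = v.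
Proof. by move=> [up uP] [vp vP]; apply: term_anti; [apply: vP | apply: uP]. Qed.

Lemma lm_coeff p u : is_lm r p u -> p@_u != 0.
Proof. by case; rewrite mcoeff_msupp. Qed.

Lemma lmX u : is_lm r ('X_[u] : A) u.
Proof.
by split=> [|v]; rewrite msuppX inE ?eqxx // => /eqP ->; apply: term_refl.
Qed.

Lemma lmM p q u v : is_lm r p u -> is_lm r q v -> is_lm r (p * q) (u + v)%MM.
Proof.
move=> hp hq; have [up uP] := hp; have [vq vP] := hq; split; last first.
  move=> w /msuppM_le/allpairsP[[a b] /= [/uP au /vP bv ->]].
  exact: term_trans (term_add _ au) (term_addl _ bv).
rewrite mcoeff_msupp mcoeffM.
have hu : (mdeg u < (mdeg (u + v)%MM).+1)%N by rewrite mdegD ltnS leq_addr.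
have hv : (mdeg v < (mdeg (u + v)%MM).+1)%N by rewrite mdegD ltnS leq_addl.
rewrite (bigD1 (BMultinom hu, BMultinom hv)) //= big1 ?addr0.
  by rewrite mulf_neq0 // -mcoeff_msupp.
move=> [a b] /= /andP[/eqP e ne]; apply/eqP; rewrite mulf_eq0 !mcoeff_eq0.
rewrite -negb_and; apply: contra ne => /andP[/uP au /vP bv].
have ea : val a = u.
  apply: (@addIm _ (val b)); apply: term_anti; first exact: term_add.
  by rewrite -e; apply: term_addl.
have eb : val b = v by move: e; rewrite ea => /addmI.
by apply/eqP; congr pair; apply: val_inj.
Qed.

Lemma lm_exp p u j : is_lm r p u -> is_lm r (p ^+ j) (u *+ j)%MM.
Proof.
move=> h; elim: j => [|j IH]; first by rewrite expr0 mulm0n -mpolyX0; apply: lmX.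
by rewrite exprS mulmS; apply: lmM.
Qed.

Lemma lm_sub p q u : is_lm r p u -> (forall v, v \in msupp q -> r v u) -> q@_u = 0 ->
  is_lm r (p - q) u.
Proof.
move=> [up uP] hq q0; split=> [|v].
  by rewrite mcoeff_msupp mcoeffB q0 subr0 -mcoeff_msupp.
by move=> /msuppB_le; rewrite mem_cat => /orP[/uP|/hq].
Qed.

Lemma lm_hc d p w : is_lm r p w -> mdeg w = d -> is_lm r (pihomog mdeg d p) w.
Proof.
move=> [wp wP] wd; split=> [|v]; rewrite mcoeff_msupp mcoeff_hc.
  by rewrite wd eqxx -mcoeff_msupp.
by case: ifP; rewrite ?eqxx // -mcoeff_msupp => _ /wP.
Qed.

(** Counting the monomials of degree at most d below [w], which are finite in number, replaces the
    well-foundedness of term orders. *)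
Lemma degree_term_ind d (P : 'X_{1..n} -> Prop) :
  (forall w, mdeg w = d -> (forall v, mdeg v = d -> r v w -> v <> w -> P v) -> P w) ->
  forall w, mdeg w = d -> P w.
Proof.
move=> H; pose N w := #|[pred v : 'X_{1..n < d.+1} | r v w]|.
suff H' k w : (N w < k)%N -> mdeg w = d -> P w by move=> w; apply: (H' (N w).+1).
elim: k w => // k IH w; rewrite ltnS => Nw wd; apply: H => // v vd vw ne.
apply: IH => //; apply: leq_trans Nw; apply: proper_card; apply/properP; split.
  by apply/subsetP => z; rewrite !inE => /term_trans; apply.
have hw : (mdeg w < d.+1)%N by rewrite wd.
exists (BMultinom hw); rewrite !inE /=; first exact: term_refl.
by apply/negP => wv; apply: ne; apply: term_anti.
Qed.

Lemma reduce_lm d p w e g u : homog_of_deg d p -> mdeg w = d ->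
  (forall v, v \in msupp p -> r v w) ->
  homog_of_deg e g -> is_lm r g u -> mdivides u w -> exists c q,
  [/\ q = p - c *: ('X_[w - u] * g), homog_of_deg d q & forall v, v \in msupp q -> r v w /\ v <> w].
Proof.
move=> hp wd wP hg gu /mnm_lepP uw.
have wE : ((w - u) + u)%MM = w by rewrite submK.
have lmg : is_lm r ('X_[w - u] * g) w by rewrite -[X in is_lm r _ X]wE; apply: lmM gu; apply: lmX.
have hm : homog_of_deg d ('X_[w - u] * g).
  rewrite -wd -[in mdeg w]wE mdegD (hg u); last by case: gu.
  by apply: homogM => //; apply: homogX.
exists (p@_w / ('X_[w - u] * g)@_w), (p - (p@_w / ('X_[w - u] * g)@_w) *: ('X_[w - u] * g)).
split=> // [|v vq]; first by apply: homogB => //; apply: homogZ.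
split.
  move: vq => /msuppB_le; rewrite mem_cat => /orP[/wP //|/msuppZ_le].
  by case: lmg => _; apply.
move=> vw; move: vq; rewrite mcoeff_msupp vw mcoeffB mcoeffZ divfK ?subrr ?eqxx //.
exact: lm_coeff lmg.
Qed.

(** Division by [G] on each homogeneous component; reduction by homogeneous elements stays in one
    degree, where [degree_term_ind] applies. *)
Lemma groebner_quadratic (J : A -> Prop) G : homog_ideal J -> groebner_basis r J G ->
  (forall g, g \in G -> homog_of_deg 2 g) -> quadratic_ideal J.
Proof.
move=> [iJ hJ] [GJ GB] G2; pose Q q := q \in G.
have iQ := ideal_gen_ideal Q; have [Q0 QD QM] := iQ.
exists Q; split=> // p; split; last by apply: ideal_gen_sub.
suff H d q : J q -> homog_of_deg d q -> ideal_gen Q q.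
  move=> Jp; rewrite (pihomog_partitionE (leqnn (msize p))); apply: ideal_sum => // d _.
  by apply: (H d); [apply: hJ | apply: hc_homog].
move: q => {}p Jp hp.
have [->//|p0] := eqVneq p 0; have [w wP] := lm_exists p0.
have wd : mdeg w = d by apply: hp; case: wP.
move: w wd p Jp hp p0 wP; apply: degree_term_ind => w wd IH p Jp hp p0 wP.
have [g [u [v [gG gu pv]]]] := GB p Jp p0; rewrite -(lm_uniq wP pv) => uw.
have [c [q [qE hq qP]]] := reduce_lm hp wd wP.2 (G2 _ gG) gu uw.
have -> : p = q + c *: ('X_[w - u] * g) by rewrite qE subrK.
apply: QD; last by apply: idealZ => //; apply: QM; apply: mem_ideal_gen.
have [->//|q0] := eqVneq q 0; have [w' w'P] := lm_exists q0.
have [w'w ne] := qP w' w'P.1.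
apply: (IH w') => //; first by apply: hq; case: w'P.
rewrite qE; apply: idealB => //; apply: idealZ => //.
by case: iJ => _ _; apply; apply: GJ.
Qed.
End TermOrder.

Section GroebnerGlue.
Variables (K : fieldType) (m : nat) (J : {mpoly K[m]} -> Prop) (M : {mpoly K[m]}).
Local Notation A := {mpoly K[m]}.
Local Notation S := {mpoly K[m.+1]}.
Local Notation y := ('X_ord_max : S).
Local Notation wid := (@mnmwiden m).
Local Notation y2 := (U_(ord_max) *+ 2 : 'X_{1..m.+1})%MM.
Hypotheses (hJ : homog_ideal J) (oJ : forall p, J p -> ordge 2 p).
Hypothesis MP : M = 0 \/ exists2 w, mdeg w = 2%N & M = 'X_[w].
Local Notation JH := (glue_ideal 2 J M).

Let iJ : is_ideal J. Proof. by case: hJ. Qed.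
Let oM : ordge 2 M. Proof. exact: (glue_ordge2 (c := 2)). Qed.
Let hM : homog_of_deg 2 M. Proof. exact: glue_mono_homog. Qed.
Let iJH : is_ideal JH. Proof. exact: ideal_gen_ideal. Qed.

Lemma glue_split p0 p1 : JH (emb p0 + y * emb p1) -> J p0 /\ J p1.
Proof.
have [R [pi [_ pi_ker]]] := quotient_exists iJ (ideal_proper oJ).
exact: (glue_ideal_split (erefl _) pi_ker oM).
Qed.

Lemma glue_emb p : J p -> JH (emb p).
Proof. by move=> Jp; apply: mem_ideal_gen; left; exists p. Qed.

Lemma supp_emb (p : A) w : w \in msupp (emb p) -> w = wid (low w) /\ low w \in msupp p.
Proof.
rewrite !mcoeff_msupp mcoeff_emb; case: ifP => [/eqP w0|]; last by rewrite eqxx.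
by move=> ->; split=> //; apply: low_max_inj; rewrite ?low_wid // mnmwiden_ordmax.
Qed.

Lemma mem_supp_emb (p : A) u : (wid u \in msupp (emb p)) = (u \in msupp p).
Proof. by rewrite !mcoeff_msupp mcoeff_emb mnmwiden_ordmax eqxx low_wid. Qed.

(** * Extending a quadratic Gröbner basis by an elimination order *)

Section Extend.
Variable r : rel 'X_{1..m}.
Hypothesis tor : term_order r.

Definition elim_order : rel 'X_{1..m.+1} := fun w w' =>
  (w ord_max < w' ord_max)%N || ((w ord_max == w' ord_max) && r (low w) (low w')).

Lemma lowD (w w' : 'X_{1..m.+1}) : low (w + w')%MM = (low w + low w')%MM.
Proof. by apply/mnmP => i; rewrite !mnmE. Qed.

Lemma elim_orderP : term_order elim_order.
Proof.
rewrite /elim_order; split=> [u v|u v|u v w|u v w|u].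
- by case: ltngtP => //= _; apply/orP; apply: term_total.
- case: ltngtP => //= e uv vu; apply: low_max_inj => //.
  exact: (term_anti tor).
- case: (ltngtP (u ord_max) (v ord_max)) => //= [uv _|uv ruv].
    by case: (ltngtP (v ord_max) (w ord_max)) => //= [vw _|vw _]; rewrite ?(ltn_trans uv vw) // -vw uv.
  rewrite uv; case: ltngtP => //= _ rvw; exact: (term_trans tor ruv rvw).
- rewrite !mnmDE ltn_add2r eqn_add2r !lowD => /orP[->//|/andP[-> h]].
  by rewrite (term_add tor _ h) orbT.
rewrite !mnm0E; case: posnP => //= ->.
have -> : low (0%MM : 'X_{1..m.+1}) = 0%MM by apply/mnmP => i; rewrite mnmE !mnm0E.
by case: tor => _ _ _ _ ->.
Qed.

Lemma elim_lm_emb (p : A) u : is_lm r p u -> is_lm elim_order (emb p) (wid u).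
Proof.
move=> [up uP]; split=> [|v]; first by rewrite mem_supp_emb.
move=> /supp_emb[e /uP h].
by rewrite e /elim_order !mnmwiden_ordmax eqxx !low_wid h.
Qed.

Lemma elim_lm_rel : is_lm elim_order (y ^+ 2 - emb M) y2.
Proof.
split; first by rewrite mcoeff_msupp mcoeff_yc_emb // oner_eq0.
move=> v /msuppB_le; rewrite mem_cat mpolyXn msuppX inE => /orP[/eqP->|].
  exact: (term_refl elim_orderP).
move=> /supp_emb[-> _]; rewrite /elim_order mnmwiden_ordmax.
by rewrite mulmnE mnm1E eqxx.
Qed.

Lemma low_degree_split (p : S) : (forall w, w \in msupp p -> (w ord_max < 2)%N) ->
  exists p0 p1, p = emb p0 + y * emb p1.
Proof.
move=> H; pose pe e := \sum_(w <- msupp p | w ord_max == e) p@_w *: 'X_[low w] : A.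
exists (pe 0%N), (pe 1%N); rewrite {1}(mpoly_yemb p) !(raddf_sum (@emb K m)) mulr_sumr.
rewrite (bigID (fun w : 'X_{1..m.+1} => w ord_max == 0%N)) /=; congr (_ + _).
  by apply: eq_bigr => w /eqP->; rewrite expr0 mul1r.
rewrite big_seq_cond [RHS]big_seq_cond; apply: eq_big => [w|w /andP[wp w0]].
  have [/H|//] := boolP (w \in msupp p); by case: (w ord_max) => [|[|]].
by have := H w wp; case: (w ord_max) w0 => [|[|]].
Qed.

Lemma groebner_glue G : groebner_basis r J G -> (forall g, g \in G -> homog_of_deg 2 g) ->
  has_quadratic_GB JH.
Proof.
move=> [GJ GB] G2; exists elim_order, (rcons (map (@emb K m) G) (y ^+ 2 - emb M)).
have tE := elim_orderP.
split=> //; first split.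
- move=> g; rewrite mem_rcons inE => /orP[/eqP ->|/mapP[g' /GJ Jg ->]].
    by apply: mem_ideal_gen; right.
  exact: glue_emb.
- move=> p Jp p0; have [w wP] := lm_exists tE p0.
  have [w2|w2] := leqP 2 (w ord_max).
    exists (y ^+ 2 - emb M), y2, w; split=> //; first by rewrite mem_rcons mem_head.
      exact: elim_lm_rel.
    by move=> i; rewrite mulmnE mnm1E; case: eqP => [<-|_]; rewrite ?mul1n.
  have [|q0 [q1 pE]] := @low_degree_split p.
    by move=> v /(wP.2)/orP[|/andP[/eqP-> _]]; lia.
  have [J0 J1] : J q0 /\ J q1 by apply: glue_split; rewrite -pE.
  have pc v : p@_v = (if v ord_max == 0%N then q0@_(low v) else 0) + (if v ord_max == 1%N then q1@_(low v) else 0).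
    by rewrite pE mcoeffD mcoeff_emb -(mcoeff_yemb 1) expr1.
  (* The coefficient in [p] of the power of y that occurs in its leading monomial. It lies in [J],
     and [elim_order] gives it the leading monomial [low w]. *)
  pose q := if w ord_max == 0%N then q0 else q1.
  have Jq : J q by rewrite /q; case: ifP.
  have qc u : q@_u = p@_(wid u + U_(ord_max) *+ w ord_max)%MM.
    rewrite pc max_split low_split /q; case: (w ord_max) w2 => [|[|]] //= _.
      by rewrite addr0.
    by rewrite add0r.
  have lq : is_lm r q (low w).
    split; first by rewrite mcoeff_msupp qc -mnm_split -mcoeff_msupp; case: wP.
    move=> v; rewrite mcoeff_msupp qc -mcoeff_msupp => /(wP.2).
    by rewrite /elim_order max_split low_split ltnn eqxx.
  have q_neq0 : q != 0 by apply: contraTneq (lm_coeff lq) => ->; rewrite mcoeff0 eqxx.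
  have [g [u [v [gG gu qv]]]] := GB q Jq q_neq0; rewrite -(lm_uniq tor lq qv) => uw.
  exists (emb g), (wid u), w; split=> //.
  + by rewrite mem_rcons inE map_f ?orbT.
  + exact: elim_lm_emb.
  move=> i; case: (unliftP ord_max i) => [j ->|->]; last by rewrite mnmwiden_ordmax.
  by rewrite lift_max_widen mnmwiden_widen; have := uw j; rewrite mnmE.
move=> g; rewrite mem_rcons inE => /orP[/eqP ->|/mapP[g' /G2 hg ->]]; last exact: homog_emb.
by apply: homogB; [apply: homog_yc | apply: homog_emb].
Qed.
End Extend.

(** * Restricting a quadratic Gröbner basis to the variables of L *)

Section Restrict.
Variables (r : rel 'X_{1..m.+1}) (G : seq S).
Hypotheses (tor : term_order r) (GB : groebner_basis r JH G).
Hypothesis G2 : forall g, g \in G -> homog_of_deg 2 g.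

Definition wid_order : rel 'X_{1..m} := fun u v => r (wid u) (wid v).
Local Notation rL := wid_order.

Lemma wid_orderP : term_order rL.
Proof.
rewrite /wid_order; split=> [u v|u v|u v w|u v w|u].
- exact/orP/term_total.
- by move=> uv vu; apply: inj_mnmwiden; apply: (term_anti tor).
- exact: (term_trans tor).
- by rewrite !mnmwidenD; apply: term_add.
by rewrite mnmwiden0; case: tor => _ _ _ _ ->.
Qed.

Lemma wid_lm_emb (p : A) w : is_lm rL p w -> is_lm r (emb p) (wid w).
Proof.
move=> [wp wP]; split=> [|v]; first by rewrite mem_supp_emb.
by move=> /supp_emb[e /wP h]; rewrite e.
Qed.

Lemma wid_lm_embV (p : A) w : is_lm r (emb p) w -> w = wid (low w) /\ is_lm rL p (low w).
Proof.
move=> [/supp_emb[wE lwp] wP]; split=> //; split=> // v vp.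
by rewrite /wid_order -wE; apply: wP; rewrite mem_supp_emb.
Qed.

Definition quadric_lm (u : 'X_{1..m}) : Prop :=
  exists s : A, [/\ J s, homog_of_deg 2 s & is_lm rL s u].

(** A basis element involving y^2 need not contain [M] itself, only some quadric [s] congruent to it
    modulo [J]; two such quadrics therefore differ by an element of [J]. *)
Lemma quadric_cases g : g \in G ->
  (exists2 s, J s & homog_of_deg 2 s /\ g = emb s) \/
  (exists t s, [/\ t != 0, J (M - s), homog_of_deg 2 s & g = t *: (y ^+ 2 - emb s)]).
Proof.
move=> gG; have [R [pi [_ pi_ker]]] := quotient_exists iJ (ideal_proper oJ).
have [s [t [Js hs gE]]] := quadric_glue_ideal (erefl _) pi_ker oM oJ hJ.2 (G2 gG) (GB.1 _ gG) hM.
have [t0|t0] := eqVneq t 0.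
  by left; exists s => //; split=> //; rewrite gE t0 scale0r addr0.
right; exists t, (M - t^-1 *: s); split=> //.
- by rewrite opprB addrC subrK; apply: idealZ.
- by apply: homogB => //; apply: homogZ.
have -> : emb (M - t^-1 *: s) = emb M - t^-1 *: emb s by rewrite (raddfB (@emb K m)) /= emb_Z.
rewrite gE opprD opprK addrA [RHS]scalerDr scalerA divff // scale1r; exact: addrC.
Qed.

Section Contradiction.
Variables (u : 'X_{1..m}) (s' : A).
Hypotheses (Js' : J (M - s')) (hs' : homog_of_deg 2 s') (us' : is_lm rL s' u).
Hypothesis yu : r y2 (wid u).

Let u0 : u != 0%MM.
Proof. by rewrite -mdeg_eq0 (hs' us'.1). Qed.

Lemma strip_exists (w : 'X_{1..m}) : exists z : nat * 'X_{1..m},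
  w = (u *+ z.1 + z.2)%MM /\ ~ mdivides u z.2.
Proof.
move: {2}(mdeg w).+1 (ltnSn (mdeg w)) => k; elim: k w => // k IH w wk.
have [uw|nuw] := classic (mdivides u w); last by exists (0%N, w); rewrite mulm0n add0m.
have wE : w = (u + (w - u))%MM by rewrite addmC submK //; apply/mnm_lepP.
have [|[j w'] /= [E H]] := IH (w - u)%MM.
  move: wk; rewrite {1}wE mdegD ltnS; apply: leq_trans.
  by rewrite -[X in (X < _)%N]add0n ltn_add2r lt0n mdeg_eq0.
by exists (j.+1, w'); split=> //=; rewrite mulmS -addmA -E.
Qed.

Definition strip w := proj1_sig (constructive_indefinite_description _ (strip_exists w)).

Lemma stripP w : w = (u *+ (strip w).1 + (strip w).2)%MM /\ ~ mdivides u (strip w).2.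
Proof. exact: (proj2_sig (constructive_indefinite_description _ (strip_exists w))). Qed.

(* Modulo [JH], replacing u^j by y^(2j) is replacing it by s'^j, which has the same leading monomial. *)
Definition yform w : 'X_{1..m.+1} := (wid (strip w).2 + U_(ord_max) *+ (2 * (strip w).1))%MM.
Definition sform w : A := s' ^+ (strip w).1 * 'X_[(strip w).2].

Lemma yform_inj : injective yform.
Proof.
move=> v w E; have := congr1 (fun z : 'X_{1..m.+1} => z ord_max) E.
have := congr1 (@low m) E; rewrite /yform !low_split !max_split => E2 E1.
have e1 : (strip v).1 = (strip w).1 by lia.
by rewrite (stripP v).1 (stripP w).1 e1 E2.
Qed.

Lemma sform_lm w : is_lm rL (sform w) w.
Proof.
rewrite [X in is_lm _ _ X](stripP w).1; apply: (lmM wid_orderP).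
  exact: (lm_exp wid_orderP).
exact: (lmX _ wid_orderP).
Qed.

Lemma sform_homog w : homog_of_deg (mdeg w) (sform w).
Proof.
rewrite [X in mdeg X](stripP w).1 mdegD mdegMn (hs' us'.1).
by apply: homogM; [apply: homog_exp | apply: homogX].
Qed.

Lemma sform_yform w : JH (emb (sform w) - 'X_[yform w]).
Proof.
rewrite X_split /yform max_split low_split /sform rmorphM rmorphXn /= -mulrBl mulrC.
case: iJH => _ JD JM; apply: (JM); rewrite exprM; elim: (strip w).1 => [|j IH].
  by rewrite !expr0 subrr; case: iJH.
have -> : emb s' ^+ j.+1 - (y ^+ 2) ^+ j.+1 =
    emb s' * (emb s' ^+ j - (y ^+ 2) ^+ j) + (y ^+ 2) ^+ j * (emb s' - y ^+ 2).
  by rewrite !exprS; ring.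
apply: JD; apply: JM => //.
have -> : emb s' - y ^+ 2 = - (y ^+ 2 - emb M) - emb (M - s') by rewrite raddfB /=; ring.
apply: idealB => //; last exact: glue_emb.
by apply: idealN => //; apply: mem_ideal_gen; right.
Qed.

Definition normal (w : 'X_{1..m}) : Prop := forall v, quadric_lm v -> ~ mdivides v w.

Lemma normal_form d w : mdeg w = d -> forall p, homog_of_deg d p -> is_lm rL p w ->
  exists h, [/\ JH (emb p - h),
    forall z, z \in msupp h -> exists v, [/\ z = yform v, normal v & rL v w]
    & normal w -> h@_(yform w) != 0].
Proof.
have tL := wid_orderP; move: w; apply: (degree_term_ind tL) => w wd IH p hp wp.
have [JH0 JHD JHM] := iJH.
have next q : homog_of_deg d q -> (forall v, v \in msupp q -> rL v w /\ v <> w) ->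
    exists h, [/\ JH (emb q - h),
      forall z, z \in msupp h -> exists v, [/\ z = yform v, normal v & rL v w]
      & h@_(yform w) = 0].
  move=> hq qP; have [->|q0] := eqVneq q 0.
    by exists 0; rewrite raddf0 subrr mcoeff0; split=> // z; rewrite msupp0.
  have [w' w'P] := lm_exists tL q0; have [w'w ne] := qP w' w'P.1.
  have [h [Jh hP _]] := IH w' (hq _ w'P.1) w'w ne q hq w'P.
  exists h; split=> // [z /hP[v [-> nv vw']]|].
    by exists v; split=> //; apply: (term_trans tL vw' w'w).
  apply/eqP; rewrite mcoeff_eq0; apply/negP => /hP[v [/yform_inj <- _ ww']].
  by apply: ne; apply: (term_anti tL).
have [nw|] := classic (normal w); last first.
  move=> nn; have [v [[s [Js hs sv]] vw]] : exists v, quadric_lm v /\ mdivides v w.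
    by apply: NNPP => H; apply: nn => v qv vw; apply: H; exists v.
  have [c [q [qE hq qP]]] := reduce_lm tL hp wd wp.2 hs sv vw.
  have [h [Jh hP _]] := next q hq qP; exists h; split=> //.
  have -> : emb p - h = emb q - h + emb (c *: ('X_[w - v] * s)).
    by rewrite qE (raddfB (@emb K m)) /=; ring.
  apply: JHD => //; apply: glue_emb; apply: idealZ => //.
  by case: iJ => _ _; apply.
(* The leading monomial of [sform w] is [w] itself, so the multiplier is the monomial 1. *)
have [] := reduce_lm tL hp wd wp.2 (sform_homog (w := w)) (sform_lm w) (fun i => leqnn (w i)).
move=> c [q [qE hq qP]]; have [h [Jh hP h0]] := next q hq qP.
have ww : (w - w)%MM = 0%MM by apply/mnmP => i; rewrite mnmBE mnm0E subnn.
rewrite ww mpolyX0 mul1r in qE.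
have c0 : c != 0.
  apply/eqP => c0; have [_] : rL w w /\ w <> w by apply: qP; rewrite qE c0 scale0r subr0; case: wp.
  by [].
exists (h + c *: 'X_[yform w]); split=> [|z|_].
- have -> : emb p - (h + c *: 'X_[yform w]) = emb q - h + c *: (emb (sform w) - 'X_[yform w]).
    by rewrite qE (raddfB (@emb K m)) /= emb_Z scalerBr; ring.
  by apply: JHD => //; apply: idealZ => //; apply: sform_yform.
- move=> /msuppD_le; rewrite mem_cat => /orP[/hP//|/msuppZ_le].
  rewrite msuppX inE => /eqP ->; exists w; split=> //; exact: (term_refl tL).
by rewrite mcoeffD h0 add0r mcoeffZ mcoeffX eqxx mulr1.
Qed.

Lemma quadric_lm_diff s2 a : J (M - s2) -> homog_of_deg 2 s2 -> is_lm rL (s2 - s') a \/ is_lm rL (s' - s2) a ->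
  quadric_lm a.
Proof.
move=> J2 h2 [H|H]; [exists (s2 - s') | exists (s' - s2)]; split=> //; try exact: homogB.
  have -> : s2 - s' = (M - s') - (M - s2) by ring.
  exact: idealB.
have -> : s' - s2 = (M - s2) - (M - s') by ring.
exact: idealB.
Qed.

(** Otherwise the normal form [h] of [p] is a nonzero element of [JH], and a basis element [g]
    divides its leading monomial [yform v], with [v] normal. If [g] comes from [J], normality of [v]
    is violated. If [g] is y^2 - [s2] up to a scalar, the difference of [s2] and [s'] lies in [J],
    and its leading monomial is either [u], which divides [w], or that of [s2], which divides
    [v]. *)
Lemma no_normal_lm d p w : J p -> homog_of_deg d p -> is_lm rL p w -> normal w ->
  ~ mdivides u w.
Proof.
move=> Jp hp wp nw uw; have tL := wid_orderP.
have nqu : ~ quadric_lm u by move=> /nw; apply.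
have [h [Jh hP /(_ nw) hn]] := normal_form (hp _ wp.1) hp wp.
have JHh : JH h.
  have -> : h = emb p - (emb p - h) by rewrite opprB addrC subrK.
  by apply: idealB => //; apply: glue_emb.
have h0 : h != 0 by apply: contraNneq hn => ->; rewrite mcoeff0.
have [g [u2 [z [gG gu hz u2z]]]] := GB.2 h JHh h0.
have [v [zE nv _]] := hP z hz.1; rewrite zE in u2z.
have lowdiv a : mdivides (wid a) (yform v) -> mdivides a (strip v).2.
  move=> H i; have := H (widen_ord (leqnSn m) i); rewrite mnmwiden_widen /yform.
  by rewrite mnmDE mnmwiden_widen mulmnE mnm1E -val_eqE /= gtn_eqF // mul0n addn0.
have strip_div a : mdivides a (strip v).2 -> mdivides a v.
  by move=> H i; rewrite {1}(stripP v).1 mnmDE (leq_trans (H i)) // leq_addl.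
have [[s Js [hs gE]]|[t [s2 [t0 Js2 hs2 gE]]]] := quadric_cases gG.
  rewrite gE in gu; have [u2E lms] := wid_lm_embV gu.
  rewrite u2E in u2z; apply: (nv (low u2)); first by exists s.
  exact/strip_div/lowdiv.
have gsupp a : (a \in msupp g) = (a \in msupp (y ^+ 2 - emb s2)).
  by rewrite !mcoeff_msupp gE mcoeffZ mulf_eq0 (negbTE t0).
have s2P a : a \in msupp s2 -> r (wid a) u2.
  move=> as2; apply: gu.2; rewrite gsupp mcoeff_msupp mcoeffB mpolyXn mcoeffX mcoeff_emb.
  rewrite mnmwiden_ordmax eqxx low_wid.
  case: (y2 =P wid a) => [/(congr1 (fun z : 'X_{1..m.+1} => z ord_max))|_].
    by rewrite mnmwiden_ordmax mulmnE mnm1E eqxx.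
  by rewrite sub0r oppr_eq0 -mcoeff_msupp.
(* Here [u] is the leading monomial of [s' - s2], a quadric of [J], against normality of [w]. *)
have u_s2 : u \notin msupp s2 -> (forall a, a \in msupp s2 -> r (wid a) (wid u)) -> False.
  move=> us2 H; apply: nqu; apply: (quadric_lm_diff Js2 hs2); right.
  by apply: lm_sub => //; apply: memN_msupp_eq0.
have : u2 \in msupp (y ^+ 2 - emb s2) by rewrite -gsupp; case: gu.
move=> /msuppB_le; rewrite mem_cat mpolyXn msuppX inE => /orP[/eqP u2E|/supp_emb[u2E lu2]].
  apply: u_s2 => [|a /s2P]; last by rewrite u2E => /(term_trans tor); apply.
  apply/negP => /s2P; rewrite u2E => /(term_anti tor yu).
  move=> /(congr1 (fun z : 'X_{1..m.+1} => z ord_max)).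
  by rewrite mnmwiden_ordmax mulmnE mnm1E eqxx.
rewrite u2E in u2z s2P; set a := low u2 in u2z s2P lu2.
have adiv := lowdiv _ u2z.
have au : a <> u by move=> e; apply: (stripP v).2; rewrite -e.
have [lau|lua] := term_total tL a u.
  apply: u_s2 => [|b /s2P ba]; last exact: (term_trans tor ba lau).
  by apply/negP => /s2P ua; apply: au; apply: (term_anti tL).
apply: (nv a); last exact: strip_div.
apply: (quadric_lm_diff Js2 hs2); left; apply: lm_sub.
- by split=> // b /s2P.
- by move=> b /us'.2 bu; apply: (term_trans tL bu lua).
by apply/eqP; rewrite mcoeff_eq0; apply/negP => /us'.2 au'; apply: au; apply: (term_anti tL).
Qed.
End Contradiction.

(** Were [w] normal, only a basis element y^2 - [s] with y-free leading monomial could divide it.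
    That monomial then serves as [u], and y^2 lies below it, which is the situation excluded by
    [no_normal_lm]. *)
Lemma quadric_lm_divides p w : J p -> is_lm rL p w -> exists2 v, quadric_lm v & mdivides v w.
Proof.
move=> Jp0 wp0; apply: NNPP => H.
have {H}nw : normal w by move=> v qv vw; apply: H; exists v.
pose d := mdeg w; have wp := lm_hc wp0 (erefl d); move: (hJ.2 d p Jp0) (@hc_homog _ _ d p) wp.
move: (pihomog _ _ p) => {Jp0 wp0}p Jp hp wp.
have lw := wid_lm_emb wp.
have p0 : emb p != 0 by apply: contraTneq (lm_coeff lw) => ->; rewrite mcoeff0 eqxx.
have [g [u0 [v [gG gu hv]]]] := GB.2 _ (glue_emb Jp) p0; rewrite -(lm_uniq tor lw hv) => uw.
have u0max : u0 ord_max = 0%N.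
  by apply/eqP; rewrite -leqn0; have := uw ord_max; rewrite mnmwiden_ordmax.
have u0E : u0 = wid (low u0) by apply: low_max_inj; rewrite ?low_wid // mnmwiden_ordmax.
have luw : mdivides (low u0) w.
  by move=> i; have := uw (widen_ord (leqnSn m) i); rewrite mnmwiden_widen mnmE.
have [[s Js [hs gE]]|[t [s [t0 Js hs gE]]]] := quadric_cases gG.
  rewrite gE in gu; have [_ lms] := wid_lm_embV gu.
  by apply: (nw (low u0)) => //; exists s.
have gsupp a : (a \in msupp g) = (a \in msupp (y ^+ 2 - emb s)).
  by rewrite !mcoeff_msupp gE mcoeffZ mulf_eq0 (negbTE t0).
have y2g : y2 \in msupp g by rewrite gsupp mcoeff_msupp mcoeff_yc_emb // oner_eq0.
have cf a : (y ^+ 2 - emb s)@_(wid a) = - s@_a.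
  rewrite mcoeffB mpolyXn mcoeffX mcoeff_emb mnmwiden_ordmax eqxx low_wid.
  case: (y2 =P wid a) => [/(congr1 (fun z : 'X_{1..m.+1} => z ord_max))|_]; last by rewrite sub0r.
  by rewrite mnmwiden_ordmax mulmnE mnm1E eqxx.
apply: (no_normal_lm Js hs _ _ Jp hp wp nw luw).
  split=> [|a as']; first by rewrite mcoeff_msupp -oppr_eq0 -cf -u0E -mcoeff_msupp -gsupp; case: gu.
  rewrite /wid_order -u0E; apply: gu.2; rewrite gsupp mcoeff_msupp cf oppr_eq0.
  by rewrite -mcoeff_msupp.
by rewrite -u0E; apply: gu.2.
Qed.

Lemma groebner_restrict : has_quadratic_GB J.
Proof.
have tL := wid_orderP.
(* Leading monomials of quadrics have degree below 3, so they are finite in number; one quadric of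
   [J] is taken for each that occurs. *)
have [G' [G'P G'lm]] : exists G' : seq A, (forall g, g \in G' -> J g /\ homog_of_deg 2 g) /\
    forall v, v \in map val (enum {: 'X_{1..m < 3}}) -> quadric_lm v ->
      exists2 g, g \in G' & is_lm rL g v.
  elim: (map _ _) => [|v vs [G' [G'P G'lm]]].
    by exists [::]; split.
  have [[s [Js hs sv]]|nq] := classic (quadric_lm v).
    exists (s :: G'); split=> [g|v'].
      by rewrite inE => /orP[/eqP ->|/G'P].
    rewrite inE => /orP[/eqP -> _|/G'lm H /H[g gG gv]]; first by exists s; rewrite ?mem_head.
    by exists g; rewrite // inE gG orbT.
  exists G'; split=> // v'; rewrite inE => /orP[/eqP -> /nq//|]; exact: G'lm.
exists rL, G'; split=> //; last by move=> g /G'P[].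
split=> [g /G'P[]//|p Jp p0]; have [w wp] := lm_exists tL p0.
have [v qv vw] := quadric_lm_divides Jp wp.
have v3 : (mdeg v < 3)%N by case: qv => s [_ hs sv]; rewrite (hs _ sv.1).
have [|g gG gv] := G'lm v _ qv.
  by apply/mapP; exists (BMultinom v3); rewrite ?mem_enum.
by exists g, v, w.
Qed.
End Restrict.
End GroebnerGlue.

(** Extensionality allows the tangent ideal to be rewritten inside all the properties of ideals at
    once. *)
Lemma same_ideal_eq (K : fieldType) n (I J : {mpoly K[n]} -> Prop) : same_ideal I J -> I = J.
Proof. by move=> E; apply: functional_extensionality => p; apply: propositional_extensionality. Qed.

Theorem theorem2p3 (K : fieldType) (m : nat) (L : nat -> Prop) (a : 'I_m -> nat)
    (c l : nat) (lam : 'I_m -> nat) (k : nat) :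
  numerical_semigroup L ->
  injective a ->
  (forall x, min_gen L x <-> exists i, a i = x) ->
  (1 < c)%N -> coprime c l ->
  L l -> ~ min_gen L l ->
  expr_of a l lam -> ord_spec a l k -> (\sum_(i < m) lam i)%N = k ->
  (c <= k)%N ->
  let IL := @toric_ker K m a in
  let IH := @toric_ker K m.+1 (glue_gens c l a) in
  let f := @glue_rel K m c lam in
  [/\ same_ideal (tangent_ideal IH)
        (ideal_gen (fun q => (exists p, tangent_ideal IL p /\ q = emb p)
                             \/ q = init_form f)),
      quadratic_ideal (tangent_ideal IH) <->
        c = 2%N /\ quadratic_ideal (tangent_ideal IL),
      koszul_quot (tangent_ideal IH) <->
        c = 2%N /\ koszul_quot (tangent_ideal IL)
    & has_quadratic_GB (tangent_ideal IH) <->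
        c = 2%N /\ has_quadratic_GB (tangent_ideal IL)].
Proof.
move=> nL ia minL c1 cl _ _ lE _ <- ck IL IH f.
have c0 := ltnW c1.
have TE := @tangent_glue K _ _ _ _ _ c0 cl lE ck.
have hJ : homog_ideal (tangent_ideal IL) := tangent_homog_ideal IL.
have oJ : forall p, tangent_ideal IL p -> ordge 2 p := tangent_toric_ordge2 nL ia minL.
have MP := @glue_muP K m c lam.
have hJH := tangent_homog_ideal IH.
split; first by rewrite /f (init_glue_rel K c0 ck).
all: rewrite /IH in hJH *; rewrite (same_ideal_eq TE) in hJH *.
- split=> [qH|[c2]]; last by subst c; apply: quadratic_glue_ideal.
  have c2 := quadratic_glue_c c1 oJ MP qH; split=> //; subst c.
  exact: quadratic_of_glue_ideal hJ oJ MP qH.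
- split=> [kH|[c2]]; last by subst c; move/(koszul_glue_ideal hJ oJ MP).
  have c2 := koszul_glue_c c1 oJ MP kH; split=> //; subst c.
  exact/(koszul_glue_ideal hJ oJ MP).
split=> [[r [G [tor GB G2]]]|[c2 [r [G [tor GB G2]]]]]; last first.
  by subst c; apply: (groebner_glue hJ oJ MP tor GB G2).
(* A Gröbner basis of quadrics generates, so c = 2 is inherited from the quadratic case. *)
have c2 := quadratic_glue_c c1 oJ MP (groebner_quadratic tor hJH GB G2).
split=> //; subst c; exact: (groebner_restrict hJ oJ MP tor GB G2).
Qed.
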